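(* For metric 4PP, there is a polynomial-time $14/17$-approximation algorithm.
   Context: A metric graph is an undirected complete graph $G=(V,E)$ on $n$ vertices with a non-negative edge weight function $w$ satisfying the triangle inequality; the weight of a set of edges is the sum of their weights. A $4$-path is a simple path on exactly $4$ distinct vertices. When $4$ divides $n$, a $4$-path packing is a set of $n/4$ vertex-disjoint $4$-paths covering all vertices. Metric 4PP: given a metric graph with $n$ divisible by $4$, find a $4$-path packing of maximum total weight. A $\rho$-approximation algorithm outputs on every instance a feasible solution of weight at least $\rho$ times the optimum. *)

(* Defs.v *)
From HB Require Import structures.
From mathcomp Require Import all_boot all_order all_algebra.

Set Implicit Arguments.
Unset Strict Implicit.
Unset Printing Implicit Defensive.

Import Order.TTheory GRing.Theory Num.Theory.

Local Open Scope ring_scope.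

(** * Metric graphs and 4-path packings *)

(* Weights are rational so that an instance has a finite binary encoding.
   [weight u v] with [u != v] is the weight of the edge {u, v}.  There are no
   loops; the convention [weight u u = 0] fixes the irrelevant diagonal, and
   adds nothing to the triangle inequality for distinct vertices. *)
Record metric_graph := MetricGraph {
  nvertices : nat;
  weight : 'I_nvertices -> 'I_nvertices -> rat;
  weight_diag : forall u, weight u u = 0;
  weight_sym : forall u v, weight u v = weight v u;
  weight_ge0 : forall u v, 0 <= weight u v;
  weight_triangle : forall u v x, weight u x <= weight u v + weight v x
}.

Section Packing.

Variable G : metric_graph.

(* The graph being complete, every sequence of distinct vertices is a simple
   path.  A path is given by either of its two traversals. *)
Definition four_path (p : 4.-tuple 'I_(nvertices G)) : bool := uniq p.

Definition path_edges (p : seq 'I_(nvertices G)) := zip p (behead p).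

Definition path_weight (p : seq 'I_(nvertices G)) : rat :=
  \sum_(e <- path_edges p) weight e.1 e.2.

(* Vertex-disjointness ensures that no path occurs in both directions. *)
Definition four_path_packing (P : {set 4.-tuple 'I_(nvertices G)}) : bool :=
  [&& #|P| == (nvertices G %/ 4)%N,
      [forall p in P, four_path p],
      [forall p in P, forall q in P, (p != q) ==> [disjoint p & q]]
    & [forall v, exists p in P, v \in p]].

Definition packing_weight (P : {set 4.-tuple 'I_(nvertices G)}) : rat :=
  \sum_(p in P) path_weight p.

(* The default value 0 is harmless, weights being nonnegative. *)
Definition opt : rat :=
  \big[Order.max/0]_(P : {set 4.-tuple 'I_(nvertices G)} | four_path_packing P)
     packing_weight P.

End Packing.

(** * Random access programs under the logarithmic cost criterion *)

(* The memory consists of integer arrays of unbounded length, named by natural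
   numbers.  A scalar variable is an array used at index 0 only. *)
Definition memory := nat -> int -> int.

Definition update (m : memory) (a : nat) (i z : int) : memory :=
  fun b j => if (b == a) && (j == i) then z else m b j.

Inductive binop := Add | Sub | Mul | Div | Leq.

Inductive expr :=
  | Const of int
  | Read of nat & expr                (* Read a e is the cell a[e] *)
  | Binop of binop & expr & expr.

Inductive cmd :=
  | Skip
  | Assign of nat & expr & expr       (* Assign a e1 e2 is a[e1] := e2 *)
  | Seq of cmd & cmd
  | If of expr & cmd & cmd
  | While of expr & cmd.

Definition eval_binop (o : binop) (x y : int) : int :=
  match o with
  | Add => x + y
  | Sub => x - y
  | Mul => x * y
  | Div => (x %/ y)%Z
  | Leq => (x <= y)%R : nat
  end.

Fixpoint eval (m : memory) (e : expr) : int :=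
  match e with
  | Const z => z
  | Read a e1 => m a (eval m e1)
  | Binop o e1 e2 => eval_binop o (eval m e1) (eval m e2)
  end.

(* The length of the binary expansion of |z|, plus one for the sign. *)
Definition bitsize (z : int) : nat := (up_log 2 `|z|.+1).+1.

(* Every value that is computed, read, or used as an address is charged its
   bit length; unit cost would let repeated squaring produce integers of
   exponential length in linear time. *)
Fixpoint eval_cost (m : memory) (e : expr) : nat :=
  (bitsize (eval m e) +
   match e with
   | Const _ => 0
   | Read _ e1 => eval_cost m e1
   | Binop _ e1 e2 => eval_cost m e1 + eval_cost m e2
   end)%N.

(* [exec c m m' t]: started in memory [m], the program [c] halts in memory
   [m'] after a computation of total cost [t]. *)
Inductive exec : cmd -> memory -> memory -> nat -> Prop :=
  | ExecSkip m : exec Skip m m 1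
  | ExecAssign m a e1 e2 :
      exec (Assign a e1 e2) m (update m a (eval m e1) (eval m e2))
        (eval_cost m e1 + eval_cost m e2).+1
  | ExecSeq c1 c2 m1 m2 m3 t1 t2 :
      exec c1 m1 m2 t1 -> exec c2 m2 m3 t2 ->
      exec (Seq c1 c2) m1 m3 (t1 + t2).+1
  | ExecIfTrue e c1 c2 m1 m2 t :
      eval m1 e != 0 -> exec c1 m1 m2 t ->
      exec (If e c1 c2) m1 m2 (eval_cost m1 e + t).+1
  | ExecIfFalse e c1 c2 m1 m2 t :
      eval m1 e = 0 -> exec c2 m1 m2 t ->
      exec (If e c1 c2) m1 m2 (eval_cost m1 e + t).+1
  | ExecWhileFalse e c m :
      eval m e = 0 -> exec (While e c) m m (eval_cost m e).+1
  | ExecWhileTrue e c m1 m2 m3 t1 t2 :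
      eval m1 e != 0 -> exec c m1 m2 t1 -> exec (While e c) m2 m3 t2 ->
      exec (While e c) m1 m3 (eval_cost m1 e + t1 + t2).+1.

Lemma exec_functional c m m1 m2 t1 t2 :
  exec c m m1 t1 -> exec c m m2 t2 -> m1 = m2 /\ t1 = t2.
Proof.
move=> H; elim: H m2 t2 => {c m m1 t1}.
- by move=> m m2 t2 H; inversion H.
- by move=> m a e1 e2 m2 t2 H; inversion H.
- move=> c1 c2 m1 m2 m3 t1 t2 _ IH1 _ IH2 m4 t4 H.
  inversion H as [| |? ? ? m5 ? t5 t6 E1 E2| | | |]; subst.
  by have [? ?] := IH1 _ _ E1; subst; have [? ?] := IH2 _ _ E2; subst.
- move=> e c1 c2 m1 m2 t /eqP ne _ IH m3 t3 H; inversion H; subst=> //.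
  by match goal with E : exec c1 _ _ _ |- _ => have [? ?] := IH _ _ E end; subst.
- move=> e c1 c2 m1 m2 t e0 _ IH m3 t3 H; inversion H; subst.
    by match goal with E : is_true (_ != _) |- _ => rewrite e0 eqxx in E end.
  by match goal with E : exec c2 _ _ _ |- _ => have [? ?] := IH _ _ E end; subst.
- move=> e c m e0 m2 t2 H; inversion H; subst=> //.
  by match goal with E : is_true (_ != _) |- _ => rewrite e0 eqxx in E end.
- move=> e c m1 m2 m3 t1 t2 /eqP ne _ IH1 _ IH2 m4 t4 H.
  inversion H as [| | | | | |? ? ? m5 ? t5 t6 _ E1 E2]; subst=> //.
  by have [? ?] := IH1 _ _ E1; subst; have [? ?] := IH2 _ _ E2; subst.
Qed.

(** * Algorithms for metric 4PP *)

(* Cell [u * n + v] of an [n * n] table stored row by row, and 0 outside of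
   the table. *)
Definition table_cell (n : nat) (f : 'I_n -> 'I_n -> int) (i : int) : int :=
  if i is Posz k then
    if (insub (k %/ n)%N, insub (k %% n)%N) is (Some u, Some v) then f u v
    else 0
  else 0.

(* Array 0 holds the number of vertices, arrays 1 and 2 the numerators and the
   denominators of the weights; all other cells are 0. *)
Definition input (G : metric_graph) : memory := fun a i =>
  match a with
  | 0%N => if i == 0 then (nvertices G)%:Z else 0
  | 1%N => table_cell (fun u v => numq (@weight G u v)) i
  | 2%N => table_cell (fun u v => denq (@weight G u v)) i
  | _ => 0
  end.

Definition input_size (G : metric_graph) : nat :=
  (bitsize (nvertices G)%:Z +
   \sum_(u < nvertices G) \sum_(v < nvertices G)
      (bitsize (numq (weight u v)) + bitsize (denq (weight u v))))%N.

(* The solution is read off array 3: cells 4j, ..., 4j+3 list the vertices of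
   the j-th path in the order of a traversal. *)
Definition output (G : metric_graph) (m : memory)
    (P : {set 4.-tuple 'I_(nvertices G)}) : Prop :=
  exists2 path : 'I_(nvertices G %/ 4) -> 4.-tuple 'I_(nvertices G),
    forall (j : 'I_(nvertices G %/ 4)) (i : 'I_4),
      m 3%N (4 * j + i)%N%:Z = (tnth (path j) i)%:Z
    & P = [set path j | j : 'I_(nvertices G %/ 4)].

Definition approximation_algorithm (rho : rat) (A : cmd) : Prop :=
  forall G : metric_graph, (4 %| nvertices G)%N ->
  exists m t (P : {set 4.-tuple 'I_(nvertices G)}),
    [/\ exec A (input G) m t, output m P, four_path_packing P
      & rho * opt G <= packing_weight P].

Definition polynomial_time (A : cmd) : Prop :=
  exists p : {poly nat}, forall G : metric_graph, (4 %| nvertices G)%N ->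
  exists m t, exec A (input G) m t /\ (t <= p.[input_size G])%N.

(* Main.v *)
Require Import Defs.
From HB Require Import structures.
From mathcomp Require Import all_boot all_order perm all_algebra.
From mathcomp Require Import zify ring lra.

Set Implicit Arguments.
Unset Strict Implicit.
Unset Printing Implicit Defensive.

Import Order.TTheory GRing.Theory Num.Theory.

(** The algorithm rounds the weights to integers and performs a local search
    over the layouts of the vertices in blocks of four, for three objectives:
    the end edges of the paths first and the middle edges second, the middle
    edges first and the end edges second, and the total weight.  A step changes
    boundedly many positions, and the best of the three local optima is
    returned.  The ratio is [5/6 - eps].

    - The end edges, or the middle edges, of a local optimum [s] form a matching
      that is nearly as heavy as any other: otherwise a short segment of the
      union of the two matchings would improve it.
    - When the ends come first, the middle edges are in addition nearly half of
      a maximum matching of the graph in which the end edges are contracted.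
      A fractional matching of weight [Gamma = sum w(P) / 4], where a path [P]
      both of whose end edges are contracted counts with its middle edge
      instead, lies below this maximum by Edmonds' description of the matching
      polytope.  So the first optimum weighs almost [alpha + Gamma], [alpha]
      being the weight of the end edges of an optimal packing.
    - When the middle edges come first, they weigh almost as much as the
      heaviest edges of the optimal paths, and by the triangle inequality the
      end edges, which can be swapped, weigh as much again.
    - Two thirds of the first bound plus one third of the second dominate [5/6]
      of the weight of each optimal path.  If there are few vertices, a local
      optimum for the total weight is optimal. *)

(** * Matchings and fractional matchings *)

(** The delicate step is the bound by [Gamma]. A path edge inside a contracted edge disappears from
    the contracted graph, so the values 1/4 on the surviving path edges do not pay for it. Its node,
    however, still has capacity 1/2 to spare, its demand. Spread over the edges to the other nodes,
    this demand recovers about 1/4 of the lost edge: by the triangle inequality every other node is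
    joined to one of its two ends by an edge of at least half its weight. The spread has to respect
    the capacities of the other nodes, so it is proportional to what they have left, and the odd set
    constraints, so everything is first scaled by [1 - e]. This needs at least [4 / e^2] nodes,
    which is why instances of bounded size are left to a third objective. A path with both end edges
    contracted fills its two nodes completely, so its middle edge may carry the value 1. The gap
    between 5/6 and 14/17 absorbs three losses: the factor [L / (L + 2)] of local search, the
    scaling by [1 - e], and the rounding of the weights. *)

Section Involutions.

Variable T : finType.
Implicit Types (f g : T -> T).

(** An orbit of two points contributes twice the value at its member of smaller rank, a fixed point
    contributes 0. *)
Lemma even_sum_involution f (F : T -> nat) : involutive f ->
  (forall v, F (f v) = F v) -> (forall v, f v = v -> F v = 0) -> ~~ odd (\sum_v F v).
Proof.
move=> fK Ff F0.
pose lt v := enum_rank v < enum_rank (f v).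
rewrite (bigID lt) /=.
have -> : \sum_(v | ~~ lt v) F v = \sum_(v | lt v) F v.
  rewrite (bigID (fun v => f v == v)) /= big1; last by move=> v /andP[_ /eqP /F0].
  rewrite add0n (reindex_inj (can_inj fK)) /=.
  apply: eq_big => [v|v _]; last exact: Ff.
  rewrite /lt /= fK; case: eqVneq => [<-|ne]; rewrite /= ?andbF ?ltnn // andbT -leqNgt leq_eqVlt.
  suff -> : (enum_rank v == enum_rank (f v) :> nat) = false by [].
  by apply/negbTE; apply: contraNneq ne => /ord_inj/enum_rank_inj/eqP.
by rewrite addnn odd_double.
Qed.

Lemma even_card_involution f (A : {set T}) : involutive f ->
  (forall v, (f v \in A) = (v \in A)) -> (forall v, v \in A -> f v != v) -> ~~ odd #|A|.
Proof.
move=> fK fA nfA; rewrite -sum1_card big_mkcond /=.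
apply: (even_sum_involution fK) => v; rewrite ?fA // => fv.
by case: ifP => // /nfA; rewrite fv eqxx.
Qed.

(* [f] and [g] generate a dihedral group; as [g] fixes [t], the orbit of [t] is
   the set of the [(g \o f)^i t]. *)
Section Dihedral.

Variables (f g : T -> T) (t : T).
Hypotheses (fK : involutive f) (gK : involutive g) (gt : g t = t).

Definition rot_ v := g (f v).
Definition dihedral_orbit := [set v | fconnect rot_ t v].

Lemma rot_inj : injective rot_.
Proof. exact: inj_comp (can_inj gK) (can_inj fK). Qed.

Lemma iter_rot_inj m : injective (iter m rot_).
Proof. by elim: m => // m IH a b /= /rot_inj /IH. Qed.

(** The reflection [f] conjugates the rotation to its inverse, and [rot_ (f t) = g t = t]. *)
Lemma iter_rot_refl i : iter i.+1 rot_ (f (iter i rot_ t)) = t.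
Proof.
elim: i => [|i IH]; first by rewrite /= /rot_ fK.
transitivity (iter i.+1 rot_ (f (iter i rot_ t))) => //.
rewrite iterSr [in LHS]iterS; congr (iter i.+1 rot_ _).
by rewrite /rot_ fK gK.
Qed.

Lemma dihedral_orbit_f v : v \in dihedral_orbit -> f v \in dihedral_orbit.
Proof.
rewrite !inE => /iter_findex <-.
rewrite (fconnect_sym rot_inj).
have := fconnect_iter rot_ (findex rot_ t v).+1 (f (iter (findex rot_ t v) rot_ t)).
by rewrite iter_rot_refl.
Qed.

Lemma dihedral_orbit_g v : v \in dihedral_orbit -> g v \in dihedral_orbit.
Proof.
move=> /dihedral_orbit_f; rewrite !inE => tv.
have -> : g v = rot_ (f v) by rewrite /rot_ fK.
exact: connect_trans tv (fconnect1 _ _).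
Qed.

Lemma iter_fix_mul h (u : T) i m : iter i h u = u -> iter (i * m) h u = u.
Proof. by move=> hu; elim: m => [|m IH]; rewrite ?muln0 // mulnS iterD IH. Qed.

(** The alternating path that starts at [t] has only one other end. If [f] fixes the i-th iterate of
    [t], then 2i+1 is a period of [t]. Given two such indices i <= j, also 2(j-i) is a period; as
    2i+1 is odd, j-i is one as well. *)
Lemma dihedral_orbit_fix_uniq a b : a \in dihedral_orbit -> b \in dihedral_orbit ->
  f a = a -> f b = b -> a = b.
Proof.
rewrite !inE => /iter_findex <- /iter_findex <-.
move: (findex _ _ a) (findex _ _ b) => i j.
wlog le_ij : i j / i <= j.
  by move=> W fi fj; case: (leqP i j) => [|/ltnW] le; [|symmetry]; apply: W.
have key l : f (iter l rot_ t) = iter l rot_ t -> iter (2 * l).+1 rot_ t = t.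
  by move=> fl; rewrite -{2}(iter_rot_refl l) fl -iterD addSn mul2n addnn.
move=> /key fi /key fj.
have e2 : iter (2 * (j - i)) rot_ t = t.
  apply: (iter_rot_inj (m := (2 * i).+1)); rewrite fi -iterD -[RHS]fj.
  by congr (iter _ rot_ t); lia.
have e1 : iter (j - i) rot_ t = t.
  rewrite -{2}(iter_fix_mul (j - i) fi).
  have -> : (2 * i).+1 * (j - i) = (j - i) + 2 * (j - i) * i by lia.
  by rewrite iterD (iter_fix_mul _ e2).
by rewrite -(subnKC le_ij) iterD e1.
Qed.

End Dihedral.

End Involutions.

(** * Gallai's lemma for maximum weight matchings *)

Section GallaiComponent.

Variables (T : finType) (w : T -> T -> nat).
Hypotheses (wC : forall a b, w a b = w b a) (w0 : forall a, w a a = 0).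
Implicit Types (f g h : {ffun T -> T}) (a b u v : T).

(** Matchings are involutions, with the unmatched vertices as fixed points; every edge is counted
    from both of its ends. *)
Definition mweight (w : T -> T -> nat) (f : T -> T) := \sum_v w v (f v).

Lemma mweight_even f : involutive f -> ~~ odd (mweight w f).
Proof.
move=> fK; apply: (even_sum_involution fK) => v; last by move->; rewrite w0.
by rewrite fK wC.
Qed.

Definition proper f := [forall v, (f v == v) || (0 < w v (f v))].

Definition normalize f : {ffun T -> T} := [ffun v => if 0 < w v (f v) then f v else v].

Lemma normalizeK f : involutive f -> involutive (normalize f).
Proof.
move=> fK v; rewrite !ffunE; case wv: (0 < w v (f v)); last by rewrite wv.
by rewrite fK wC wv.
Qed.

Lemma normalize_proper f : proper (normalize f).
Proof. by apply/forallP => v; rewrite ffunE; case: ifP => [->|]; rewrite ?orbT ?eqxx. Qed.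

Lemma normalize_fix f v : w v (f v) = 0 -> normalize f v = v.
Proof. by rewrite ffunE => ->. Qed.

Variable K : {set T}.
Hypothesis Kclosed : forall a b, 0 < w a b -> (a \in K) = (b \in K).

Definition wK a b := w a b - ((a \in K) && (b \in K)).

Definition covered f := [set v in K | 0 < w v (f v)].

(** An edge of positive weight has both ends in [K] or none, so lowering the weights costs exactly
    one at each covered vertex. *)
Lemma mweight_wK f : mweight w f = mweight wK f + #|covered f|.
Proof.
rewrite /mweight -sum1_card (big_mkcond (mem (covered f))) -big_split /=.
apply: eq_bigr => v _; rewrite /wK inE.
case: (posnP (w v (f v))) => [->|wv]; first by rewrite andbF.
by rewrite -(Kclosed wv) andbb andbT; case: (v \in K) => /=; lia.
Qed.

Lemma mweight_normalize (w' : T -> T -> nat) f : (forall a b, w' a b <= w a b) ->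
  mweight w' (normalize f) = mweight w' f.
Proof.
move=> le; apply: eq_bigr => v _; rewrite ffunE; case wv: (0 < w v (f v)) => //.
by have := le v (f v); have := le v v; rewrite w0; lia.
Qed.

Lemma wK_le a b : wK a b <= w a b. Proof. exact: leq_subr. Qed.

Lemma covered_normalize f : covered (normalize f) = covered f.
Proof.
apply/setP => v; rewrite !inE ffunE; case wv: (0 < w v (f v)); first by rewrite wv.
by rewrite w0.
Qed.

(** A lexicographic order: the lowered weight first, then the number of covered vertices of [K],
    which is less than the base. *)
Definition score f := mweight wK f * #|T|.+1 + #|covered f|.

Definition good f := involutive f /\ forall g, involutive g -> score g <= score f.

Lemma good_normalize f : good f -> good (normalize f).
Proof.
case=> fK fmax; split; first exact: normalizeK.
by move=> g /fmax; rewrite /score mweight_normalize ?covered_normalize //; apply: wK_le.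
Qed.

(* Gallai's relation: no good matching leaves both [u] and [v] uncovered. *)
Definition tied u v := forall f, good f -> proper f -> f u = u -> f v = v -> u = v.

(** Otherwise adding the edge between [u] and [v] would cover more vertices of [K] without reducing
    the lowered weight. *)
Lemma tied_adjacent u v : u \in K -> 0 < w u v -> tied u v.
Proof.
move=> uK wuv f [fK fmax] pf fu fv; apply/eqP/negPn/negP => nuv.
have vK : v \in K by rewrite -(Kclosed wuv).
pose g : {ffun T -> T} := [ffun a => if a == u then v else if a == v then u else f a].
have gE a : a != u -> a != v -> g a = f a by rewrite ffunE => /negbTE-> /negbTE->.
have gu : g u = v by rewrite ffunE eqxx.
have gv : g v = u by rewrite ffunE eqxx eq_sym (negbTE nuv).
have fE a b : f b = b -> a != b -> f a != b.
  by move=> fb; apply: contra_neq => fab; rewrite -(fK a) fab fb.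
have gK : involutive g.
  move=> a; have [->|au] := eqVneq a u; first by rewrite gu gv.
  have [->|av] := eqVneq a v; first by rewrite gv gu.
  by rewrite (gE a) // gE ?fE // fK.
have le1 : mweight wK f <= mweight wK g.
  apply: leq_sum => a _; have [->|au] := eqVneq a u; first by rewrite fu /wK w0.
  have [->|av] := eqVneq a v; first by rewrite fv /wK w0.
  by rewrite gE.
have lt2 : #|covered f| < #|covered g|.
  apply: proper_card; apply/properP; split; last first.
    by exists u; rewrite inE ?gu ?fu ?wuv ?w0 uK.
  apply/subsetP => a; rewrite !inE => /andP[-> wa] /=.
  have [e|au] := eqVneq a u; first by rewrite e fu w0 in wa.
  have [e|av] := eqVneq a v; first by rewrite e fv w0 in wa.
  by rewrite gE.
have := fmax g gK; rewrite /score leqNgt => /negP; apply.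
by rewrite -addnS leq_add // leq_mul2r le1 orbT.
Qed.

Hypothesis avoid : forall u, exists f,
  [/\ involutive f, w u (f u) = 0 & forall g, involutive g -> mweight w g <= mweight w f].

Lemma proper_stable f u : proper f -> (f u \in K) = (u \in K).
Proof.
by move/forallP/(_ u) => /orP[/eqP->//|wu]; rewrite (Kclosed wu).
Qed.

Lemma proper_pos f u : proper f -> (0 < w u (f u)) = (f u != u).
Proof.
move/forallP/(_ u); case: eqVneq => [->|]; rewrite ?w0 //=.
Qed.

(** Suppose that a good [f] leaves [u] and [v] uncovered; it then covers [t]. Exchange [f] with a
    maximum weight matching [g] avoiding [t] along the alternating path [C] from [t]. The result is
    again good and avoids [t]. As [C] contains at most one of [u] and [v], it also avoids the other
    one, which is tied to [t]. *)
Lemma tied_trans t u v : t \in K -> tied u t -> tied t v -> tied u v.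
Proof.
move=> tK Rut Rtv f gf pf fu fv; apply/eqP/negPn/negP => nuv.
have ft : f t != t.
  apply/negP => /eqP ft; move/eqP: nuv; apply.
  by rewrite (Rut f gf pf fu ft) -(Rtv f gf pf ft fv).
case: (avoid t) => g0 [g0K wg0 g0max].
pose g := normalize g0.
have gK : involutive g by apply: normalizeK.
have pg : proper g by apply: normalize_proper.
have gt : g t = t by apply: normalize_fix.
have gmax h : involutive h -> mweight w h <= mweight w g.
  by rewrite mweight_normalize //; apply: g0max.
clearbody g.
have [fK fmax] := gf.
pose C := dihedral_orbit f g t.
have Cf : forall a, a \in C -> f a \in C := @dihedral_orbit_f _ f g t fK gK gt.
have Cg : forall a, a \in C -> g a \in C := @dihedral_orbit_g _ f g t fK gK gt.
have tC : t \in C by rewrite inE connect0.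
have CK : C \subset K.
  apply/subsetP => a; rewrite inE => /iter_findex <-.
  elim: (findex _ _ _) => //= i IH.
  by rewrite /rot_ proper_stable // proper_stable.
have Cu : forall a b, a \in C -> b \in C -> f a = a -> f b = b -> a = b.
  exact: (@dihedral_orbit_fix_uniq _ f g t fK gK gt).
clearbody C.
have CfE a : (f a \in C) = (a \in C).
  by apply/idP/idP => [/Cf|/Cf//]; rewrite fK.
have CgE a : (g a \in C) = (a \in C).
  by apply/idP/idP => [/Cg|/Cg//]; rewrite gK.
pose f' : {ffun T -> T} := [ffun a => if a \in C then g a else f a].
pose g' : {ffun T -> T} := [ffun a => if a \in C then f a else g a].
have f'K : involutive f'.
  by move=> a; rewrite !ffunE; case aC: (a \in C); rewrite ?CgE ?CfE aC ?gK ?fK.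
have g'K : involutive g'.
  by move=> a; rewrite !ffunE; case aC: (a \in C); rewrite ?CgE ?CfE aC ?gK ?fK.
have sumE : mweight w f' + mweight w g' = mweight w f + mweight w g.
  rewrite -!big_split; apply: eq_bigr => a _ /=; rewrite !ffunE.
  by case: ifP => // _; rewrite addnC.
have pf' : proper f'.
  apply/forallP => a; rewrite ffunE; case: ifP => _.
    by have/forallP := pg.
  by have/forallP := pf.
(* On [C] the new matching misses at least [t], whereas [f] misses at most the other end of the
   path. *)
have cov_le : #|covered f'| <= #|covered f|.
  rewrite -(cardsID C (covered f')) -(cardsID C (covered f)).
  have -> : covered f' :\: C = covered f :\: C.
    by apply/setP => a; rewrite !inE; case aC: (a \in C); rewrite //= ffunE aC.
  rewrite leq_add2r.
  have -> : covered f' :&: C = C :\: [set a | g a == a].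
    apply/setP => a; rewrite !inE proper_pos // ffunE.
    by case aC: (a \in C); rewrite ?andbF ?andbT ?(subsetP CK _ aC).
  have -> : covered f :&: C = C :\: [set a | f a == a].
    apply/setP => a; rewrite !inE proper_pos //.
    by case aC: (a \in C); rewrite ?andbF ?andbT ?(subsetP CK _ aC).
  rewrite !cardsD leq_sub2l //.
  have le1 : #|C :&: [set a | f a == a]| <= 1.
    rewrite leqNgt; apply/negP => /card_gt1P[a [b [/setIP[aC fa] /setIP[bC fb]]]].
    by move: fa fb; rewrite !inE => /eqP fa /eqP fb /eqP; apply; apply: Cu.
  by apply: (leq_trans le1); rewrite (cardD1 t) !inE tC gt eqxx.
(* Maximality of [g] gives [f'] at least the weight of [f]. If [f'] covers fewer vertices of [K],
   its lowered weight is larger by at least the difference, which outweighs the loss in the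
   score. *)
have gf' : good f'.
  split=> // h /fmax /leq_trans; apply; rewrite /score.
  have := gmax g' g'K; have := mweight_wK f; have := mweight_wK f'.
  have := max_card (mem (covered f)).
  move: sumE cov_le; set c := #|covered f|; set c' := #|covered f'|.
  set a := mweight wK f; set a' := mweight wK f'; move=> ? ? ? ? ? ?.
  have : a + (c - c') <= a' by lia.
  have : (c - c') * 1 <= (c - c') * #|T|.+1 by rewrite leq_mul2l orbT.
  have : (a + (c - c')) * #|T|.+1 <= a' * #|T|.+1 -> 
     a * #|T|.+1 + (c - c') * #|T|.+1 <= a' * #|T|.+1 by rewrite mulnDl.
  rewrite leq_mul2r => H1 H2 H3; move: (H1 ltac:(by rewrite H3 orbT)); lia.
have f't : f' t = t by rewrite ffunE tC.
case uC: (u \in C); last first.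
  have f'u : f' u = u by rewrite ffunE uC.
  by move/eqP: ft; apply; rewrite -(Rut f' gf' pf' f'u f't).
case vC: (v \in C); last first.
  have f'v : f' v = v by rewrite ffunE vC.
  by move/eqP: ft; apply; rewrite (Rtv f' gf' pf' f't f'v).
by move/eqP: nuv; apply; apply: Cu.
Qed.

Hypothesis Kconn : {in K &, forall u v, connect (fun a b => 0 < w a b) u v}.

Lemma tied_component u v : u \in K -> v \in K -> tied u v.
Proof.
move=> uK vK; case/connectP: (Kconn uK vK) => p; elim: p u uK => [|x p IH] u uK /=.
  by move=> _ ->.
case/andP=> ux xp vE; have xK : x \in K by rewrite -(Kclosed ux).
by apply: (tied_trans xK); [apply: tied_adjacent | apply: IH].
Qed.

(** A matching of best score misses at most one vertex of [K], all of them being tied; by parity it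
    covers all of [K] except for at most one vertex, which is what the lowering takes away. *)
Lemma gallai_bound f : involutive f ->
  exists2 g : {ffun T -> T}, involutive g & mweight wK f + #|K|./2.*2 <= mweight w g.
Proof.
move=> fK.
pose invb (h : {ffun T -> T}) := [forall v, h (h v) == v].
have invP h : reflect (involutive h) (invb h) by apply/forallPP => v; apply: eqP.
case: (@arg_maxnP _ f invb score); first exact/invP.
move=> h0 /invP h0K h0max.
have gh0 : good h0 by split=> // g /invP/h0max.
have gh := good_normalize gh0; have ph := normalize_proper h0.
move: (normalize h0) gh ph => h gh ph; have [hK hmax] := gh.
exists h => //; have := mweight_wK h => ->.
have wle : mweight wK f <= mweight wK h.
  rewrite leqNgt; apply/negP => lt.
  have := hmax f fK; rewrite /score leqNgt => /negP; apply.
  have : #|covered h| <= #|T| by apply: max_card.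
  have : (mweight wK h).+1 * #|T|.+1 <= mweight wK f * #|T|.+1 by rewrite leq_mul2r lt orbT.
  rewrite mulSn; lia.
rewrite leq_add //.
have covE : covered h = K :\: [set a | h a == a].
  by apply/setP => a; rewrite !inE proper_pos // andbC.
have ev : ~~ odd #|covered h|.
  rewrite covE; apply: (even_card_involution hK) => v.
    by rewrite !inE proper_stable // hK eq_sym.
  by rewrite !inE => /andP[].
have le1 : #|K :&: [set a | h a == a]| <= 1.
  rewrite leqNgt; apply/negP => /card_gt1P[a [b [/setIP[aC fa] /setIP[bC fb]]]].
  move: fa fb; rewrite !inE => /eqP fa /eqP fb /eqP; apply.
  exact: (tied_component aC bC gh ph).
have := cardsID [set a | h a == a] K; rewrite -covE.
have := odd_double_half #|K|; have := odd_double_half #|covered h|; rewrite (negbTE ev); lia.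
Qed.

End GallaiComponent.

Local Open Scope ring_scope.

(* The inequality half of Edmonds' description of the matching polytope: the
   fractional matching [x] satisfies the odd set constraints. *)
Lemma fractional_matching_nat (T : finType) (x : T -> T -> rat) (w : T -> T -> nat) :
  (forall a b, 0 <= x a b) -> (forall a b, x a b = x b a) ->
  (forall a, \sum_(b | b != a) x a b <= 1) ->
  (forall U : {set T}, odd #|U| ->
     \sum_(a in U) \sum_(b in U | b != a) x a b <= #|U|%:R - 1) ->
  (forall a b, w a b = w b a) -> (forall a, w a a = 0%N) ->
  exists2 f : {ffun T -> T}, involutive f &
    \sum_a \sum_b x a b * (w a b)%:R <= (mweight w f)%:R.
Proof.
move=> x0 xC xdeg xodd.
(* Induction on the total weight. Each step subtracts from [w] the left-hand side of one constraint
   on [x], chosen so that the optimum drops by at least twice its right-hand side; the factor 2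
   comes from counting ordered pairs. *)
have [N] := ubnP (\sum_a \sum_b w a b)%N; elim: N w => // N IH w ltN wC w0.
pose invb (h : {ffun T -> T}) := [forall v, h (h v) == v].
have invP (h : {ffun T -> T}) : reflect (involutive h) (invb h) by apply/forallPP => v; apply: eqP.
pose id0 : {ffun T -> T} := [ffun v => v].
have id0K : involutive id0 by move=> v; rewrite !ffunE.
case: (@arg_maxnP _ id0 invb (fun f => mweight w f)); first exact/invP.
move=> f0 /invP f0K f0max.
have {f0max} fmax (g : {ffun T -> T}) : involutive g -> (mweight w g <= mweight w f0)%N by move/invP/f0max.
exists f0 => //; set nu := mweight w f0 in fmax *.
have sumB (w' : T -> T -> nat) (d : T -> T -> nat) :
    (forall a b, w a b <= w' a b + d a b)%N ->
  \sum_a \sum_b x a b * (w a b)%:R <=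
  \sum_a \sum_b x a b * (w' a b)%:R + \sum_a \sum_b x a b * (d a b)%:R.
  move=> wd; rewrite -big_split /=; apply: ler_sum => a _.
  rewrite -big_split /=; apply: ler_sum => b _.
  by rewrite -mulrDr -natrD ler_wpM2l // ler_nat.
have sumlt (w' : T -> T -> nat) a0 b0 : (forall a b, w' a b <= w a b)%N -> 
    (w' a0 b0 < w a0 b0)%N -> (\sum_a \sum_b w' a b < N)%N.
  move=> le lt; rewrite -ltnS; apply: leq_trans ltN; rewrite ltnS.
  rewrite (bigD1 a0) //= [X in (_ < X)%N](bigD1 a0) //= -addSn leq_add //; last first.
    by apply: leq_sum => a _; apply: leq_sum.
  rewrite (bigD1 b0) //= [X in (_ < X)%N](bigD1 b0) //= -addSn leq_add //.
  by apply: leq_sum.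
(* If every maximum matching covers some vertex [u] by a positive weight, the degree constraint at
   [u] is subtracted. *)
case: (boolP [exists u, [forall f : {ffun T -> T}, (invb f && (mweight w f == nu)) ==> (0 < w u (f u))%N]]).
  case/existsP=> u /forallP umax.
  have {}umax (f : {ffun T -> T}) : involutive f -> mweight w f = nu -> (0 < w u (f u))%N.
    by move=> /invP fK /eqP fnu; have := umax f; rewrite fK fnu.
  have wu0 := umax f0 f0K erefl.
  pose d a b := ((a == u) || (b == u)) && (a != b).
  pose w' a b := (w a b - d a b)%N.
  have w'C a b : w' a b = w' b a by rewrite /w' /d wC orbC [a == b]eq_sym.
  have w'0 a : w' a a = 0%N by rewrite /w' w0.
  have lt' : (\sum_a \sum_b w' a b < N)%N.
    apply: (sumlt w' u (f0 u)) => [a b|]; first exact: leq_subr.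
    rewrite /w' /d eqxx /=; case: eqVneq => [e|_]; first by rewrite -e w0 in wu0.
    by rewrite ltn_subrL wu0.
  have [f fK fle] := IH w' lt' w'C w'0.
  have fnu : (mweight w' f + 2 <= nu)%N.
    (* A matching that does not cover [u] is not maximum; as weights of matchings are even, it is
       already short by 2. *)
    have [wu|wu] := posnP (w u (f u)).
      have lt : (mweight w f < nu)%N.
        rewrite ltn_neqAle fmax // andbT; apply/negP => /eqP e.
        by have := umax f fK e; rewrite wu.
      have le : (mweight w' f <= mweight w f)%N by apply: leq_sum => v _; apply: leq_subr.
      have := mweight_even wC w0 fK; have := mweight_even wC w0 f0K; rewrite -/nu; lia.
    apply: leq_trans (fmax f fK).
    have nfu : f u != u by apply: contraTneq wu => ->; rewrite w0.
    rewrite /mweight (bigD1 u) //= (bigD1 (f u)) //=.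
    rewrite [X in (_ <= X)%N](bigD1 u) //= [X in (_ <= _ + X)%N](bigD1 (f u)) //=.
    have : (\sum_(i | (i != u) && (i != f u)) w' i (f i) <=
            \sum_(i | (i != u) && (i != f u)) w i (f i))%N.
      by apply: leq_sum => v _; apply: leq_subr.
    rewrite /w' /d fK eqxx orbT /= [u == f u]eq_sym nfu /= wC [w (f u) u]wC.
    by move: wu; rewrite wC; lia.
  apply: (le_trans (sumB w' d _)) => [a b|]; first by rewrite /w'; lia.
  have : (mweight w' f)%:R + 2%:R <= nu%:R :> rat by rewrite -natrD ler_nat.
  apply: le_trans; apply: lerD => //.
  have -> : \sum_a \sum_b x a b * (d a b)%:R = (\sum_(b | b != u) x u b) *+ 2.
    rewrite (bigD1 u) //= mulr2n; congr (_ + _).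
      rewrite [RHS]big_mkcond /=; apply: eq_bigr => b _; rewrite /d eqxx /= eq_sym.
      by case: eqP; rewrite ?mulr0 ?mulr1.
    apply: eq_bigr => a au; rewrite (bigD1 u) //= /d au eqxx (negbTE au) orbT /= mulr1.
    rewrite big1 ?addr0; first exact: xC.
    by move=> b /negbTE->; rewrite mulr0.
  by have := xdeg u; rewrite mulr2n; lra.
move=> nex.
(* In the remaining case every vertex is avoided by a maximum matching, so Gallai's lemma applies to
   a component [K] of the graph of positive weights. *)
have avoid u : exists f : {ffun T -> T}, [/\ involutive f, w u (f u) = 0%N &
    forall g : {ffun T -> T}, involutive g -> (mweight w g <= mweight w f)%N].
  move: nex; rewrite negb_exists => /forallP/(_ u).
  rewrite negb_forall => /existsP[f]; rewrite negb_imply -eqn0Ngt.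
  by case/andP=> /andP[/invP fK /eqP fnu] /eqP wu; exists f; split=> // g /fmax; rewrite fnu.
case: (boolP [exists a, [exists b, (0 < w a b)%N]]); last first.
  move=> nex2; rewrite big1 ?ler0n // => a _; rewrite big1 // => b _.
  move: nex2; rewrite negb_exists => /forallP/(_ a).
  by rewrite negb_exists => /forallP/(_ b); rewrite -eqn0Ngt => /eqP ->; rewrite mulr0.
case/existsP=> a0 /existsP[b0 w_pos].
pose e := fun a b => (0 < w a b)%N.
have esym : connect_sym e by apply: sym_connect_sym => a b; rewrite /e wC.
pose K := [set v | connect e a0 v].
have Kclosed a b : (0 < w a b)%N -> (a \in K) = (b \in K).
  move=> wab; rewrite !inE; have cab : connect e a b by apply: connect1.
  by apply/idP/idP => /connect_trans; apply; rewrite // esym.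
have Kconn : {in K &, forall u v, connect e u v}.
  by move=> u v; rewrite !inE esym; apply: connect_trans.
pose w' := wK w K.
have a0K : a0 \in K by rewrite inE connect0.
have lt' : (\sum_a \sum_b w' a b < N)%N.
  apply: (sumlt w' a0 b0) => [a b|]; first exact: leq_subr.
  by rewrite /w' /wK -(Kclosed _ _ w_pos) a0K ltn_subrL w_pos.
have w'C a b : w' a b = w' b a by rewrite /w' /wK wC andbC.
have w'0 a : w' a a = 0%N by rewrite /w' /wK w0.
have [f fK fle] := IH w' lt' w'C w'0.
have [g gK gle] := gallai_bound wC w0 Kclosed avoid Kconn fK.
pose d a b := [&& a \in K, b \in K & b != a].
apply: (le_trans (sumB w' d _)) => [a b|].
  rewrite /w' /wK /d; case: eqVneq => [->|_]; first by rewrite w0.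
  by rewrite andbT; lia.
have : (mweight w' f)%:R + (#|K|./2.*2)%:R <= nu%:R :> rat.
  by rewrite -natrD ler_nat (leq_trans gle) // fmax.
apply: le_trans; apply: lerD => //.
have -> : \sum_a \sum_b x a b * (d a b)%:R = \sum_(a in K) \sum_(b in K | b != a) x a b.
  rewrite [RHS]big_mkcond /=; apply: eq_bigr => a _; rewrite /d.
  case: (a \in K) => /=; last by rewrite big1 // => b _; rewrite mulr0.
  rewrite [RHS]big_mkcond /=; apply: eq_bigr => b _.
  by case: (_ && _); rewrite ?mulr0 ?mulr1.
(* For odd [K] this is an odd set constraint; for even [K] the degree constraints add up to the same
   bound. *)
case oK: (odd #|K|).
  apply: (le_trans (xodd K oK)).
  by rewrite -[X in X%:R - 1]odd_double_half oK add1n -natr1 addrK.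
have -> : #|K|./2.*2 = #|K| by rewrite -[RHS]odd_double_half oK.
rewrite -sum1_card natr_sum; apply: ler_sum => a _; apply: le_trans (xdeg a).
rewrite [X in _ <= X]big_mkcond /= [X in X <= _]big_mkcond /=.
by apply: ler_sum => b _; case: (b \in K) => //=; case: ifP.
Qed.

Lemma complete_involution (T : finType) (f : {ffun T -> T}) :
  involutive f -> ~~ odd #|T| ->
  exists g : {ffun T -> T}, [/\ involutive g, forall v, g v != v &
    forall v, f v != v -> g v = f v].
Proof.
move=> + evT; have [N] := ubnP #|[set v | f v == v]|; elim: N f => // N IH f ltN fK.
have ev : ~~ odd #|[set v | f v == v]|.
  have evA : ~~ odd #|[set v | f v != v]|.
    apply: (even_card_involution fK) => v; last by rewrite inE.
    by rewrite !inE fK eq_sym.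
  have -> : [set v | f v == v] = ~: [set v | f v != v].
    by apply/setP => v; rewrite !inE negbK.
  by have := cardsC [set v | f v != v]; lia.
case: (leqP #|[set v | f v == v]| 1) => [le1|].
  exists f; split=> // v; apply/negP => fv.
  have : (0 < #|[set v | f v == v]|)%N by apply/card_gt0P; exists v; rewrite inE.
  by move: le1 ev; case: #|_| => [|[]].
case/card_gt1P=> a [b [+ + nab]]; rewrite !inE => /eqP fa /eqP fb.
pose g : {ffun T -> T} := [ffun v => if v == a then b else if v == b then a else f v].
have gE v : v != a -> v != b -> g v = f v by rewrite ffunE => /negbTE-> /negbTE->.
have ga : g a = b by rewrite ffunE eqxx.
have gb : g b = a by rewrite ffunE eqxx eq_sym (negbTE nab).
have fne c v : f c = c -> v != c -> f v != c.
  by move=> fc; apply: contra_neq => fvc; rewrite -(fK v) fvc fc.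
have gK : involutive g.
  move=> v; have [->|va] := eqVneq v a; first by rewrite ga gb.
  have [->|vb] := eqVneq v b; first by rewrite gb ga.
  by rewrite (gE v) // gE ?fne // fK.
have [|h [hK hne hE]] := IH g _ gK.
  rewrite -ltnS; apply: leq_trans ltN; rewrite ltnS; apply: proper_card.
  apply/properP; split; last by exists a; rewrite !inE ?fa // ga eq_sym.
  apply/subsetP => v; rewrite !inE; have [->|va] := eqVneq v a; first by rewrite fa.
  by have [->|vb] := eqVneq v b; [rewrite fb | rewrite gE].
exists h; split=> // v fv; have va : v != a by apply: contraNneq fv => ->; rewrite fa.
have vb : v != b by apply: contraNneq fv => ->; rewrite fb.
by rewrite hE gE.
Qed.

Lemma common_denominator (I : finType) (F : I -> rat) : (forall i, 0 <= F i) ->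
  exists2 N : nat, (0 < N)%N & exists G : I -> nat, forall i, F i * N%:R = (G i)%:R.
Proof.
move=> F0; pose N := \prod_i denq (F i).
have N0 : 0 < N by apply: prodr_gt0 => i _; apply: denq_gt0.
exists `|N|%N; first by rewrite absz_gt0 gt_eqF.
exists (fun i => absz (numq (F i) * \prod_(j | j != i) denq (F j))) => i.
have num0 : 0 <= numq (F i) * \prod_(j | j != i) denq (F j).
  by rewrite mulr_ge0 ?numq_ge0 // prodr_ge0 // => j _; apply: ltW; apply: denq_gt0.
rewrite !natr_absz (ger0_norm num0) (ger0_norm (ltW N0)).
rewrite /N (bigD1 i) //= !intrM mulrA; congr (_ * _).
by rewrite -{1}[F i]divq_num_den divfK // intr_eq0 denq_neq0.
Qed.

(** Clearing denominators makes the weights natural numbers. Nonnegative weights allow the matching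
    found to be completed to a perfect one. *)
Lemma fractional_perfect_matching (T : finType) (x W : T -> T -> rat) : ~~ odd #|T| ->
  (forall a b, 0 <= x a b) -> (forall a b, x a b = x b a) ->
  (forall a, \sum_(b | b != a) x a b <= 1) ->
  (forall U : {set T}, odd #|U| ->
     \sum_(a in U) \sum_(b in U | b != a) x a b <= #|U|%:R - 1) ->
  (forall a b, 0 <= W a b) -> (forall a b, W a b = W b a) ->
  exists f : {ffun T -> T}, [/\ involutive f, forall v, f v != v &
    \sum_a \sum_(b | b != a) x a b * W a b <= \sum_a W a (f a)].
Proof.
move=> evT x0 xC xdeg xodd W0 WC.
have [|N N0 [G GE]] := @common_denominator (T * T)%type (fun p => if p.1 == p.2 then 0 else W p.1 p.2).
  by move=> p; case: ifP.
pose w a b := G (a, b).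
have wE a b : (if a == b then 0 else W a b) * N%:R = (w a b)%:R by exact: (GE (a, b)).
have wC a b : w a b = w b a.
  by apply/eqP; rewrite -(eqr_nat rat) -!wE [b == a]eq_sym WC.
have w0 a : w a a = 0%N.
  by apply/eqP; rewrite -(eqr_nat rat) -!wE eqxx mul0r.
have [f0 f0K f0le] := fractional_matching_nat x0 xC xdeg xodd wC w0.
have [f [fK fne fE]] := complete_involution f0K evT.
exists f; split=> //.
rewrite -(@ler_pM2r _ N%:R) ?ltr0n //.
have -> : (\sum_a \sum_(b | b != a) x a b * W a b) * N%:R = \sum_a \sum_b x a b * (w a b)%:R.
  rewrite mulr_suml; apply: eq_bigr => a _; rewrite mulr_suml [LHS]big_mkcond /=.
  by apply: eq_bigr => b _; rewrite -wE eq_sym; case: eqP => _; rewrite ?mul0r ?mulr0 ?mulrA.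
apply: (le_trans f0le); rewrite mulr_suml /mweight natr_sum; apply: ler_sum => a _.
rewrite -wE ler_pM2r ?ltr0n //; case: eqVneq => [_|ne]; first exact: W0.
by rewrite fE // eq_sym.
Qed.

(** * Local search for matchings *)

Local Close Scope ring_scope.

(* [mu] and [nu] are perfect matchings, [dummy] points are never matched
   together, and [mu] cannot be improved by changing at most [2 L + 4] points. *)
Section LocalSearch.

Variables (T : finType) (wt : T -> T -> nat) (dummy : pred T).
Hypothesis wtC : forall a b, wt a b = wt b a.
Variables (mu nu : T -> T) (L : nat).
Hypotheses (muK : involutive mu) (nuK : involutive nu).
Hypotheses (mu_neq : forall v, mu v != v) (nu_neq : forall v, nu v != v).
Hypothesis mu_dummy : forall v, dummy v -> ~~ dummy (mu v).
Hypothesis nu_dummy : forall v, dummy v -> ~~ dummy (nu v).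
Hypothesis dummy_next : forall v, dummy v -> mu v != nu v -> ~~ dummy (mu (nu v)).
Hypothesis local_opt : forall f : {ffun T -> T}, involutive f -> (forall v, f v != v) ->
  (forall v, dummy v -> ~~ dummy (f v)) -> #|[set v | f v != mu v]| <= 2 * L + 4 ->
  \sum_v wt v (f v) <= \sum_v wt v (mu v).

Let s v := mu (nu v).
Let n v := wt v (nu v).
Let m v := wt v (mu v).

Let muI : injective mu := can_inj muK.
Let sI : injective s. Proof. exact: inj_comp muI (can_inj nuK). Qed.
Let iterI i : injective (iter i s).
Proof. by elim: i => // i IH a b /= /sI /IH. Qed.

Let nu_s v : nu v = mu (s v). Proof. by rewrite /s muK. Qed.

Let mu_iter i v : iter i s (mu (iter i s v)) = mu v.
Proof.
elim: i => // i IH; rewrite iterSr -[RHS]IH; congr (iter i s _).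
by rewrite /= {1}/s -nu_s nuK.
Qed.

(* The reflection [mu] has no fixed point on the orbits of the rotation [s],
   and neither has [nu], so it maps every orbit to another one. *)
Let mu_orbit_disjoint v i j : mu (iter i s v) != iter j s v.
Proof.
apply/eqP => e.
have e2 : mu v = iter (i + j) s v by rewrite -(mu_iter i v) e -iterD.
have [l [e3|e3]] : exists l : nat, i + j = l + l \/ i + j = l + l.+1.
  by exists (i + j)./2; have := odd_double_half (i + j); case: odd; lia.
- by have := mu_neq (iter l s v); rewrite -(inj_eq (@iterI l)) mu_iter e2 e3 iterD eqxx.
have := nu_neq (iter l s v); rewrite -(inj_eq muI) -/(s _) -iterS.
by rewrite -(inj_eq (@iterI l)) mu_iter e2 e3 iterD eqxx.
Qed.

Let sumC (C : {set T}) (f : {ffun T -> T}) : involutive f -> (forall v, f v != v) ->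
  (forall v, dummy v -> ~~ dummy (f v)) -> #|C| <= 2 * L + 4 ->
  (forall v, v \notin C -> f v = mu v) ->
  \sum_(v in C) wt v (f v) <= \sum_(v in C) m v.
Proof.
move=> fK fne fd leC fE; have := local_opt fK fne fd.
rewrite (leq_trans _ leC); last first.
  by apply/subset_leq_card/subsetP => v; rewrite inE; apply: contraNT => vC; rewrite fE ?eqxx.
move=> /(_ isT); rewrite (bigID (mem C)) /= [X in _ <= X](bigID (mem C)) /=.
have -> : \sum_(v | v \notin C) wt v (f v) = \sum_(v | v \notin C) wt v (mu v).
  by apply: eq_bigr => v vC; rewrite fE.
by rewrite leq_add2r.
Qed.

Section Window.

Variables (v : T) (r : nat).
Hypothesis uniq_r : forall i j, i <= r -> j <= r -> iter i s v = iter j s v -> i = j.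

Let X := [set iter (i : 'I_r.+1) s v | i in 'I_r.+1].
Let Y := [set mu y | y in X].
Let C := X :|: Y.

Let sumX (F : T -> nat) : \sum_(y in X) F y = \sum_(i < r.+1) F (iter i s v).
Proof.
rewrite big_imset //= => i j _ _ e; apply/val_inj.
exact: uniq_r (leq_ord i) (leq_ord j) e.
Qed.

Let XP y : reflect (exists2 i, i <= r & y = iter i s v) (y \in X).
Proof.
apply: (iffP imsetP) => [[i _ ->]|[i le ->]]; first by exists i => //; rewrite -ltnS.
by exists (Ordinal (le : i < r.+1)).
Qed.

Let YP y : reflect (exists2 i, i <= r & y = mu (iter i s v)) (y \in Y).
Proof.
apply: (iffP imsetP) => [[x /XP[i le ->] ->]|[i le ->]]; first by exists i.
by exists (iter i s v) => //; apply/XP; exists i.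
Qed.

Let sum_window (F : T -> nat) : \sum_(y in C) F y =
  \sum_(i < r.+1) F (iter i s v) + \sum_(i < r.+1) F (mu (iter i s v)).
Proof.
rewrite (eq_bigl (predU (mem X) (mem Y))); last by move=> y; rewrite !inE.
rewrite bigU /=; last first.
  apply/pred0P => y /=; apply/negP => /andP[/XP[i _ ->] /YP[j _ e]].
  have := mu_orbit_disjoint v j i.
  by rewrite -e eqxx.
by rewrite (big_imset _ (in2W muI)) /= !sumX.
Qed.

Let muC y : (mu y \in C) = (y \in C).
Proof.
have H z : z \in C -> mu z \in C.
  rewrite !inE => /orP[/XP[i le ->]|/YP[i le ->]].
    by apply/orP; right; apply/YP; exists i.
  by rewrite muK; apply/orP; left; apply/XP; exists i.
by apply/idP/idP => /H //; rewrite muK.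
Qed.

Let card_window : #|C| <= 2 * r.+1.
Proof.
apply: leq_trans (leq_card_setU _ _) _; rewrite mul2n -addnn.
have leX : #|X| <= r.+1 by apply: leq_trans (leq_imset_card _ _) _; rewrite card_ord.
by apply: leq_add => //; apply: leq_trans (leq_imset_card _ _) leX.
Qed.

Let sum_m_window : \sum_(y in C) m y = 2 * \sum_(i < r.+1) m (iter i s v).
Proof.
rewrite sum_window mul2n -addnn; congr (_ + _); apply: eq_bigr => i _.
by rewrite /m muK wtC.
Qed.

(** Trade the [r + 1] edges of [mu] in the window for the [r] edges of [nu] between them, and match
    the two free ends with each other; the weight of this closing edge is dropped. At most
    [2 * (r + 1) <= 2 * L + 4] points change partners, whence the locality constant. *)
Lemma window : r <= L.+1 -> ~~ (dummy (mu v) && dummy (iter r s v)) ->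
  \sum_(i < r) n (iter i s v) <= \sum_(i < r.+1) m (iter i s v).
Proof.
move=> rL nd; set x := iter r s v in nd *.
have nxv : mu v != x by have := mu_orbit_disjoint v 0 r.
pose f : {ffun T -> T} := [ffun y => if y == x then mu v else if y == mu v then x
  else if y \in C then nu y else mu y].
have fx : f x = mu v by rewrite ffunE eqxx.
have fv : f (mu v) = x by rewrite ffunE eqxx (negbTE nxv).
have vC : mu v \in C by rewrite muC inE; apply/orP; left; apply/XP; exists 0.
have xC : x \in C by rewrite inE; apply/orP; left; apply/XP; exists r.
have fN y : y \notin C -> f y = mu y.
  move=> yC; rewrite ffunE (negbTE yC); case: eqP => [e|_]; first by rewrite e xC in yC.
  by case: eqP => [e|_] //; rewrite e vC in yC.
have fX i : i < r -> f (iter i s v) = nu (iter i s v).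
  move=> lt; have iC : iter i s v \in C by rewrite inE; apply/orP; left; apply/XP; exists i => //; apply: ltnW.
  rewrite ffunE iC; case: eqP => [e|_].
    by have := uniq_r (ltnW lt) (leqnn r) e; lia.
  by case: eqP => // e; have := mu_orbit_disjoint v 0 i; rewrite /= e eqxx.
have fY i : i < r -> f (nu (iter i s v)) = iter i s v.
  move=> lt; have iE : nu (iter i s v) = mu (iter i.+1 s v) by rewrite nu_s.
  have iC : nu (iter i s v) \in C by rewrite iE inE; apply/orP; right; apply/YP; exists i.+1.
  rewrite ffunE iC nuK; case: eqP => [e|_].
    by have := mu_orbit_disjoint v i.+1 r; rewrite -iE e eqxx.
  case: eqP => // e; have /muI e2 : mu (iter i.+1 s v) = mu (iter 0 s v) by rewrite -iE e.
  by have := uniq_r (lt : i.+1 <= r) (leq0n r) e2.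
have CE y : y \in C -> [\/ y = x, y = mu v, exists2 i, i < r & y = iter i s v
    | exists2 i, i < r & y = nu (iter i s v)].
  rewrite inE => /orP[/XP|/YP] [i le ->].
    move: le; rewrite leq_eqVlt => /orP[/eqP->|lt]; first by constructor 1.
    by constructor 3; exists i.
  case: i le => [|i] lt; first by constructor 2.
  by constructor 4; exists i => //; rewrite nu_s.
have fK : involutive f.
  move=> y; have [/CE[->|->|[i lt ->]|[i lt ->]]|yC] := boolP (y \in C).
  - by rewrite fx fv.
  - by rewrite fv fx.
  - by rewrite fX // fY.
  - by rewrite fY // fX.
  by rewrite (fN y) // fN ?muC // muK.
have fne y : f y != y.
  have [/CE[->|->|[i lt ->]|[i lt ->]]|yC] := boolP (y \in C).
  - by rewrite fx.
  - by rewrite fv eq_sym.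
  - by rewrite fX.
  - by rewrite fY // eq_sym.
  by rewrite fN.
have fd y : dummy y -> ~~ dummy (f y).
  have [/CE[->|->|[i lt ->]|[i lt ->]]|yC] := boolP (y \in C).
  - by rewrite fx; move=> dx; move: nd; rewrite dx andbT.
  - by rewrite fv; move=> dx; move: nd; rewrite dx.
  - by rewrite fX //; apply: nu_dummy.
  - by rewrite fY // => /nu_dummy; rewrite nuK.
  by rewrite fN //; apply: mu_dummy.
have leC : #|C| <= 2 * L + 4 by apply: leq_trans card_window _; lia.
have := sumC fK fne fd leC fN; rewrite sum_m_window sum_window.
rewrite big_ord_recr /= [X in _ + X <= _]big_ord_recl /=.
have -> : \sum_(i < r) wt (iter i s v) (f (iter i s v)) = \sum_(i < r) n (iter i s v).
  by apply: eq_bigr => i _; rewrite fX.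
have -> : \sum_(i < r) wt (mu (s (iter i s v))) (f (mu (s (iter i s v)))) = \sum_(i < r) n (iter i s v).
  by apply: eq_bigr => i _; rewrite -nu_s fY // wtC.
set a := \sum_(i < r) n _; set b := \sum_(i < r.+1) _; clearbody a b.
move: (wt _ _) (wt _ _) => c d; lia.
Qed.

(** Here the window is a whole alternating cycle, on which [mu] can be replaced by [nu] without any
    closing edge. *)
Lemma full_turn : iter r.+1 s v = v -> r <= L.+1 ->
  \sum_(i < r.+1) n (iter i s v) <= \sum_(i < r.+1) m (iter i s v).
Proof.
move=> cyc rL.
have nuC y : (nu y \in C) = (y \in C).
  have H z : z \in C -> nu z \in C.
    rewrite !inE => /orP[/XP[i le ->]|/YP[i le ->]]; apply/orP; [right|left].
      apply/YP; rewrite nu_s -iterS; move: le; rewrite leq_eqVlt => /orP[/eqP->|lt].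
        by exists 0; rewrite // cyc.
      by exists i.+1.
    apply/XP; case: i le => [|i] le.
      by exists r => //; rewrite -{1}cyc iterS -nu_s nuK.
    by exists i; [apply: ltnW | rewrite iterS -nu_s nuK].
  by apply/idP/idP => /H //; rewrite nuK.
pose f : {ffun T -> T} := [ffun y => if y \in C then nu y else mu y].
have fK : involutive f.
  by move=> y; rewrite !ffunE; case yC: (y \in C); rewrite ?nuC ?muC yC ?muK ?nuK.
have fne y : f y != y by rewrite ffunE; case: ifP.
have fd y : dummy y -> ~~ dummy (f y).
  by rewrite ffunE; case: ifP => _; [apply: nu_dummy | apply: mu_dummy].
have leC : #|C| <= 2 * L + 4 by apply: leq_trans card_window _; lia.
have fN y : y \notin C -> f y = mu y by rewrite ffunE => /negbTE->.
have := sumC fK fne fd leC fN; rewrite sum_m_window.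
rewrite (eq_bigr n); last by move=> y yC; rewrite ffunE yC.
rewrite sum_window.
have -> : \sum_(i < r.+1) n (mu (iter i s v)) = \sum_(i < r.+1) n (iter i s v).
  rewrite big_ord_recl [RHS]big_ord_recr /= addnC; congr (_ + _).
    by apply: eq_bigr => i _; rewrite -nu_s /n nuK wtC.
  have e : mu v = nu (iter r s v) by rewrite nu_s -iterS cyc.
  by rewrite e /n nuK wtC.
lia.
Qed.

End Window.

Let uniq_order v i j : i < order s v -> j < order s v -> iter i s v = iter j s v -> i = j.
Proof. by move=> /findex_iter {2}<- /findex_iter {2}<- ->. Qed.

(** Complete turns around the cycle are split off by induction. What remains is a window, unless
    both of its ends are dummies; then it is extended backwards by one step, which costs the
    additional edge of [mu] at [nu (mu v)]. *)
Lemma walk v r : r <= L ->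
  \sum_(i < r) n (iter i s v) <= m (nu (mu v)) + \sum_(i < r.+1) m (iter i s v).
Proof.
elim/ltn_ind: r => r IH rL.
have cyc := iter_order sI v.
have k0 := order_gt0 s v.
have turn : order s v <= L.+1 ->
    \sum_(i < order s v) n (iter i s v) <= \sum_(i < order s v) m (iter i s v).
  move=> kL; have := @full_turn v (order s v).-1; rewrite prednK //; apply=> //; last by lia.
  by move=> i j li lj; apply: uniq_order; lia.
have [rk|kr] := ltnP r (order s v).
  have [nd|] := boolP (~~ (dummy (mu v) && dummy (iter r s v))).
    rewrite (leq_trans (window _ _ nd)) ?leq_addl //; last by lia.
    by move=> i j li lj; apply: uniq_order; lia.
  rewrite negbK => /andP[dv dr].
  have [rk2|rk2] := ltnP r.+1 (order s v); last first.
    have kE : order s v = r.+1 by lia.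
    rewrite kE in turn; apply: leq_trans (leq_addl _ _).
    by apply: leq_trans (turn _); rewrite ?ltnS // big_ord_recr leq_addr.
  pose p := nu (mu v).
  have sp : s p = v by rewrite /s /p nuK muK.
  have sip i : iter i.+1 s p = iter i s v by rewrite iterSr sp.
  have kp : order s p = order s v.
    by rewrite -sp; apply: eq_card; apply: same_fconnect1.
  have npv : mu (mu v) != nu (mu v).
    rewrite muK; apply/eqP => e; have : iter 1 s v = iter 0 s v by rewrite /= {1}e -/p sp.
    by move/(uniq_order (leq_ltn_trans (ltn0Sn r) rk2) k0).
  have ndp := dummy_next dv npv.
  have := @window p r.+1; rewrite sip [dummy _ && _]andbC dr (negbTE ndp) /=.
  move=> /(_ _ _ isT) W.
  have {W} : \sum_(i < r.+1) n (iter i s p) <= \sum_(i < r.+2) m (iter i s p).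
    by apply: W => // i j li lj; rewrite -kp in rk2; apply: uniq_order; lia.
  rewrite big_ord_recl [X in _ <= X]big_ord_recl /=.
  under eq_bigr do rewrite -iterS sip.
  under [X in _ <= _ + X -> _]eq_bigr do rewrite -iterS sip.
  by move=> W; apply: leq_trans W; apply: leq_addl.
have kL : order s v <= L.+1 by lia.
have := turn kL; have := IH (r - order s v) ltac:(lia) ltac:(lia).
have shift (F : T -> nat) l : \sum_(i < order s v + l) F (iter i s v) =
   \sum_(i < order s v) F (iter i s v) + \sum_(i < l) F (iter i s v).
  rewrite big_split_ord /=; congr (_ + _); apply: eq_bigr => i _.
  by rewrite addnC iterD cyc.
have -> : r = order s v + (r - order s v) by lia.
by rewrite -addnS !shift addKn; lia.
Qed.

(** Sum [walk] for length [L] over all starting points: each edge of [nu] is met [L] times, each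
    edge of [mu] at most [L + 2] times, per end. *)
Lemma local_search_matching :
  L * \sum_v wt v (nu v) <= (L + 2) * \sum_v wt v (mu v).
Proof.
have sumI (F : T -> nat) i : \sum_v F (iter i s v) = \sum_v F v.
  by rewrite [RHS](reindex_inj (@iterI i)).
have : \sum_v \sum_(i < L) n (iter i s v) <=
       \sum_v (m (nu (mu v)) + \sum_(i < L.+1) m (iter i s v)).
  by apply: leq_sum => v _; apply: walk.
rewrite big_split /= exchange_big /= [X in _ <= _ + X]exchange_big /=.
under eq_bigr do rewrite sumI.
under [X in _ <= _ + X]eq_bigr do rewrite sumI.
rewrite !sum_nat_const !card_ord.
have <- : \sum_v m v = \sum_v m (nu (mu v)).
  by rewrite [LHS](reindex_inj (inj_comp (can_inj nuK) muI)).
by rewrite -mulSn addn2.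
Qed.

End LocalSearch.

(** * Contracting a matching *)

Definition i0 : 'I_4 := @Ordinal 4 0 isT.
Definition i1 : 'I_4 := @Ordinal 4 1 isT.
Definition i2 : 'I_4 := @Ordinal 4 2 isT.
Definition i3 : 'I_4 := @Ordinal 4 3 isT.

Lemma sum4 (F : 'I_4 -> nat) : \sum_i F i = F i0 + F i1 + F i2 + F i3.
Proof.
rewrite !big_ord_recl big_ord0 addn0 !addnA.
by congr (F _ + F _ + F _ + F _); apply/val_inj.
Qed.

Lemma ord4P (P : 'I_4 -> Prop) : P i0 -> P i1 -> P i2 -> P i3 -> forall i, P i.
Proof.
move=> P0 P1 P2 P3 [[|[|[|[|//]]]] lt]; rewrite (bool_irrelevance lt isT).
all: by [exact: P0 | exact: P1 | exact: P2 | exact: P3].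
Qed.

Lemma sum_bool (I : finType) (A P : pred I) :
  \sum_(i | A i) (P i : nat) = #|[pred i | A i && P i]|.
Proof. by rewrite -sum1_card big_mkcondr; apply: eq_bigr => i _; case: (P i). Qed.

Lemma sum_add3 (I : finType) (A : pred I) (F G H : I -> nat) :
  \sum_(i | A i) (F i + G i + H i) = \sum_(i | A i) F i + \sum_(i | A i) G i + \sum_(i | A i) H i.
Proof. by rewrite !big_split. Qed.

(** The symmetric indicator of the edge between [x] and [y]; a loop counts twice on the diagonal. *)
Definition cut (T : eqType) (x y a b : T) : nat := (x == a) * (y == b) + (x == b) * (y == a).

(* The packing is [o], and [nd] contracts the edges of a perfect matching. *)
Section Contraction.

Variables (V Nd : finType) (k : nat) (o : 'I_k * 'I_4 -> V) (nd : V -> Nd).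
Hypothesis o_inj : injective o.
Hypothesis cardV : #|V| = 4 * k.
Hypothesis fiber : forall a, #|[set v | nd v == a]| = 2.

Let a0 P := nd (o (P, i0)).
Let a1 P := nd (o (P, i1)).
Let a2 P := nd (o (P, i2)).
Let a3 P := nd (o (P, i3)).

Definition both_ends_in P := (a0 P == a1 P) && (a2 P == a3 P).
(** A node has only two vertices, so adjacent edges of a path are never both contracted. Hence
    exactly one edge of the path is contracted here, and [in_node] is its node. *)
Definition one_edge_in P := ~~ both_ends_in P && [|| a0 P == a1 P, a2 P == a3 P | a1 P == a2 P].
Definition in_node P := if a0 P == a1 P then a0 P else if a2 P == a3 P then a2 P else a1 P.


(* Fourfold fractional matching: 1/4 on every edge, but 1 on the middle edge
   of a path whose end edges are both contracted. *)
Definition pathN P a b : nat :=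
  if both_ends_in P then 4 * cut (a1 P) (a2 P) a b
  else cut (a0 P) (a1 P) a b + cut (a1 P) (a2 P) a b + cut (a2 P) (a3 P) a b.
Definition fracN a b := \sum_P pathN P a b.
(** Each path counted here later puts a demand of 1/2 on [a], the capacity that its vanished edge
    leaves free. *)
Definition demandN a := \sum_P (one_edge_in P && (in_node P == a)).

Let sum_eqb (A : {set Nd}) (x : Nd) : \sum_(b in A) (x == b) = (x \in A).
Proof.
rewrite sum_bool; case xA: (x \in A).
  by rewrite (eq_card (B := pred1 x)) ?card1 // => b; rewrite !inE andbC eq_sym; case: eqP => // ->.
by apply: eq_card0 => b; rewrite !inE; apply/negP => /andP[bA /eqP e]; rewrite e bA in xA.
Qed.

Let sum_cut (A : {set Nd}) (x y : Nd) :
  \sum_(a in A) \sum_(b in A | b != a) cut x y a b = 2 * [&& x \in A, y \in A & x != y].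
Proof.
have one u v : \sum_(a in A) \sum_(b in A | b != a) (u == a) * (v == b) = [&& u \in A, v \in A & u != v].
  transitivity (\sum_(a in A) (u == a) * [&& v \in A & v != u]).
    apply: eq_bigr => a aA; rewrite -big_distrr /=; case: (u =P a) => [<-|] //; rewrite !mul1n.
    rewrite (eq_bigl (mem (A :\ u))); last by move=> b; rewrite !inE andbC.
    by rewrite sum_eqb !inE andbC.
  by rewrite -big_distrl /= sum_eqb [v == u]eq_sym; case: (u \in A); case: (_ && _).
rewrite /cut; under eq_bigr do rewrite big_split.
rewrite big_split /= one.
under [X in _ + X]eq_bigr => a _ do under eq_bigr => b _ do rewrite mulnC.
by rewrite one [y == x]eq_sym; case: (x \in A); case: (y \in A); case: (x != y).
Qed.

Let sum_cut1 (a x y : Nd) : \sum_(b | b != a) cut x y a b = (x == a) (+) (y == a).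
Proof.
rewrite /cut big_split /= -big_distrr /= -big_distrl /=.
have E z : \sum_(b | b != a) (z == b) = (z != a).
  by rewrite (eq_bigl (mem [set~ a])) ?sum_eqb ?inE // => b; rewrite !inE.
by rewrite !E; case: (x == a); case: (y == a).
Qed.

Lemma fracN_sym a b : fracN a b = fracN b a.
Proof.
apply: eq_bigr => P _; rewrite /pathN; have C (x y : Nd) : cut x y a b = cut x y b a by rewrite /cut addnC.
by rewrite !C.
Qed.

Lemma sum_layout (F : V -> nat) : \sum_v F v = \sum_P (F (o (P, i0)) + F (o (P, i1)) + F (o (P, i2)) + F (o (P, i3))).
Proof.
have bij : bijective o by apply: inj_card_bij => //; rewrite card_prod !card_ord cardV mulnC.
rewrite (reindex o) /=; last exact: onW_bij.
rewrite (eq_bigr (fun p => F (o (p.1, p.2)))) => [|[]//].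
rewrite -(pair_bigA _ (fun P i => F (o (P, i)))) /=.
by apply: eq_bigr => P _; rewrite sum4.
Qed.

Lemma sum_fiber (A : {set Nd}) : \sum_v (nd v \in A) = 2 * #|A|.
Proof.
rewrite sum_bool mulnC -sum_nat_const /=.
rewrite -(eq_card (A := [set v | nd v \in A])); last by move=> v; rewrite inE.
rewrite -sum1_card (partition_big nd (mem A)) /=; last by move=> v; rewrite inE.
apply: eq_bigr => a aA; rewrite -(fiber a) -sum1_card; apply: eq_bigl => v.
by rewrite !inE; case: eqP => [->|]; rewrite ?aA ?andbF.
Qed.

Lemma card_nodes : #|Nd| = 2 * k.
Proof.
have := sum_fiber setT; rewrite (eq_bigr (fun=> 1)) => [|v _]; last by rewrite inE.
by rewrite sum1_card cardsT cardV; lia.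
Qed.

(** Each of the two vertices of [a] pays 2, a bound on its degree in its path. A single contracted
    edge uses one unit at either end, and this is the term for the demand; a path with both end
    edges contracted pays 4 at each of its two nodes. *)
Lemma fracN_degree a : \sum_(b | b != a) fracN a b + 2 * demandN a <= 4.
Proof.
have <- : 2 * \sum_v (nd v == a) = 4.
  rewrite sum_bool (_ : #|_| = 2) // -[RHS](fiber a).
  by apply: eq_card => v; rewrite !inE.
rewrite exchange_big /= sum_layout !big_distrr /= -big_split /=; apply: leq_sum => P _.
rewrite /pathN /one_edge_in /in_node /both_ends_in -/(a0 P) -/(a1 P) -/(a2 P) -/(a3 P).
move: (a0 P) (a1 P) (a2 P) (a3 P) => x y z t.
case: (x =P y) => [->|nxy]; case: (z =P t) => [->|nzt] /=.
- by rewrite -big_distrr /= sum_cut1; case: (y == a); case: (t == a).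
- rewrite sum_add3 !sum_cut1; by do 3!case: (_ == a).
- rewrite sum_add3 !sum_cut1; by do 3!case: (_ == a).
rewrite sum_add3 !sum_cut1; case: (y =P z) => [->|nyz] /=; do 4?case: (_ =P a) => //=; congruence.
Qed.

(** A path contributes 6 for three surviving edges, or 4 + 4 if just one is contracted, or at most 8
    if both ends are. The factor 4, instead of the 2 in the degree bound, reserves room also for the
    other ends of the demands. *)
Lemma fracN_total : \sum_a \sum_(b | b != a) fracN a b + 4 * \sum_a demandN a <= 4 * #|Nd|.
Proof.
rewrite card_nodes.
have -> : \sum_a \sum_(b | b != a) fracN a b = \sum_P \sum_(a in setT) \sum_(b in setT | b != a) pathN P a b.
  under eq_bigr do rewrite exchange_big /=.
  rewrite exchange_big /=; apply: eq_bigr => P _.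
  by apply: eq_big => a; rewrite ?inE // => _; apply: eq_bigl => b; rewrite inE.
have -> : \sum_a demandN a = \sum_P \sum_a (one_edge_in P && (in_node P == a)) by apply: exchange_big.
have -> : 4 * (2 * k) = \sum_(P < k) 8 by rewrite sum_nat_const card_ord; lia.
rewrite big_distrr /= -big_split /=; apply: leq_sum => P _.
have -> : \sum_a (one_edge_in P && (in_node P == a)) = one_edge_in P.
  have := sum_eqb setT (in_node P); rewrite inE; under eq_bigl do rewrite inE.
  by case: (one_edge_in P) => //= _; apply: big1.
rewrite /pathN /one_edge_in /both_ends_in.
move: (a0 P) (a1 P) (a2 P) (a3 P) => x y z t.
case: ((x == y) && (z == t)) => /=.
  under eq_bigr do rewrite -big_distrr /=.
  by rewrite -big_distrr /= sum_cut; case: [&& _, _ & _].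
under eq_bigr do rewrite sum_add3.
rewrite sum_add3 !sum_cut !inE /=.
by case: (x == y); case: (z == t); case: (y == z).
Qed.

(** Let [c P] count the vertices of [P] in nodes of [U], and let [q P] be half the contribution of
    [P]. Then [q <= c] and the [c P] add up to [2 * #|U|], so a total gap of 2 has to be found. A
    smaller gap is refuted modulo 4, together with the fact that nodes have two vertices. *)
Lemma fracN_odd (U : {set Nd}) : odd #|U| ->
  \sum_(a in U) \sum_(b in U | b != a) fracN a b <= 4 * (#|U| - 1).
Proof.
move=> oU; set c := fun P => (a0 P \in U) + (a1 P \in U) + (a2 P \in U) + (a3 P \in U).
have sumc : \sum_P c P = 2 * #|U| by rewrite -sum_fiber sum_layout.
pose q P := if both_ends_in P then 4 * [&& a1 P \in U, a2 P \in U & a1 P != a2 P] else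
  [&& a0 P \in U, a1 P \in U & a0 P != a1 P] + [&& a1 P \in U, a2 P \in U & a1 P != a2 P] +
  [&& a2 P \in U, a3 P \in U & a2 P != a3 P].
have -> : \sum_(a in U) \sum_(b in U | b != a) fracN a b = 2 * \sum_P q P.
  under eq_bigr do rewrite exchange_big /=.
  rewrite exchange_big big_distrr /=; apply: eq_bigr => P _; rewrite /pathN /q.
  case: ifP => _.
    under eq_bigr do rewrite -big_distrr /=.
    by rewrite -big_distrr /= sum_cut; lia.
  under eq_bigr do rewrite sum_add3.
  by rewrite sum_add3 !sum_cut; lia.
have qc P : q P <= c P.
  rewrite /q /c /both_ends_in; move: (a0 P) (a1 P) (a2 P) (a3 P) => x y z t.
  case: (x =P y) => [->|_]; case: (z =P t) => [->|_] /=;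
  by case: (x \in U); case: (y \in U); case: (z \in U); case: (t \in U); case: (x == y); case: (y == z); case: (z == t); case: (y == t).
have qc1 P : ~~ both_ends_in P -> 0 < c P -> q P < c P.
  rewrite /q /c => /negbTE->; move: (a0 P) (a1 P) (a2 P) (a3 P) => x y z t.
  by case: (x \in U); case: (y \in U); case: (z \in U); case: (t \in U); case: (x == y); case: (y == z); case: (z == t).
have qc2 P : both_ends_in P -> q P = c P -> 4 %| c P.
  rewrite /q /c => /[dup] /andP[/eqP<- /eqP<-] ->.
  by case: (a0 P \in U); case: (a2 P \in U); case: (a0 P == a2 P).
suff : 2 <= \sum_P (c P - q P) by rewrite sumnB // sumc; have := odd_gt0 oU; lia.
rewrite leqNgt ltnS; apply/negP => le1.
have [P0 /andP[nP0 cP0]|none] := pickP (fun P => ~~ both_ends_in P && (0 < c P)); last first.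
  (* Only paths with both end edges contracted meet [U]; for these [c] and [q] are even, so there is
     no gap at all and every [c P] is divisible by 4, against the oddness of [U]. *)
  have : 4 %| 2 * #|U|.
    rewrite -sumc; apply: dvdn_sum => P _; case bP: (both_ends_in P); last first.
      by have := none P; rewrite bP /= lt0n => /negbFE /eqP ->.
    have [e|ne] := eqVneq (q P) (c P); first exact: qc2.
    have lt : q P < c P by rewrite ltn_neqAle ne qc.
    move: le1; rewrite (bigD1 P) //=.
    have : ~~ odd (c P) /\ ~~ odd (q P).
      move: bP; rewrite /c /q => /[dup] /andP[/eqP<- /eqP<-] ->.
      by case: (a0 P \in U); case: (a2 P \in U); case: (a0 P == a2 P).
    by lia.
  by move: oU; lia.
move: le1; rewrite (bigD1 P0) //= => le1.
have dP0 : c P0 - q P0 = 1 by have := qc1 P0 nP0 cP0; lia.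
have rest P : P != P0 -> q P = c P.
  move=> nP; move: le1; rewrite dP0 (bigD1 P) //=; have := qc P; lia.
have others P : P != P0 -> 4 %| c P.
  move=> nP; case bP: (both_ends_in P); first by apply: qc2 => //; apply: rest.
  have [->|cP] := posnP (c P); first by [].
  by have := qc1 P (negbT bP) cP; rewrite rest // ltnn.
(* All other paths being divisible by 4, the odd size of [U] leaves 2 modulo 4 for [P0]. *)
have cP0E : c P0 = 2.
  have : 4 %| \sum_(P | P != P0) c P by apply: dvdn_sum.
  have : c P0 <= 4 by rewrite /c; do 4!case: (_ \in U).
  move: sumc oU; rewrite (bigD1 P0) //=; lia.
have qP0 : q P0 = 1 by lia.
have [i [j [iU jU ij nij uniq]]] : exists i j : 'I_4, [/\ nd (o (P0, i)) \in U, nd (o (P0, j)) \in U, i != j,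
    nd (o (P0, i)) != nd (o (P0, j)) & forall l, nd (o (P0, l)) \in U -> l = i \/ l = j].
  move: qP0 cP0E; rewrite /q /c (negbTE nP0) /a0 /a1 /a2 /a3.
  case u0: (_ (o (P0, i0)) \in U); case u1: (_ (o (P0, i1)) \in U);
  case u2: (_ (o (P0, i2)) \in U); case u3: (_ (o (P0, i3)) \in U) => //=.
  - by case: eqP => // /eqP ne _ _; exists i0, i1; split=> //; elim/ord4P; rewrite ?u2 ?u3 //; auto.
  - by case: eqP => // /eqP ne _ _; exists i1, i2; split=> //; elim/ord4P; rewrite ?u0 ?u3 //; auto.
  - by case: eqP => // /eqP ne _ _; exists i2, i3; split=> //; elim/ord4P; rewrite ?u0 ?u1 //; auto.
(* The node of one of the two vertices of [P0] in [U] has a second vertex [v']. It lies on another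
   path, which meets [U] and hence has both end edges contracted; so the node contains two vertices
   of that path besides the one of [P0]. *)
have /card_gt1P[u [v [+ + nuv]]] : 1 < #|[set v | nd v == nd (o (P0, i))]| by rewrite fiber.
rewrite !inE => /eqP ndu /eqP ndv.
have [v' nv' ndv'] : exists2 v', v' != o (P0, i) & nd v' = nd (o (P0, i)).
  have [e|ne] := eqVneq u (o (P0, i)); last by exists u.
  by exists v => //; rewrite -e eq_sym.
have bij : bijective o by apply: inj_card_bij => //; rewrite card_prod !card_ord cardV mulnC.
have [g _ og] := bij.
have oE : v' = o ((g v').1, (g v').2) by rewrite -surjective_pairing og.
move: oE; move: (g v').1 (g v').2 => P l oE.
have lU : nd (o (P, l)) \in U by rewrite -oE ndv'.
have [eP|nP] := eqVneq P P0.
  rewrite eP in lU oE; case: (uniq _ lU) => e; rewrite e in oE; first by rewrite oE eqxx in nv'.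
  by rewrite -oE ndv' eqxx in nij.
have bP : both_ends_in P.
  apply: contraT => nb; have : 0 < c P.
    by move: l lU {oE}; rewrite /c; elim/ord4P => ->; rewrite ?addnS ?addn1.
  by move=> /(qc1 P nb); rewrite rest // ltnn.
have [l2 nl ndl] : exists2 l2, l2 != l & nd (o (P, l2)) = nd (o (P, l)).
  move: bP => /andP[/eqP e1 /eqP e2]; move: l {lU oE}.
  by elim/ord4P; [exists i1 | exists i0 | exists i3 | exists i2].
have : #|o (P0, i) |: [set o (P, l); o (P, l2)]| <= #|[set v | nd v == nd (o (P0, i))]|.
  apply/subset_leq_card/subsetP => x; rewrite !inE => /or3P[] /eqP->; rewrite ?eqxx //.
    by rewrite -oE ndv'.
  by rewrite ndl -oE ndv'.
rewrite fiber cardsU1 cards2 !inE !(inj_eq o_inj) !xpair_eqE [P0 == P]eq_sym (negbTE nP) /= eqxx /=.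
by rewrite [l == l2]eq_sym (negbTE nl).
Qed.

End Contraction.

(** * Spreading the demands within the matching polytope *)

Local Open Scope ring_scope.

(** For an odd set of size [s] with demand [D] and share [t] of the total supply [R], the spread
    adds at most [2 * D * t]. If [t <= e / 4], the slack from scaling by [1 - e] pays for it.
    Otherwise the second alternative says that the sum of the degree bounds exceeds what is used by
    at least 1; the cases below and above [t = 1 / 2] differ in the sign of [1 - 2 * t]. *)
Lemma odd_set_margin (e R eta t D s : rat) : 0 < e -> e <= 1 -> 4 <= e * eta -> eta <= R ->
  0 <= D -> D <= R - eta -> D <= s -> 2 <= s -> 0 <= t -> t <= 1 ->
  2 * D * t <= e * (s - 1) \/ 1 <= D + t * R - 2 * D * t.
Proof.
move=> e0 e1 eta4 etaR D0 DR Ds s2 t0 t1.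
have eta0 : 4 <= eta by nra.
have [te|te] := lerP t (e / 4).
  left; have : D * t <= s * (e / 4) by apply: ler_pM.
  nra.
right; have [t2|t2] := lerP t (1 / 2).
  have : e / 4 * eta <= t * R by apply: ler_pM => //; lra.
  nra.
have : 0 <= (R - eta - D) * (2 * t - 1) by apply: mulr_ge0; lra.
have : 0 <= (R - eta) * (1 - t) by apply: mulr_ge0; lra.
have : eta * (1 / 2) <= eta * t by apply: ler_wpM2l; lra.
lra.
Qed.

Section Rounding.

Variables (V Nd : finType) (k : nat) (o : 'I_k * 'I_4 -> V) (nd : V -> Nd).
Hypothesis o_inj : injective o.
Hypothesis cardV : #|V| = (4 * k)%N.
Hypothesis fiber : forall a, #|[set v | nd v == a]| = 2%N.

Variables (w : V -> V -> rat) (W : Nd -> Nd -> rat) (e : rat).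
Hypothesis wC : forall u v, w u v = w v u.
Hypothesis w0 : forall u v, 0 <= w u v.
Hypothesis w_triangle : forall u v x, w u x <= w u v + w v x.
Hypothesis WC : forall a b, W a b = W b a.
Hypothesis W0 : forall a b, 0 <= W a b.
Hypothesis wW : forall u v, nd u != nd v -> w u v <= W (nd u) (nd v).
Hypotheses (e0 : 0 < e) (e1 : e <= 1) (eN : 4 <= e * (e * (2 * k)%:R)).

Let frac a b : rat := (fracN o nd a b)%:R / 4.
Let demand0 a : rat := (demandN o nd a)%:R / 2.
Let deg a : rat := \sum_(b | b != a) frac a b.
Let demand a : rat := (1 - e) * demand0 a.
(** The unit capacity of [a] minus its scaled degree and its own demand. Scaling guarantees each
    node a supply of at least [e], which makes [R] large and every share small. *)
Let supply a : rat := (1 - e) * (1 - deg a - demand0 a) + e.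
Let R : rat := \sum_a supply a.
Let share a : rat := supply a / R.
(** The demand of each node is distributed over all nodes in proportion to their supplies; the two
    products are the two directions of this flow. *)
Let x a b : rat := (1 - e) * frac a b + (demand a * share b + demand b * share a).

Let eta : rat := e * (2 * k)%:R.

Let cardN : #|Nd| = (2 * k)%N. Proof. exact: card_nodes cardV fiber. Qed.

Let ec : 0 <= 1 - e. Proof. by rewrite subr_ge0. Qed.
Let frac0 a b : 0 <= frac a b. Proof. by rewrite divr_ge0. Qed.
Let demand00 a : 0 <= demand0 a. Proof. by rewrite divr_ge0. Qed.
Let demand_ge0 a : 0 <= demand a. Proof. by rewrite mulr_ge0. Qed.
Let deg0 a : 0 <= deg a. Proof. exact: sumr_ge0. Qed.

Let degN a : deg a = (\sum_(b | b != a) fracN o nd a b)%:R / 4.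
Proof. by rewrite natr_sum mulr_suml. Qed.

Let deg_demand a : deg a + demand0 a <= 1.
Proof.
have := fracN_degree o_inj cardV fiber a.
by rewrite -(ler_nat rat) natrD natrM degN /demand0; lra.
Qed.

Let supply_ge a : e <= supply a.
Proof. by rewrite /supply; have := mulr_ge0 ec (_ : 0 <= 1 - deg a - demand0 a); have := deg_demand a; lra. Qed.

Let supply_le a : supply a <= 1.
Proof.
rewrite /supply; have := deg0 a; have := demand00 a => H1 H2.
have : (1 - e) * (deg a + demand0 a) >= 0 by apply: mulr_ge0 => //; lra.
lra.
Qed.

Let total_demand : \sum_a demand a + eta <= R.
Proof.
have := fracN_total o cardV fiber; rewrite -(ler_nat rat) natrD.
rewrite (natrM _ 4 (\sum_a _)) natrM cardN => H.
have dE : \sum_a demand0 a = (\sum_a demandN o nd a)%N%:R / 2 by rewrite natr_sum mulr_suml.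
have degE : \sum_a deg a = (\sum_a \sum_(b | b != a) fracN o nd a b)%N%:R / 4.
  by rewrite natr_sum mulr_suml; apply: eq_bigr => a _; rewrite degN.
have -> : R = (1 - e) * ((2 * k)%:R - \sum_a deg a - \sum_a demand0 a) + eta.
  by rewrite /R big_split /= -mulr_sumr !sumrB !sumr_const cardN /eta mulr_natr.
rewrite /demand -mulr_sumr lerD2r ler_wpM2l // dE degE.
by move: H; set A := (\sum_a \sum_(_ | _) _)%N; set B := (\sum_a demandN _ _ _)%N; lra.
Qed.

Let eta0 : 0 < eta.
Proof. by rewrite -(pmulr_rgt0 _ e0); apply: lt_le_trans eN. Qed.

Let demand_sum_ge0 : 0 <= \sum_a demand a. Proof. exact: sumr_ge0. Qed.

Let R_gt0 : 0 < R. Proof. by have := total_demand; have := demand_sum_ge0; have := eta0; lra. Qed.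

Let share_ge0 a : 0 <= share a.
Proof. by rewrite divr_ge0 ?(ltW R_gt0) // (le_trans (ltW e0)). Qed.

Let share_sum : \sum_a share a = 1.
Proof. by rewrite -mulr_suml divff // gt_eqF. Qed.

Let share_le a : share a <= e / 2.
Proof.
rewrite ler_pdivrMr ?R_gt0 //; apply: le_trans (supply_le a) _.
have : e / 2 * eta <= e / 2 * R.
  by apply: ler_wpM2l; [by rewrite divr_ge0 // ltW | have := total_demand; have := demand_sum_ge0; lra].
by rewrite /eta; have := eN; lra.
Qed.

Let x_ge0 a b : 0 <= x a b.
Proof.
by apply: addr_ge0; [exact: mulr_ge0 | apply: addr_ge0; exact: mulr_ge0].
Qed.

Let xC a b : x a b = x b a.
Proof. by rewrite /x /frac fracN_sym [demand a * _ + _]addrC. Qed.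

Let share_split a (A : pred Nd) : \sum_(b | A b) (demand a * share b + demand b * share a) =
  demand a * (\sum_(b | A b) share b) + share a * (\sum_(b | A b) demand b).
Proof.
rewrite !mulr_sumr -big_split /=; apply: eq_bigr => b _.
by rewrite [demand b * _]mulrC.
Qed.

(** What [a] receives is at most its share of the total demand, and the total demand is at most [R];
    so [a] receives at most its supply. *)
Let x_degree a : \sum_(b | b != a) x a b <= 1.
Proof.
rewrite /x big_split /= -mulr_sumr -/(deg a).
have : \sum_(b | b != a) (demand a * share b + demand b * share a) <=
    demand a * 1 + share a * (R - eta).
  rewrite share_split; apply: lerD.
    by apply: ler_wpM2l => //; rewrite -share_sum [X in _ <= X](bigD1 a) //= lerDr.
  apply: ler_wpM2l => //; have := total_demand; rewrite (bigD1 a) //=.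
  by have := demand_ge0 a; lra.
have : share a * R = supply a by rewrite divfK // gt_eqF.
have : 0 <= share a * eta by rewrite mulr_ge0 // ltW.
by rewrite /supply /demand; have := ec; lra.
Qed.

Let x_odd (U : {set Nd}) : odd #|U| ->
  \sum_(a in U) \sum_(b in U | b != a) x a b <= #|U|%:R - 1.
Proof.
move=> oU.
have [c1|c1] := leqP #|U| 1.
  have U1 : #|U| = 1%N by move: oU c1; case: #|U| => [|[]].
  have /eqP/cards1P[u ->] := U1; rewrite big_set1 cards1 subrr big1 // => b.
  by rewrite inE => /andP[->].
pose D := \sum_(a in U) demand a; pose t := \sum_(a in U) share a.
pose X := \sum_(a in U) \sum_(b in U | b != a) frac a b.
have tR : t * R = \sum_(a in U) supply a.
  by rewrite mulr_suml; apply: eq_bigr => a _; rewrite divfK // gt_eqF.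
have xle : \sum_(a in U) \sum_(b in U | b != a) x a b <= (1 - e) * X + 2 * D * t.
  rewrite /x /X mulr_sumr.
  have -> : 2 * D * t = \sum_(a in U) (demand a * t + share a * D).
    rewrite big_split /=.
    have -> : \sum_(a in U) demand a * t = D * t by rewrite mulr_suml.
    have -> : \sum_(a in U) share a * D = t * D by rewrite mulr_suml.
    by clearbody D t; ring.
  rewrite -big_split /=; apply: ler_sum => a aU.
  rewrite big_split /= -mulr_sumr; apply: lerD; first by [].
  rewrite share_split.
  apply: lerD; apply: ler_wpM2l => //.
    by rewrite /t [X in _ <= X](bigD1 a) //= lerDr.
  by rewrite /D [X in _ <= X](bigD1 a) //= lerDr.
have X1 : X <= #|U|%:R - 1.
  have := fracN_odd o_inj cardV fiber oU; rewrite -(ler_nat rat) natrM natrB ?(ltnW c1) //.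
  have -> : X = (\sum_(a in U) \sum_(b in U | b != a) fracN o nd a b)%N%:R / 4.
    rewrite natr_sum mulr_suml; apply: eq_bigr => a _.
    by rewrite natr_sum mulr_suml.
  by lra.
have X2 : (1 - e) * X + D + t * R <= #|U|%:R.
  have -> : #|U|%:R = \sum_(a in U) 1 :> rat by rewrite sumr_const.
  rewrite tR /X mulr_sumr /D -!big_split /=; apply: ler_sum => a aU.
  have : \sum_(b in U | b != a) frac a b <= deg a.
    rewrite /deg [X in _ <= X]big_mkcond /= [X in X <= _]big_mkcond /=.
    by apply: ler_sum => b _; case: (b \in U) => //=; case: ifP.
  move/(ler_wpM2l ec); rewrite /demand /supply; lra.
have D0 : 0 <= D by apply: sumr_ge0.
have t0 : 0 <= t by apply: sumr_ge0.
have t1 : t <= 1.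
  by rewrite -share_sum [X in _ <= X](bigID (mem U)) /= lerDl sumr_ge0.
have DR : D <= R - eta.
  have : D <= \sum_a demand a by rewrite [X in _ <= X](bigID (mem U)) /= lerDl sumr_ge0.
  by have := total_demand; lra.
have Ds : D <= #|U|%:R.
  have : 0 <= (1 - e) * X by apply: mulr_ge0 => //; apply: sumr_ge0 => a _; apply: sumr_ge0.
  have : 0 <= t * R by rewrite mulr_ge0 // ltW // R_gt0.
  by lra.
have etaR : eta <= R by have := total_demand; have := demand_sum_ge0; lra.
have s2 : 2 <= #|U|%:R :> rat by rewrite (ler_nat _ 2).
(* The first alternative complements the scaled odd set bound [X1], the second one complements the
   sum [X2] of the degree bounds. *)
have [H|H] := odd_set_margin e0 e1 eN etaR D0 DR Ds s2 t0 t1.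
  by have := ler_wpM2l ec X1; lra.
by lra.
Qed.

Definition path_total P := w (o (P, i0)) (o (P, i1)) + w (o (P, i1)) (o (P, i2)) + w (o (P, i2)) (o (P, i3)).
Definition path_gain P :=
  if both_ends_in o nd P then w (o (P, i1)) (o (P, i2)) else path_total P / 4.

Let no_triple p q r : p != q -> p != r -> q != r -> nd (o p) = nd (o q) -> nd (o q) != nd (o r).
Proof.
move=> pq pr qr epq; apply/eqP => eqr.
have : (#|o p |: [set o q; o r]| <= #|[set v | nd v == nd (o r)]|)%N.
  apply/subset_leq_card/subsetP => v; rewrite !inE => /or3P[] /eqP->; rewrite ?eqxx //.
    by rewrite epq eqr.
  by rewrite eqr.
by rewrite fiber cardsU1 cards2 !inE !(inj_eq o_inj) negb_or pq pr qr.
Qed.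

Let sum_cutW y z : \sum_a \sum_(b | b != a) (cut y z a b)%:R * W a b = (2 * (y != z))%:R * W y z.
Proof.
have one u v : \sum_a \sum_(b | b != a) ((u == a) * (v == b))%N%:R * W a b = (u != v)%:R * W u v.
  rewrite (bigD1 u) //= [X in _ + X]big1 ?addr0; last first.
    by move=> a; rewrite eq_sym => /negbTE-> ; rewrite big1 // => b _; rewrite mul0n mul0r.
  rewrite eqxx; have [<-|ne] := eqVneq u v.
    by rewrite mul0r big1 // => b; rewrite eq_sym => /negbTE->; rewrite mul0r.
  rewrite (bigD1 v) /=; last by rewrite eq_sym.
  rewrite eqxx !mul1r big1 ?addr0 // => b /andP[_].
  by rewrite eq_sym => /negbTE->; rewrite mul0r.
transitivity (\sum_a \sum_(b | b != a) ((y == a) * (z == b))%N%:R * W a b +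
              \sum_a \sum_(b | b != a) ((z == a) * (y == b))%N%:R * W a b).
  rewrite -big_split; apply: eq_bigr => a _; rewrite -big_split; apply: eq_bigr => b _ /=.
  by rewrite /cut natrD mulrDl [((y == b) * _)%N]mulnC.
rewrite !one natrM [z == y]eq_sym [W z y]WC; ring.
Qed.

(** For any vertex [z] of another node, [w u v <= w u z + w z v], and both terms are at most [W].
    The share of the node itself is lost, at most [e / 2]. *)
Let shareW u v : nd u = nd v ->
  w u v * (1 - e / 2) / 2 <= \sum_(b | b != nd u) share b * W (nd u) b.
Proof.
move=> uv; have : w u v / 2 * (1 - share (nd u)) <= \sum_(b | b != nd u) share b * W (nd u) b.
  have -> : 1 - share (nd u) = \sum_(b | b != nd u) share b.
    by have := share_sum; rewrite (bigD1 (nd u)) //=; lra.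
  rewrite mulr_sumr; apply: ler_sum => b nb.
  rewrite mulrC ler_wpM2l // ler_pdivrMr //.
  have /card_gt0P[z] : (0 < #|[set v | nd v == b]|)%N by rewrite fiber.
  rewrite inE => /eqP zb; move: nb; rewrite -zb eq_sym => nb.
  have h1 := wW nb; have h2 : w v z <= W (nd u) (nd z) by rewrite uv in nb *; apply: wW.
  by have := w_triangle u z v; rewrite (wC z v); lra.
apply: le_trans; have := w0 u v; have := share_le (nd u); nra.
Qed.

(** Path by path, a surviving edge has the value 1/4, or 1 between two contracted ends, and a demand
    of 1/2 recovers half the weight of a contracted edge by [shareW]. The factor 2 is due to ordered
    pairs. *)
Lemma heavy_contracted_matching : exists f : {ffun Nd -> Nd},
  [/\ involutive f, forall a, f a != a &
      2 * ((1 - e) * (1 - e / 2)) * \sum_P path_gain P <= \sum_a W a (f a)].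
Proof.
have ev : ~~ odd #|Nd| by rewrite cardN mul2n odd_double.
have [f [fK fne fle]] := fractional_perfect_matching ev x_ge0 xC x_degree x_odd W0 WC.
exists f; split=> //; apply: le_trans fle.
have [S SE] : exists S, forall a, S a = \sum_(b | b != a) share b * W a b by eexists.
have -> : \sum_a \sum_(b | b != a) x a b * W a b =
  (1 - e) * (\sum_a \sum_(b | b != a) frac a b * W a b + 2 * \sum_a demand0 a * S a).
  have sym : \sum_a \sum_(b | b != a) demand b * share a * W a b = \sum_a demand a * S a.
    rewrite (exchange_big_dep predT) //=; apply: eq_bigr => a _; rewrite SE mulr_sumr.
    apply: eq_big => [b|b _]; first by rewrite eq_sym.
    by rewrite WC mulrA.
  have sym2 : \sum_a demand a * S a = (1 - e) * \sum_a demand0 a * S a.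
    by rewrite [RHS]mulr_sumr; apply: eq_bigr => a _; exact: esym (mulrA _ _ _).
  transitivity ((1 - e) * (\sum_a \sum_(b | b != a) frac a b * W a b) +
    (\sum_a demand a * S a + \sum_a \sum_(b | b != a) demand b * share a * W a b)).
    rewrite mulr_sumr -!big_split /=; apply: eq_bigr => a _.
    rewrite SE !mulr_sumr -!big_split /=; apply: eq_bigr => b _.
    by rewrite /x; move: (frac a b) (demand a) (demand b) (share a) (share b) => f1 d1 d2 s1 s2; ring.
  rewrite sym sym2; move: (\sum_a _) (\sum_a demand0 _ * _) => X1 X2; ring.
rewrite -mulrA mulrCA -mulrA ler_wpM2l // mulrA.
have -> : \sum_a demand0 a * S a = \sum_P (one_edge_in o nd P)%:R * S (in_node o nd P) / 2.
  transitivity (\sum_a \sum_P (one_edge_in o nd P && (in_node o nd P == a))%:R * S a / 2).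
    by apply: eq_bigr => a _; rewrite /demand0 /demandN natr_sum -mulrA mulr_suml; apply: eq_bigr => P _; ring.
  rewrite exchange_big /=; apply: eq_bigr => P _; rewrite (bigD1 (in_node o nd P)) //= eqxx andbT.
  by rewrite big1 ?addr0 // => a; rewrite eq_sym => /negbTE->; rewrite andbF !mul0r.
have -> : \sum_a \sum_(b | b != a) frac a b * W a b =
   \sum_P (\sum_a \sum_(b | b != a) (pathN o nd P a b)%:R * W a b) / 4.
  transitivity (\sum_a \sum_(b | b != a) \sum_P (pathN o nd P a b)%:R * W a b / 4).
    apply: eq_bigr => a _; apply: eq_bigr => b _; rewrite /frac /fracN natr_sum 2!mulr_suml.
    by apply: eq_bigr => P _; rewrite mulrAC.
  under eq_bigr do rewrite exchange_big.
  rewrite exchange_big; apply: eq_bigr => P _; rewrite mulr_suml; apply: eq_bigr => a _.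
  by rewrite mulr_suml.
rewrite !mulr_sumr -big_split /=; apply: ler_sum => P _.
have t2 : (2 * true)%N = 2%N by [].
have f2 : (2 * false)%N = 0%N by [].
have z2 : (2 * 0)%N = 0%N by [].
have ew u v : 0 <= e * w u v by rewrite mulr_ge0 // ltW.
have ne (i j : 'I_4) : i != j -> (P, i) != (P, j) by rewrite xpair_eqE eqxx.
rewrite /path_gain /pathN /one_edge_in; case bP: (both_ends_in o nd P) => /=.
  have := bP => /andP[/eqP e01 /eqP e23].
  have n12 := no_triple (ne i0 i1 isT) (ne i0 i2 isT) (ne i1 i2 isT) e01.
  have -> : \sum_a \sum_(b | b != a) (4 * cut (nd (o (P, i1))) (nd (o (P, i2))) a b)%N%:R * W a b = 
    4 * (2 * W (nd (o (P, i1))) (nd (o (P, i2)))).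
  have := sum_cutW (nd (o (P, i1))) (nd (o (P, i2))); rewrite n12 muln1 => <-.
    rewrite mulr_sumr; apply: eq_bigr => a _; rewrite mulr_sumr; apply: eq_bigr => b _.
    by rewrite natrM mulrA.
  by have := wW n12; have := ew (o (P, i1)) (o (P, i2)); lra.
have -> : \sum_a \sum_(b | b != a) (cut (nd (o (P, i0))) (nd (o (P, i1))) a b +
     cut (nd (o (P, i1))) (nd (o (P, i2))) a b + cut (nd (o (P, i2))) (nd (o (P, i3))) a b)%N%:R * W a b = 
   (2 * (nd (o (P, i0)) != nd (o (P, i1))))%:R * W (nd (o (P, i0))) (nd (o (P, i1))) +
   (2 * (nd (o (P, i1)) != nd (o (P, i2))))%:R * W (nd (o (P, i1))) (nd (o (P, i2))) +
   (2 * (nd (o (P, i2)) != nd (o (P, i3))))%:R * W (nd (o (P, i2))) (nd (o (P, i3))).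
  rewrite -!sum_cutW -!big_split; apply: eq_bigr => a _; rewrite -!big_split; apply: eq_bigr => b _ /=.
  by rewrite !natrD !mulrDl.
move/negbT: bP; rewrite /both_ends_in /path_total /in_node negb_and.
move: (ew (o (P, i0)) (o (P, i1))) (ew (o (P, i1)) (o (P, i2))) (ew (o (P, i2)) (o (P, i3))).
move: (W0 (nd (o (P, i0))) (nd (o (P, i1)))) (W0 (nd (o (P, i1))) (nd (o (P, i2)))) (W0 (nd (o (P, i2))) (nd (o (P, i3)))).
case: (eqVneq (nd (o (P, i0))) (nd (o (P, i1)))) => [l1|/wW] /=.
  move=> + + + + + + nl2; have := wW (no_triple (ne i0 i1 isT) (ne i0 i2 isT) (ne i1 i2 isT) l1).
  have := wW nl2; have := shareW l1; rewrite nl2 -SE.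
  have -> : nd (o (P, i1)) != nd (o (P, i2)).
    exact: no_triple (ne i0 i1 isT) (ne i0 i2 isT) (ne i1 i2 isT) l1.
  by rewrite ?t2 ?f2 ?z2; lra.
case: (eqVneq (nd (o (P, i2))) (nd (o (P, i3)))) => [l2|/wW] /=.
  have n12 : nd (o (P, i1)) != nd (o (P, i2)).
    by rewrite l2 eq_sym; apply: no_triple (ne i2 i3 isT) (ne i2 i1 isT) (ne i3 i1 isT) l2.
  have := wW n12; have := shareW l2; rewrite n12 -SE.
  by rewrite ?t2 ?f2 ?z2; lra.
case: (eqVneq (nd (o (P, i1))) (nd (o (P, i2)))) => [l3|/wW] /=.
  by have := shareW l3; rewrite -SE ?t2 ?f2 ?z2; lra.
by rewrite ?t2 ?f2 ?z2; lra.
Qed.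

End Rounding.

(** * Layouts *)

Local Close Scope ring_scope.

Section Slots.

(* [tau] pairs the slots; a layout [s] of the slots realizes the matching
   [s \o tau \o s^-1]. *)
Variables (T V : finType) (tau : T -> T).
Hypotheses (tauK : involutive tau) (tau_neq : forall q, tau q != q).
Hypothesis cardTV : #|V| = #|T|.

Lemma layout_surj (s : T -> V) : injective s -> forall v, exists q, v = s q.
Proof.
move=> sI v; have := inj_card_onto sI; rewrite cardTV => /(_ (leqnn _) v).
by case/codomP=> q ->; exists q.
Qed.

Lemma layout_matching (s : T -> V) : injective s -> exists mu : V -> V,
  [/\ forall q, mu (s q) = s (tau q), involutive mu & forall v, mu v != v].
Proof.
move=> sI; have [g sg gs] : bijective s by apply: inj_card_bij => //; rewrite cardTV.
exists (fun v => s (tau (g v))); split=> [q|v|v]; first by rewrite sg.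
  by rewrite sg tauK gs.
by rewrite -{2}(gs v) (inj_eq sI).
Qed.

Variables (dumT : pred T) (dumV : pred V) (f : V -> V).
Hypotheses (fK : involutive f) (f_neq : forall v, f v != v).
Hypothesis tau_dum : forall q, dumT q -> ~~ dumT (tau q).
Hypothesis f_dum : forall v, dumV v -> ~~ dumV (f v).

(** Repeatedly swap the vertex due at [tau q] into that slot; slots that are already right stay
    untouched, so the layout changes only at points whose partner changes. Treating dummy slots
    first ensures that no swap moves a dummy. *)
Lemma realize_matching (s : {ffun T -> V}) : injective s -> (forall q, dumV (s q) = dumT q) ->
  exists s' : {ffun T -> V}, [/\ injective s', forall q, f (s' q) = s' (tau q),
    forall q, dumT q -> s' q = s q & forall q, f (s q) = s (tau q) -> s' q = s q].
Proof.
have [N] := ubnP #|[set q | f (s q) != s (tau q)]|; elim: N s => // N IH s ltN sI sd.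
have step q : f (s q) != s (tau q) -> ~~ dumT (tau q) -> ~~ dumV (f (s q)) ->
    exists s' : {ffun T -> V}, [/\ injective s', forall q, f (s' q) = s' (tau q),
    forall q, dumT q -> s' q = s q & forall q, f (s q) = s (tau q) -> s' q = s q].
  move=> bad nd1 nd2; have [q2 q2E] := layout_surj sI (f (s q)).
  have q2d : ~~ dumT q2 by rewrite -sd -q2E.
  have ne : tau q != q2 by apply: contraNneq bad => ->; rewrite q2E.
  pose sw := tperm (tau q) q2.
  pose s1 : {ffun T -> V} := [ffun p => s (sw p)].
  have s1I : injective s1 by move=> a b; rewrite !ffunE => /sI/perm_inj.
  have nq : q != q2 by apply/eqP => e; have := f_neq (s q); rewrite q2E -e eqxx.
  have s1q : s1 q = s q by rewrite ffunE /sw tpermD // eq_sym.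
  have s1tq : s1 (tau q) = f (s q) by rewrite ffunE /sw tpermL q2E.
  have s1E p : f (s p) = s (tau p) -> s1 p = s p /\ s1 (tau p) = s (tau p).
    move=> ok.
    have h1 : p != tau q.
      by apply: contraNneq bad => e; rewrite -(inj_eq (can_inj fK)) fK -e ok e tauK.
    have h2 : p != q2.
      by apply: contraNneq ne => e; move: ok; rewrite e -q2E fK => /sI ->; rewrite tauK.
    have h3 : tau p != tau q by rewrite (inj_eq (can_inj tauK)); apply/eqP => e; rewrite -e ok eqxx in bad.
    have h4 : tau p != q2.
      apply: contraNneq h3 => e; have -> // : p = q.
      by apply: sI; apply: (can_inj fK); rewrite ok e q2E.
    by rewrite !ffunE /sw !tpermD // eq_sym.
  have s1d p : dumV (s1 p) = dumT p.
    by rewrite ffunE sd /sw; case: tpermP => [->|->|] //; rewrite (negbTE nd1) (negbTE q2d).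
  have s1dum p : dumT p -> s1 p = s p.
    move=> dp; rewrite ffunE /sw tpermD //; first by apply: contraNneq nd1 => ->.
    by apply: contraNneq q2d => ->.
  have [|//|s' [s'I s'f s'd s'E]] := IH s1 _ s1I.
    rewrite -ltnS; apply: leq_trans ltN; rewrite ltnS; apply: proper_card; apply/properP; split.
      apply/subsetP => p; rewrite !inE; apply: contraNneq => ok.
      by have [-> ->] := s1E p ok; rewrite ok.
    by exists q; rewrite !inE ?bad // s1q s1tq eqxx.
  exists s'; split=> // p.
    by move=> dp; rewrite s'd // s1dum.
  by move=> ok; have [e1 e2] := s1E p ok; rewrite s'E // e1 e2.
have [q /andP[dq bad]|nodum] := pickP (fun q => dumT q && (f (s q) != s (tau q))).
  by apply: (step q) => //; [apply: tau_dum | apply: f_dum; rewrite sd].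
have dumok q : dumT q -> f (s q) = s (tau q).
  by move=> dq; have := nodum q; rewrite dq /= => /negbFE/eqP.
have [q bad|ok] := pickP (fun q => f (s q) != s (tau q)).
  apply: (step q) => //; apply/negP => d.
    have := dumok _ d; rewrite tauK => e.
    by move: bad; rewrite -e fK eqxx.
  have [q2 q2E] := layout_surj sI (f (s q)).
  have := dumok q2; rewrite -sd -q2E d => /(_ isT); rewrite fK => /sI e.
  by move: bad; rewrite q2E e tauK eqxx.
by exists s; split=> // q; apply/eqP/negbFE/ok.
Qed.

End Slots.

Lemma sum_positions k (F : 'I_k * 'I_4 -> nat) :
  \sum_q F q = \sum_P (F (P, i0) + F (P, i1) + F (P, i2) + F (P, i3)).
Proof.
rewrite (eq_bigr (fun q => F (q.1, q.2))) => [|[]//].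
rewrite -(pair_bigA _ (fun P i => F (P, i))) /=.
by apply: eq_bigr => P _; rewrite sum4.
Qed.

Section Objectives.

Variables (V : finType) (k : nat).
Hypothesis cardV : #|V| = 4 * k.
Variable w : V -> V -> nat.
Hypothesis wC : forall u v, w u v = w v u.

Notation pos := ('I_k * 'I_4)%type.
Implicit Types (s o : {ffun pos -> V}).

Definition ends_weight (s : pos -> V) := \sum_P (w (s (P, i0)) (s (P, i1)) + w (s (P, i2)) (s (P, i3))).
Definition mids_weight (s : pos -> V) := \sum_P w (s (P, i1)) (s (P, i2)).
Definition objective A C (s : pos -> V) := A * ends_weight s + C * mids_weight s.

Definition diff s o := [set q | s q != o q].

Definition local_optimum c A C s := forall s', injective s' -> #|diff s' s| <= c ->
  objective A C s' <= objective A C s.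

Let cardVpos : #|V| = #|{: pos}|. Proof. by rewrite card_prod !card_ord cardV mulnC. Qed.

Lemma sum_over_layout s (F : V -> nat) : injective s -> \sum_v F v = \sum_q F (s q).
Proof.
move=> sI; rewrite (reindex s) //=; apply: onW_bij.
by apply: inj_card_bij => //; rewrite cardVpos.
Qed.

Definition end_partner (q : pos) : pos :=
  (q.1, if q.2 == i0 then i1 else if q.2 == i1 then i0 else if q.2 == i2 then i3 else i2).

Lemma end_partnerK : involutive end_partner.
Proof. by case=> P; elim/ord4P. Qed.

Lemma end_partner_neq q : end_partner q != q.
Proof. by case: q => P; elim/ord4P; rewrite xpair_eqE eqxx. Qed.

Lemma sum_end_partner s : \sum_q w (s q) (s (end_partner q)) = 2 * ends_weight s.
Proof.
rewrite sum_positions /ends_weight big_distrr; apply: eq_bigr => P _ /=.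
rewrite /end_partner /= [w (s (P, i1)) _]wC [w (s (P, i3)) _]wC.
by move: (w _ _) (w _ _) => a b; lia.
Qed.

(** The end edges already form a perfect matching, so the general bound applies without dummies. *)
Lemma ends_local_optimum L c s o : injective s -> injective o -> 2 * L + 4 <= c ->
  (forall s', injective s' -> #|diff s' s| <= c -> ends_weight s' <= ends_weight s) ->
  L * ends_weight o <= (L + 2) * ends_weight s.
Proof.
move=> sI oI Lc opt.
have [mu [mus muK mu_neq]] := layout_matching end_partnerK end_partner_neq cardVpos sI.
have [nu [nuo nuK nu_neq]] := layout_matching end_partnerK end_partner_neq cardVpos oI.
have sumE (t : {ffun pos -> V}) f : injective t -> (forall q, f (t q) = t (end_partner q)) ->
    \sum_v w v (f v) = 2 * ends_weight t.
  move=> tI ft; rewrite (sum_over_layout _ tI) -sum_end_partner.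
  by apply: eq_bigr => q _; rewrite ft.
have := @local_search_matching V w pred0 wC mu nu L muK nuK mu_neq nu_neq.
rewrite (sumE s) // (sumE o) // !(mulnCA _ 2) leq_pmul2l //; apply=> // f fK f_neq _ df.
have [s' [s'I s'f _ s'E]] := realize_matching (dumT := pred0) (dumV := pred0)
  end_partnerK end_partner_neq cardVpos fK f_neq (fun _ _ => isT) (fun _ _ => isT) sI (fun _ => erefl).
rewrite (sumE s') // leq_mul2l; apply: opt => //; apply: leq_trans Lc; apply: leq_trans df.
rewrite -(card_imset (diff s' s) sI); apply/subset_leq_card/subsetP => v /imsetP[q].
by rewrite !inE => nq ->; apply: contraNneq nq => e; rewrite s'E // e mus.
Qed.

Notation dummy := ('I_k * bool)%type.

(** End slots are matched with dummies of weight 0, which turns the middle edges into a perfect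
    matching. Forbidding edges between dummies keeps the number of middle edges at [k]. *)
Definition mid_partner (q : pos + dummy) : pos + dummy :=
  match q with
  | inl (P, r) => if r == i0 then inr (P, false) else if r == i1 then inl (P, i2)
                  else if r == i2 then inl (P, i1) else inr (P, true)
  | inr (P, b) => inl (P, if b then i3 else i0)
  end.

Lemma mid_partnerK : involutive mid_partner.
Proof. by case=> [[P]|[P []]] //; elim/ord4P. Qed.

Lemma mid_partner_neq q : mid_partner q != q.
Proof. by case: q => [[P]|[P []]] //; elim/ord4P; apply/eqP => -[]. Qed.

Let is_dummy (A B : Type) (x : A + B) : bool := if x is inr _ then true else false.

Lemma mid_partner_dummy q : is_dummy q -> ~~ is_dummy (mid_partner q).
Proof. by case: q => // -[]. Qed.

Definition with_dummies s : {ffun pos + dummy -> V + dummy} :=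
  [ffun q => match q with inl q => inl (s q) | inr d => inr d end].

Lemma with_dummies_inj s : injective s -> injective (with_dummies s).
Proof. by move=> sI [a|a] [b|b]; rewrite !ffunE => // -[]; [move/sI-> | move->]. Qed.

Let wd (x y : V + dummy) : nat := if x is inl u then if y is inl v then w u v else 0 else 0.

Let wdC x y : wd x y = wd y x.
Proof. by case: x y => [u|d] [v|d'] //=. Qed.

Let card_dummies : #|{: V + dummy}| = #|{: pos + dummy}|.
Proof. by rewrite !card_sum cardVpos. Qed.

Lemma sum_sum (A B : finType) (F : A + B -> nat) :
  \sum_x F x = \sum_a F (inl a) + \sum_b F (inr b).
Proof.
rewrite (bigID (@is_dummy A B)) /= addnC; congr (_ + _).
  rewrite (reindex_omap inl (fun x => if x is inl a then Some a else None)) /=; last by case.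
  by apply: eq_bigl => a; rewrite eqxx.
rewrite (reindex_omap inr (fun x => if x is inr a then Some a else None)) /=; last by case.
by apply: eq_bigl => a; rewrite eqxx.
Qed.

Lemma sum_mid_partner s f : injective s ->
  (forall q, f (with_dummies s q) = with_dummies s (mid_partner q)) ->
  \sum_x wd x (f x) = 2 * mids_weight s.
Proof.
move=> sI fE; rewrite sum_sum [X in _ + X]big1 ?addn0 //.
rewrite (sum_over_layout (fun v => wd (inl v) (f (inl v))) sI) sum_positions.
have fs q : f (inl (s q)) = with_dummies s (mid_partner (inl q)) by rewrite -fE ffunE.
rewrite /mids_weight big_distrr; apply: eq_bigr => P _ /=.
rewrite !fs !ffunE /= [w (s (P, i2)) _]wC.
by move: (w _ _) => a; lia.
Qed.

Definition is_end (q : pos) := (q.2 == i0) || (q.2 == i3).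

(** End positions may be permuted without changing the middle edges. Maximizing the number of
    agreements puts every vertex that is an end in both layouts at the same position. *)
Lemma align_ends s o : injective s -> injective o -> exists o' : {ffun pos -> V},
  [/\ injective o', mids_weight o' = mids_weight o &
      forall p q, is_end p -> is_end q -> o' p = s q -> p = q].
Proof.
move=> sI oI.
pose ok (o' : {ffun pos -> V}) := injectiveb o' && [forall q, is_end q || (o' q == o q)].
pose score (o' : {ffun pos -> V}) := #|[set q | is_end q && (o' q == s q)]|.
have ok_o : ok o by rewrite /ok; apply/andP; split; [apply/injectiveP | apply/forallP => q; rewrite eqxx orbT].
case: (arg_maxnP score ok_o) => o' /andP[/injectiveP o'I /forallP mid] omax.
exists o'; split=> //.
  apply: eq_bigr => P _; have := mid (P, i1); have := mid (P, i2).
  by rewrite /is_end /= => /eqP-> /eqP->.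
move=> p q ep eq opq; apply/eqP/negPn/negP => npq.
pose o2 : {ffun pos -> V} := [ffun a => o' (tperm p q a)].
have ok2 : ok o2.
  apply/andP; split; first by apply/injectiveP => a b; rewrite !ffunE => /o'I/perm_inj.
  apply/forallP => a; rewrite ffunE; case: tpermP => [->|->|_ _]; rewrite ?ep ?eq //; exact: mid.
have : score o2 <= score o' by exact: omax.
rewrite leqNgt => /negP; apply; apply: proper_card; apply/properP; split.
  apply/subsetP => a; rewrite !inE ffunE => /andP[ea /eqP oa]; rewrite ea /=.
  case: tpermP => [e|e|_ _]; last by rewrite oa.
    by move: oa; rewrite e opq => /sI qp; rewrite qp eqxx in npq.
  by move: oa; rewrite e -opq => /o'I qp; rewrite qp eqxx in npq.
exists q; first by rewrite !inE eq ffunE tpermR opq eqxx.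
by rewrite !inE eq /= -opq (inj_eq o'I) eq_sym.
Qed.

Lemma mids_local_optimum L c s o : injective s -> injective o -> 2 * L + 4 <= c ->
  (forall s', injective s' -> #|diff s' s| <= c -> mids_weight s' <= mids_weight s) ->
  L * mids_weight o <= (L + 2) * mids_weight s.
Proof.
move=> sI oI Lc opt; have [o' [o'I <- align]] := align_ends sI oI.
have sdI := with_dummies_inj sI; have odI := with_dummies_inj o'I.
have [mu [mus muK mu_neq]] := layout_matching mid_partnerK mid_partner_neq card_dummies sdI.
have [nu [nuo nuK nu_neq]] := layout_matching mid_partnerK mid_partner_neq card_dummies odI.
have dummy_out (t : {ffun pos -> V}) (f : V + dummy -> V + dummy) : (forall q, f (with_dummies t q) = with_dummies t (mid_partner q)) ->
    forall x, is_dummy x -> ~~ is_dummy (f x).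
  by move=> fE [//|[P b]] _; have := fE (inr (P, b)); rewrite !ffunE => ->.
have mud P b : mu (inr (P, b)) = inl (s (P, if b then i3 else i0)).
  by have := mus (inr (P, b)); rewrite !ffunE.
have nud P b : nu (inr (P, b)) = inl (o' (P, if b then i3 else i0)).
  by have := nuo (inr (P, b)); rewrite !ffunE.
(* If a dummy has different partners, then by the alignment its partner under [nu] is a middle
   vertex of [s], and [mu] matches that to a vertex. *)
have next x : is_dummy x -> mu x != nu x -> ~~ is_dummy (mu (nu x)).
  case: x => [//|[P b]] _; rewrite mud nud => ne.
  case: (layout_surj cardVpos sI (o' (P, if b then i3 else i0))) => q qE.
  have neq : ~~ is_end q.
    apply/negP => eq; have ep : is_end (P, if b then i3 else i0) by case: b {ne qE}.
    by case/eqP: ne; rewrite qE -(align _ q ep eq qE).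
  rewrite qE; have := mus (inl q); rewrite !ffunE => ->.
  by case: q {qE} neq => Q; elim/ord4P.
have := @local_search_matching _ wd (@is_dummy V dummy) wdC mu nu L muK nuK mu_neq nu_neq
   (dummy_out s mu mus) (dummy_out o' nu nuo) next.
rewrite (sum_mid_partner sI mus) (sum_mid_partner o'I nuo) !(mulnCA _ 2) leq_pmul2l //.
apply=> f fK f_neq f_dum df.
have dE q : is_dummy (with_dummies s q) = is_dummy q by rewrite ffunE; case: q.
have [t [tI tf td tE]] := realize_matching mid_partnerK mid_partner_neq card_dummies
   fK f_neq mid_partner_dummy f_dum sdI dE.
have tl q : exists v, t (inl q) = inl v.
  case e: (t (inl q)) => [v|d]; first by exists v.
  by have /tI : t (inl q) = t (inr d) by rewrite e (td (inr d)) // ffunE.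
have s'P q : t (inl q) == inl (if t (inl q) is inl v then v else s q).
  by have [v ->] := tl q.
pose s' : {ffun pos -> V} := [ffun q => if t (inl q) is inl v then v else s q].
have s'E q : t (inl q) = inl (s' q) by rewrite ffunE; apply/eqP.
have s'I : injective s'.
  by move=> a b e; have /tI[] : t (inl a) = t (inl b) by rewrite !s'E e.
have ts' q : t q = with_dummies s' q.
  by rewrite ffunE; case: q => [q|d]; rewrite ?s'E // td // ffunE.
rewrite (sum_mid_partner s'I) ?leq_mul2l; last by move=> q; rewrite -!ts'.
apply: opt => //; apply: leq_trans Lc; apply: leq_trans df.
rewrite -(card_imset (diff s' s) (inj_comp (@inl_inj _ dummy) sI)).
apply/subset_leq_card/subsetP => v /imsetP[q]; rewrite !inE => nq -> /=.
apply: contraNneq nq => e; have := tE (inl q); rewrite !ffunE e.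
have := mus (inl q); rewrite ffunE => -> /(_ _)/wrap[]; first by rewrite ffunE.
by rewrite s'E => -[->].
Qed.

End Objectives.

(** * Middle edges as a matching of the contracted end edges *)

Section Connectors.

Variables (V : finType) (k : nat).
Hypothesis cardV : #|V| = 4 * k.
Variable w : V -> V -> nat.
Hypothesis wC : forall u v, w u v = w v u.

Notation pos := ('I_k * 'I_4)%type.
Notation node := ('I_k * bool)%type.
Variables (s : {ffun pos -> V}).
Hypothesis sI : injective s.

(* Block [P] consists of the nodes [(P, false)] and [(P, true)]; the slots next
   to the middle edge of the block are [slot (P, false) true] and
   [slot (P, true) false]. *)
Definition slot (a : node) (c : bool) : pos :=
  (a.1, if a.2 then if c then i3 else i2 else if c then i1 else i0).
Definition node_of (q : pos) : node := (q.1, (q.2 == i2) || (q.2 == i3)).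
Definition side_of (q : pos) := (q.2 == i1) || (q.2 == i3).

Lemma slotK a c : node_of (slot a c) = a /\ side_of (slot a c) = c.
Proof. by case: a => P [] ; case: c. Qed.

Lemma node_ofK q : slot (node_of q) (side_of q) = q.
Proof. by case: q => P; elim/ord4P. Qed.

Definition node_dist (a b : node) :=
  \max_(c : bool) \max_(c' : bool) w (s (slot a c)) (s (slot b c')).

Lemma node_dist_ge a b c c' : w (s (slot a c)) (s (slot b c')) <= node_dist a b.
Proof.
apply: leq_trans (leq_bigmax (F := fun c => \max_(c' : bool) w (s (slot a c)) (s (slot b c'))) c).
exact: (leq_bigmax (F := fun c' => w (s (slot a c)) (s (slot b c'))) c').
Qed.

Lemma node_dist_attained a b : exists c c', node_dist a b = w (s (slot a c)) (s (slot b c')).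
Proof.
have b0 : 0 < #|{: bool}| by rewrite card_bool.
have [c e] := @bigop.eq_bigmax _ (fun c => \max_(c' : bool) w (s (slot a c)) (s (slot b c'))) b0.
have [c' e'] := @bigop.eq_bigmax _ (fun c' => w (s (slot a c)) (s (slot b c'))) b0.
by exists c, c'; rewrite /node_dist e e'.
Qed.

Lemma node_distC a b : node_dist a b = node_dist b a.
Proof.
have le x y : node_dist x y <= node_dist y x.
  by have [c [c' ->]] := node_dist_attained x y; rewrite wC node_dist_ge.
by apply/eqP; rewrite eqn_leq !le.
Qed.

(** Moves end edges as a whole, possibly reversed, so that only the middle edges change. *)
Definition rearrange (kappa : node -> node) (flip : node -> bool) : {ffun pos -> V} :=
  [ffun q => s (slot (kappa (node_of q)) (side_of q (+) flip (node_of q)))].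

Lemma rearrange_inj kappa flip : injective kappa -> injective (rearrange kappa flip).
Proof.
move=> kI p q; rewrite !ffunE => /sI e.
have [e1 e2] := slotK (kappa (node_of p)) (side_of p (+) flip (node_of p)).
rewrite e in e1 e2; have [e3 e4] := slotK (kappa (node_of q)) (side_of q (+) flip (node_of q)).
have nE : node_of p = node_of q by apply: kI; rewrite -e1 e3.
rewrite -(node_ofK p) -(node_ofK q) nE; congr slot.
by move: e2; rewrite e4 nE => /addIb.
Qed.

Let contracted a := w (s (slot a false)) (s (slot a true)).

Lemma ends_weight_rearrange kappa flip : injective kappa ->
  ends_weight w (rearrange kappa flip) = ends_weight w s.
Proof.
move=> kI.
have endsE (h : node -> nat) (t : pos -> V) : (forall a, w (t (slot a false)) (t (slot a true)) = h a) ->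
    ends_weight w t = \sum_a h a.
  move=> th; rewrite (eq_bigr (fun a => h (a.1, a.2))) => [|[]//].
  rewrite -(pair_bigA _ (fun P b => h (P, b))) /=; apply: eq_bigr => P _.
  by rewrite big_bool /= -!th addnC.
rewrite (endsE contracted s) // (endsE (fun a => contracted (kappa a))) => [|a]; last first.
  rewrite !ffunE; have [-> ->] := slotK a false; have [-> ->] := slotK a true.
  by case: (flip a); rewrite //= wC.
by rewrite [RHS](reindex_inj kI).
Qed.

Lemma mids_weight_rearrange kappa flip :
  mids_weight w (rearrange kappa flip) = \sum_P
     w (s (slot (kappa (P, false)) (~~ flip (P, false)))) (s (slot (kappa (P, true)) (flip (P, true)))).
Proof. by apply: eq_bigr => P _; rewrite !ffunE. Qed.

Variables (c L : nat).
Hypothesis Lc : 8 * L + 16 <= c.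
Hypothesis local_opt : forall s' : {ffun pos -> V}, injective s' -> #|diff s' s| <= c ->
  ends_weight w s' = ends_weight w s -> mids_weight w s' <= mids_weight w s.

Let partner (a : node) : node := (a.1, ~~ a.2).
Let partnerK : involutive partner. Proof. by case=> P b; rewrite /partner negbK. Qed.
Let partner_neq a : partner a != a.
Proof. by case: a => P []; rewrite xpair_eqE andbF. Qed.

Let rearrange_le kappa (D : {set 'I_k}) : injective kappa -> 4 * #|D| <= c ->
  (forall P, P \notin D -> forall b, kappa (P, b) = (P, b)) ->
  \sum_(P in D) node_dist (kappa (P, false)) (kappa (P, true)) <=
  \sum_(P in D) w (s (P, i1)) (s (P, i2)).
Proof.
move=> kI leD kE.
(* The flips are chosen to let each middle edge attain the largest of the four distances between its
   nodes. *)
have att a b : exists cc : bool * bool, node_dist a b == w (s (slot a (~~ cc.1))) (s (slot b cc.2)).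
  have [x [y ->]] := node_dist_attained a b; exists (~~ x, y); by rewrite /= negbK.
pose cc P := xchoose (att (kappa (P, false)) (kappa (P, true))).
have ccE P := eqP (xchooseP (att (kappa (P, false)) (kappa (P, true)))).
pose flip (a : node) := (a.1 \in D) && (if a.2 then (cc a.1).2 else (cc a.1).1).
have := local_opt (rearrange_inj (flip := flip) kI); rewrite ends_weight_rearrange // => /(_ _ erefl) H.
have {H} : mids_weight w (rearrange kappa flip) <= mids_weight w s.
  apply: H; apply: leq_trans leD.
  have -> : 4 * #|D| = #|setX D [set: 'I_4]| by rewrite cardsX cardsT card_ord mulnC.
  apply/subset_leq_card/subsetP => -[P r]; rewrite !inE ffunE andbT /=.
  apply: contraR => nD; rewrite kE // /flip /= (negbTE nD) addbF.
  by rewrite (node_ofK (P, r)).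
rewrite mids_weight_rearrange /mids_weight (bigID (mem D)) /= [X in _ <= X](bigID (mem D)) /=.
have -> : \sum_(P | P \notin D)
     w (s (slot (kappa (P, false)) (~~ flip (P, false)))) (s (slot (kappa (P, true)) (flip (P, true)))) =
   \sum_(P | P \notin D) w (s (P, i1)) (s (P, i2)).
  by apply: eq_bigr => P nD; rewrite !kE // /flip /= (negbTE nD).
rewrite leq_add2r; apply: leq_trans; apply: leq_sum => P PD.
by rewrite [X in X <= _]ccE /flip /= PD.
Qed.

Lemma block_optimum P : node_dist (P, false) (P, true) <= w (s (P, i1)) (s (P, i2)).
Proof.
have := @rearrange_le id [set P] (fun _ _ => id) _ (fun _ _ _ => erefl).
by rewrite !big_set1 cards1; apply; lia.
Qed.

(** A change at [2 * L + 4] nodes affects at most as many blocks, that is [8 * L + 16] positions;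
    this is the origin of the bound on [c]. *)
Lemma connectors_local_optimum (nu : node -> node) : involutive nu -> (forall a, nu a != a) ->
  L * \sum_a node_dist a (nu a) <= (L + 2) * (2 * mids_weight w s).
Proof.
move=> nuK nu_neq.
have sumP (kappa : node -> node) : \sum_a node_dist (kappa a) (kappa (partner a)) =
    2 * \sum_P node_dist (kappa (P, false)) (kappa (P, true)).
  rewrite (eq_bigr (fun a => node_dist (kappa (a.1, a.2)) (kappa (a.1, ~~ a.2)))) => [|[]//].
  rewrite -(pair_bigA _ (fun P b => node_dist (kappa (P, b)) (kappa (P, ~~ b)))) /=.
  rewrite big_distrr; apply: eq_bigr => P _; rewrite big_bool /=.
  by rewrite [node_dist (kappa (P, true)) _]node_distC addnn mul2n.
have opt := @local_search_matching _ node_dist pred0 node_distC partner nu L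
  partnerK nuK partner_neq nu_neq (fun _ _ => isT) (fun _ _ => isT) (fun _ _ _ => isT).
apply: leq_trans (opt _) _; last first.
  rewrite leq_mul2l (sumP id) leq_mul2l /=; apply/orP; right; apply: leq_sum => P _.
  exact: block_optimum.
move=> f fK f_neq _ df.
pose id0 : {ffun node -> node} := [ffun a => a].
have id0I : injective id0 by move=> a b; rewrite !ffunE.
have [kappa [kI kf _ kE]] := realize_matching (dumT := pred0) (dumV := pred0)
  partnerK partner_neq erefl fK f_neq (fun _ _ => isT) (fun _ _ => isT) id0I (fun _ => erefl).
have {}kE a : f a = partner a -> kappa a = a by move=> e; rewrite kE !ffunE.
rewrite (reindex_inj kI) /=; under eq_bigr do rewrite kf.
rewrite sumP [X in _ <= X](sumP id) leq_mul2l /=.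
pose D := [set a.1 | a in [set a | f a != partner a]].
have DE P : P \notin D -> forall b, kappa (P, b) = (P, b).
  move=> nP b; apply: kE; apply/eqP; apply: contraR nP => ne.
  by apply/imsetP; exists (P, b); rewrite ?inE.
rewrite (bigID (mem D)) /= [X in _ <= X](bigID (mem D)) /=.
apply: leq_add; last by apply: leq_sum => P nP; rewrite !DE.
apply: leq_trans (rearrange_le kI _ DE) _; last first.
  by apply: leq_sum => P _; exact: (node_dist_ge (P, false) (P, true) true false).
have : #|D| <= 2 * L + 4 by apply: leq_trans (leq_imset_card _ _) df.
by rewrite -(leq_pmul2l (isT : 0 < 4)) => /leq_trans; apply; lia.
Qed.

End Connectors.

(** * The approximation ratio *)

Local Open Scope ring_scope.

Section LocalOptima.

Variables (V : finType) (k : nat).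
Hypothesis cardV : #|V| = (4 * k)%N.
Variables (w : V -> V -> rat) (r : V -> V -> nat) (unit : rat).
Hypothesis wC : forall u v, w u v = w v u.
Hypothesis w0 : forall u v, 0 <= w u v.
Hypothesis w_triangle : forall u v x, w u x <= w u v + w v x.
Hypothesis rC : forall u v, r u v = r v u.
Hypothesis unit_gt0 : 0 < unit.
Hypothesis r_le : forall u v, (r u v)%:R * unit <= w u v.
Hypothesis r_gt : forall u v, w u v < (r u v).+1%:R * unit.

Notation pos := ('I_k * 'I_4)%type.
Implicit Types (s o : {ffun pos -> V}).

Let r_ge u v : w u v <= (r u v)%:R * unit + unit.
Proof. by have := r_gt u v; rewrite -natr1 mulrDl mul1r; apply: ltW. Qed.

Variables (c L B : nat) (e : rat).
Hypothesis Lc : (8 * L + 16 <= c)%N.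
Hypothesis ends_lt_B : forall s, injective s -> (ends_weight r s < B)%N.
Hypothesis mids_lt_B : forall s, injective s -> (mids_weight r s < B)%N.
Hypotheses (e0 : 0 < e) (e1 : e <= 1).

Lemma lex_le (a b a' b' : nat) : (B * a' + b' <= B * a + b)%N -> (b < B)%N -> (a' <= a)%N.
Proof. nia. Qed.

Lemma ends_first_ends s : injective s -> local_optimum r c B 1 s ->
  forall s', injective s' -> (#|diff s' s| <= c)%N -> (ends_weight r s' <= ends_weight r s)%N.
Proof.
move=> sI opt s' s'I d; have := opt s' s'I d; rewrite /objective !mul1n.
by move/lex_le; apply; apply: mids_lt_B.
Qed.

Lemma ends_first_mids s : injective s -> local_optimum r c B 1 s ->
  forall s', injective s' -> (#|diff s' s| <= c)%N -> ends_weight r s' = ends_weight r s ->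
  (mids_weight r s' <= mids_weight r s)%N.
Proof.
move=> sI opt s' s'I d ee; have := opt s' s'I d.
by rewrite /objective !mul1n ee leq_add2l.
Qed.

Lemma mids_first_mids s : injective s -> local_optimum r c 1 B s ->
  forall s', injective s' -> (#|diff s' s| <= c)%N -> (mids_weight r s' <= mids_weight r s)%N.
Proof.
move=> sI opt s' s'I d; have := opt s' s'I d; rewrite /objective !mul1n ![(ends_weight _ _ + _)%N]addnC.
by move/lex_le; apply; apply: ends_lt_B.
Qed.

Lemma mids_first_ends s : injective s -> local_optimum r c 1 B s ->
  forall s', injective s' -> (#|diff s' s| <= c)%N -> mids_weight r s' = mids_weight r s ->
  (ends_weight r s' <= ends_weight r s)%N.
Proof.
move=> sI opt s' s'I d ee; have := opt s' s'I d.
by rewrite /objective !mul1n ee leq_add2r.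
Qed.

Let cardVpos : #|V| = #|{: pos}|. Proof. by rewrite card_prod !card_ord cardV mulnC. Qed.

(** [nd] contracts the end edges of [s]. The additional [unit] in [W] makes it dominate the
    unrounded weights and costs one unit per node. *)
Lemma rounded_connectors s o : injective s -> injective o -> local_optimum r c B 1 s ->
  4 <= e * (e * (2 * k)%:R) -> exists nd : V -> 'I_k * bool,
  L%:R * (2 * ((1 - e) * (1 - e / 2)) * \sum_P path_gain o nd w P) <=
  (L + 2)%:R * (2 * (mids_weight r s)%:R * unit) + L%:R * (2 * k%:R * unit).
Proof.
move=> sI oI opt kbig.
have [g sg gs] : bijective s by apply: inj_card_bij => //; rewrite cardVpos.
pose nd v := node_of (g v); exists nd.
have fiber a : #|[set v | nd v == a]| = 2%N.
  have ne : slot a false != slot a true by case: a => P []; rewrite xpair_eqE eqxx.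
  rewrite -[RHS](_ : #|[set s (slot a false); s (slot a true)]| = 2%N); last first.
    by rewrite cards2 (inj_eq sI) ne.
  apply: eq_card => v; rewrite !inE /nd -{2 3}(gs v) !(inj_eq sI).
  rewrite -{2 3}(node_ofK (g v)); apply/eqP/orP => [->|].
    by case: side_of; rewrite eqxx; [right | left].
  by case=> /eqP h; have [<- _] := slotK (node_of (g v)) (side_of (g v)); rewrite h; case: (slotK a false); case: (slotK a true).
pose W a b : rat := (node_dist r s a b)%:R * unit + unit.
have WC a b : W a b = W b a by rewrite /W node_distC.
have W0 a b : 0 <= W a b by rewrite addr_ge0 ?mulr_ge0 // ltW.
have wW u v : nd u != nd v -> w u v <= W (nd u) (nd v).
  move=> _; apply: le_trans (r_ge u v) _; rewrite lerD2r ler_pM2r // ler_nat.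
  by rewrite -{1}(gs u) -{1}(gs v) -(node_ofK (g u)) -(node_ofK (g v)) node_dist_ge.
have [nu [nuK nu_neq nule]] := heavy_contracted_matching oI cardV fiber wC w0 w_triangle WC W0 wW e0 e1 kbig.
have := connectors_local_optimum cardV rC sI Lc (ends_first_mids sI opt) nuK nu_neq.
rewrite -(ler_nat rat) !natrM => H.
apply: le_trans (ler_wpM2l (ler0n _ L) nule) _.
have -> : \sum_a W a (nu a) = (\sum_a node_dist r s a (nu a))%N%:R * unit + 2 * k%:R * unit.
  rewrite big_split /= natr_sum -mulr_suml sumr_const; congr (_ + _).
  by rewrite card_prod card_ord card_bool -[LHS]mulr_natl natrM [k%:R * _]mulrC.
by rewrite mulrDr lerD2r !mulrA ler_pM2r // -!mulrA.
Qed.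

Let total o := \sum_P path_total o w P.
Let alpha o P := w (o (P, i0)) (o (P, i1)) + w (o (P, i2)) (o (P, i3)).
Let beta o P := w (o (P, i1)) (o (P, i2)).

Lemma rounded_ends s o : injective s -> injective o -> local_optimum r c B 1 s ->
  L%:R * \sum_P alpha o P <= (L + 2)%:R * ((ends_weight r s)%:R * unit) + L%:R * (2 * k%:R * unit).
Proof.
move=> sI oI opt.
have := ends_local_optimum cardV rC sI oI (_ : 2 * L + 4 <= c)%N (ends_first_ends sI opt).
move=> /(_ ltac:(lia)); rewrite -(ler_nat rat) !natrM => H.
have : \sum_P alpha o P <= (ends_weight r o)%:R * unit + 2 * k%:R * unit.
  have -> : 2 * k%:R * unit = \sum_(P < k) (unit + unit).
    by rewrite sumr_const card_ord -[RHS]mulr_natl; ring.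
  rewrite natr_sum mulr_suml -big_split /=; apply: ler_sum => P _.
  rewrite natrD mulrDl addrACA; exact: lerD (r_ge _ _) (r_ge _ _).
move/(ler_wpM2l (ler0n _ L)) => /le_trans; apply.
by rewrite mulrDr lerD2r !mulrA ler_pM2r.
Qed.

Let heavy o P := maxn (r (o (P, i1)) (o (P, i2))) (maxn (r (o (P, i0)) (o (P, i1))) (r (o (P, i2)) (o (P, i3)))).

(* Each path is permuted so that its heaviest edge becomes its middle edge. *)
Lemma heavy_layout o : injective o -> exists2 o' : {ffun pos -> V}, injective o' & mids_weight r o' = (\sum_P heavy o P)%N.
Proof.
move=> oI.
pose h P : {perm 'I_4} := if r (o (P, i1)) (o (P, i2)) == heavy o P then 1%g else
  if r (o (P, i0)) (o (P, i1)) == heavy o P then (tperm i0 i2)%g else tperm i1 i3.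
pose o' : {ffun pos -> V} := [ffun q => o (q.1, h q.1 q.2)].
exists o'; first by move=> [P i] [Q j]; rewrite !ffunE /= => /oI[<-] /perm_inj ->.
apply: eq_bigr => P _; rewrite !ffunE /= /h.
case: eqP => [<-|n1]; first by rewrite !perm1.
case: eqP => [<-|n2]; first by rewrite tpermR tpermD // rC.
rewrite tpermL tpermD // rC; move: n1 n2; rewrite /heavy.
by move: (r _ _) (r _ _) (r _ _) => x y z; lia.
Qed.

Lemma rounded_mids s o : injective s -> injective o -> local_optimum r c 1 B s ->
  L%:R * (\sum_P (heavy o P)%:R * unit) <= (L + 2)%:R * ((mids_weight r s)%:R * unit).
Proof.
move=> sI /heavy_layout[o' o'I oE] opt.
have := mids_local_optimum cardV rC sI o'I (_ : 2 * L + 4 <= c)%N (mids_first_mids sI opt).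
move=> /(_ ltac:(lia)); rewrite oE -(ler_nat rat) !natrM natr_sum => H.
by rewrite -mulr_suml !mulrA ler_pM2r.
Qed.

(** Swapping the two ends of a path keeps its middle edge, so by optimality the present ends weigh
    at least as much as the swapped ones. The four edges together exceed twice the middle edge by
    the triangle inequality, up to a rounding error of one for each of its two uses. *)
Lemma ends_from_mids s : injective s -> local_optimum r c 1 B s ->
  (mids_weight r s <= ends_weight r s + k)%N.
Proof.
move=> sI opt.
have -> : (ends_weight r s + k = \sum_P (r (s (P, i0)) (s (P, i1)) + r (s (P, i2)) (s (P, i3)) + 1))%N.
  by rewrite big_split /= sum1_card card_ord.
apply: leq_sum => P _.
pose t := tperm (P, i0) (P, i3).
pose s' : {ffun pos -> V} := [ffun q => s (t q)].
have s'I : injective s' by move=> a b; rewrite !ffunE => /sI/perm_inj.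
have sE Q i : Q != P -> s' (Q, i) = s (Q, i).
  by move=> nQ; rewrite ffunE tpermD // xpair_eqE eq_sym (negbTE nQ).
have s0 : s' (P, i0) = s (P, i3) by rewrite ffunE tpermL.
have s3 : s' (P, i3) = s (P, i0) by rewrite ffunE tpermR.
have s1 : s' (P, i1) = s (P, i1) by rewrite ffunE tpermD // xpair_eqE eqxx.
have s2 : s' (P, i2) = s (P, i2) by rewrite ffunE tpermD // xpair_eqE eqxx.
have le : (ends_weight r s' <= ends_weight r s)%N.
  apply: (mids_first_ends sI opt s'I).
    have : (#|diff s' s| <= #|[set (P, i0); (P, i3)]|)%N.
      apply/subset_leq_card/subsetP => q; rewrite !inE ffunE.
      apply: contraR; rewrite negb_or => /andP[n0 n3]; rewrite tpermD // eq_sym //.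
    by rewrite cards2; move: Lc; case: (_ != _); lia.
  apply: eq_bigr => Q _; have [->|nQ] := eqVneq Q P; last by rewrite !sE.
  by rewrite s1 s2.
move: le; rewrite /ends_weight (bigD1 P) //= [X in (_ <= X)%N](bigD1 P) //= s0 s1 s2 s3.
rewrite (eq_bigr (fun Q => r (s (Q, i0)) (s (Q, i1)) + r (s (Q, i2)) (s (Q, i3)))%N) => [|Q nQ]; last first.
  by rewrite !sE.
rewrite leq_add2r => le.
have tri u v x : (r v x <= r u v + r u x + 1)%N.
  rewrite -ltnS -(ltr_nat rat) -(ltr_pM2r unit_gt0).
  apply: le_lt_trans (r_le v x) _; apply: le_lt_trans (w_triangle v u x) _.
  have := r_gt u v; have := r_gt u x; rewrite (wC v u) -!natr1 !natrD; lra.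
have := tri (s (P, i0)) (s (P, i1)) (s (P, i2)); have := tri (s (P, i3)) (s (P, i1)) (s (P, i2)).
move: le; rewrite (rC (s (P, i3)) (s (P, i2))) (rC (s (P, i2)) (s (P, i0))).
by move: (r _ _) (r _ _) (r _ _) (r _ _) (r _ _) => x y z t1 t2; lia.
Qed.

(** For edges [x], [y], [z] with heaviest [h]: if not both ends are contracted, [2/3 * (x + z) + 1/6
    * (x + y + z) + 2/3 * h] suffices because [h >= y]. If both are, [2/3 * (x + y + z) + 2/3 * h]
    suffices because [h] is at least the average. *)
Lemma path_bound o (nd : V -> 'I_k * bool) P (q : rat) : 0 <= q -> q <= 1 ->
  5 / 6 * q * path_total o w P <=
  2 / 3 * (alpha o P + q * path_gain o nd w P) + 2 / 3 * ((heavy o P)%:R * unit + unit).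
Proof.
move=> q0 q1.
have hv u v : (r u v <= heavy o P)%N -> w u v <= (heavy o P)%:R * unit + unit.
  by move=> le; apply: le_trans (r_ge u v) _; rewrite lerD2r ler_pM2r // ler_nat.
have h1 := hv (o (P, i1)) (o (P, i2)) (leq_maxl _ _).
have h0 : w (o (P, i0)) (o (P, i1)) <= (heavy o P)%:R * unit + unit.
  by apply: hv; rewrite /heavy !leq_max leqnn orbT.
have h2 : w (o (P, i2)) (o (P, i3)) <= (heavy o P)%:R * unit + unit.
  by apply: hv; rewrite /heavy !leq_max leqnn !orbT.
move: (w0 (o (P, i0)) (o (P, i1))) (w0 (o (P, i1)) (o (P, i2))) (w0 (o (P, i2)) (o (P, i3))).
rewrite /path_gain /path_total /alpha; move: h0 h1 h2.
move: (w _ _) (w _ _) (w _ _) ((heavy o P)%:R * unit + unit) => x y z h hx hy hz x0 y0 z0.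
have qx := ler_wpM2r x0 q1; have qy := ler_wpM2r y0 q1; have qz := ler_wpM2r z0 q1.
have qx0 := mulr_ge0 q0 x0; have qy0 := mulr_ge0 q0 y0; have qz0 := mulr_ge0 q0 z0.
by case: ifP => _; lra.
Qed.

Lemma local_search_ratio s1 s2 s3 o (F : nat) :
  injective s1 -> injective s2 -> injective s3 -> injective o ->
  local_optimum r c B 1 s1 -> local_optimum r c 1 B s2 -> local_optimum r c 1 1 s3 ->
  (objective r 1 1 s1 <= F)%N -> (objective r 1 1 s2 <= F)%N -> (objective r 1 1 s3 <= F)%N ->
  10 * 10 * 10 <= L%:R :> rat -> e * (10 * 10 * 10) = 1 -> (e * (e * (2 * k)%:R) < 4 -> (4 * k <= c)%N) ->
  4 * k%:R * unit * (10 * 10 * 10) <= total o -> 14 / 17 * total o <= F%:R * unit.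
Proof.
move=> s1I s2I s3I oI opt1 opt2 opt3 F1 F2 F3 L1000 eE small unit_small.
have T0 : 0 <= total o by apply: sumr_ge0 => P _; rewrite /path_total !addr_ge0.
have ku0 : 0 <= k%:R * unit by rewrite mulr_ge0 // ltW.
have [/small kc|kbig] := ltP (e * (e * (2 * k)%:R)) 4.
  (* With at most [c] positions every layout is a neighbour of [s3], which is therefore optimal for
     the rounded weights. *)
  have : (objective r 1 1 o <= F)%N.
    apply: leq_trans F3; apply: opt3 => //; apply: leq_trans kc.
    by rewrite -cardV cardVpos max_card.
  rewrite /objective !mul1n -(ler_nat rat) natrD -(ler_pM2r unit_gt0) => H.
  have : total o <= ((ends_weight r o)%:R + (mids_weight r o)%:R) * unit + 3 * (k%:R * unit).
    have -> : 3 * (k%:R * unit) = \sum_(P < k) (3 * unit).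
      by rewrite sumr_const card_ord -[RHS]mulr_natl; ring.
    rewrite /total /ends_weight /mids_weight -natrD -big_split /= natr_sum mulr_suml -big_split /=.
    apply: ler_sum => P _; rewrite /path_total !natrD.
    have := r_ge (o (P, i0)) (o (P, i1)); have := r_ge (o (P, i1)) (o (P, i2)).
    have := r_ge (o (P, i2)) (o (P, i3)); lra.
  by lra.
have [nd I1] := rounded_connectors s1I oI opt1 kbig.
have I2 := rounded_ends s1I oI opt1.
have I3 := rounded_mids s2I oI opt2.
have I4 := ends_from_mids s2I opt2.
set q : rat := (1 - e) * (1 - e / 2) in I1.
have qE : q = (1 - 1 / (10 * 10 * 10)) * (1 - 1 / (20 * 10 * 10)).
  rewrite /q; have -> : e = 1 / (10 * 10 * 10) by lra.
  by lra.
have q0 : 0 <= q by rewrite qE; lra.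
have q1 : q <= 1 by rewrite qE; lra.
have S : 5 / 6 * q * total o <= 2 / 3 * (\sum_P alpha o P + q * \sum_P path_gain o nd w P) +
    2 / 3 * (\sum_P (heavy o P)%:R * unit + k%:R * unit).
  have -> : k%:R * unit = \sum_(P < k) unit by rewrite sumr_const card_ord mulr_natl.
  rewrite !mulr_sumr -!big_split /= !mulr_sumr -big_split /=.
  by apply: ler_sum => P _; apply: path_bound.
move: F1 F2 I4; rewrite /objective !mul1n -!(ler_nat rat) !natrD => F1 F2 I4.
have l0 := L1000.
move: S I1 I2 I3; rewrite natrD.
move: (\sum_P alpha _ _) (\sum_P path_gain _ _ _ _) (\sum_P (heavy _ _)%:R * unit) => X Y Z.
move: (total o) T0 unit_small => T T0 unit_small S I1 I2 I3.
move: (L%:R : rat) (ends_weight r s1)%:R (mids_weight r s1)%:R (ends_weight r s2)%:R (mids_weight r s2)%:R l0 F1 F2 I1 I2 I3 I4.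
move=> l a1 m1 a2 m2 l0 F1 F2 I1 I2 I3 I4.
have lp : 0 <= l + 2%:R by lra.
have J1 := ler_wpM2l lp (ler_wpM2r (ltW unit_gt0) F1).
have J2 := ler_wpM2l lp (ler_wpM2r (ltW unit_gt0) F2).
have J4 := ler_wpM2l lp (ler_wpM2r (ltW unit_gt0) I4).
have l0' : 0 <= l by lra.
have S' := ler_wpM2l l0' S.
have U' := ler_wpM2l l0' unit_small.
have lT := ler_wpM2r T0 l0.
rewrite -(@ler_pM2l _ (l + 2%:R)); last by lra.
(* Two thirds of the value of [s1] and one third of that of [s2], for which [ends_from_mids] gives
   twice the middle weight as at most [F] plus [k]. The terms in [k * unit] are the rounding
   errors. *)
have key : l * (5 / 6 * q * T) <= (l + 2%:R) * (F%:R * unit) + l * (2 * (k%:R * unit)) + l * (2 / 3 * (k%:R * unit)) + (l + 2%:R) * (k%:R * unit) / 3 by lra.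
rewrite qE in key; lra.
Qed.

End LocalOptima.

(** * Running programs *)

Local Close Scope ring_scope.

Section Runs.

Variable b : nat.
Hypothesis b2 : 2 <= b.

Definition small (z : int) := `|z|%N <= 2 ^ b.
Arguments small : simpl never.
Definition bounded (m : memory) := forall a i, small (m a i).

Fixpoint expr_size (e : expr) : nat :=
  match e with
  | Const _ => 1
  | Read _ e1 => (expr_size e1).+1
  | Binop _ e1 e2 => (expr_size e1 + expr_size e2).+1
  end.

Fixpoint small_consts (e : expr) : bool :=
  match e with
  | Const z => small z
  | Read _ e1 => small_consts e1
  | Binop _ e1 e2 => small_consts e1 && small_consts e2
  end.

(** Any constant that bounds the sizes of the expressions in the program would do. *)
Definition ok_expr e := (expr_size e <= 128) && small_consts e.

Lemma expr_size_gt0 e : 0 < expr_size e. Proof. by case: e. Qed.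

Lemma leq_exp_add x y : 0 < x -> 0 < y -> 2 ^ x + 2 ^ y <= 2 ^ (x + y).
Proof.
move=> x0 y0; rewrite expnD.
have h2 z : 0 < z -> 2 <= 2 ^ z by case: z => // z _; rewrite expnS leq_pmulr // expn_gt0.
by have := h2 x x0; have := h2 y y0; nia.
Qed.

Lemma absz_div_le (x y : int) : `|(x %/ y)%Z|%N <= `|x|%N.
Proof.
have [->|y0] := eqVneq y 0%R; first by rewrite divz0.
rewrite -(lez_nat) !abszE; have := divz_eq x y; have := modz_ge0 x y0; have := ltz_mod x y0.
by move: (x %/ y)%Z (x %% y)%Z => q r; nia.
Qed.

(** A read returns a stored value, hence resets the bound to [2 ^ b]; a binary operation at most
    adds the exponents. *)
Lemma eval_bound m e : bounded m -> small_consts e -> `|eval m e|%N <= 2 ^ (b * expr_size e).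
Proof.
move=> bm; elim: e => [z|a e IH|o e1 IH1 e2 IH2] /=.
- by rewrite muln1.
- move=> _; apply: leq_trans (bm _ _) _; rewrite leq_exp2l // mulnS.
  exact: leq_addr.
case/andP=> /IH1 h1 /IH2 h2; rewrite mulnS mulnDr.
have p1 : 0 < b * expr_size e1 by rewrite muln_gt0 expr_size_gt0 andbT; lia.
have p2 : 0 < b * expr_size e2 by rewrite muln_gt0 expr_size_gt0 andbT; lia.
have up x : x <= 2 ^ (b * expr_size e1 + b * expr_size e2) ->
    x <= 2 ^ (b + (b * expr_size e1 + b * expr_size e2)).
  by move/leq_trans; apply; rewrite leq_exp2l // leq_addl.
apply: up; have sum := leq_exp_add p1 p2; case: o => /=.
- by apply: leq_trans sum; apply: leq_trans (leq_add h1 h2); lia.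
- by apply: leq_trans sum; apply: leq_trans (leq_add h1 h2); lia.
- by rewrite abszM expnD leq_mul.
- apply: leq_trans (absz_div_le _ _) _; apply: leq_trans h1 _.
  by rewrite leq_exp2l // leq_addr.
have p : 0 < 2 ^ (b * expr_size e1 + b * expr_size e2) by rewrite expn_gt0.
by apply: leq_trans p; case: (Order.le _ _).
Qed.

Lemma bitsize_bound (z : int) d : `|z|%N <= 2 ^ d -> bitsize z <= d + 2.
Proof.
move=> h; rewrite /bitsize addn2 !ltnS; apply: up_log_min => //; rewrite expnS.
by have : 0 < 2 ^ d; [rewrite expn_gt0 | move: h; lia].
Qed.

Lemma eval_cost_bound m e : bounded m -> small_consts e ->
  eval_cost m e <= expr_size e * (b * expr_size e + 2).
Proof.
move=> bm; elim: e => [z|a e IH|o e1 IH1 e2 IH2] /= sc.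
- have := bitsize_bound (eval_bound (e := Const z) bm sc); rewrite /=; lia.
- have := bitsize_bound (eval_bound (e := Read a e) bm sc); have := IH sc; rewrite /=.
  move: (bitsize _) => x; move: (expr_size e) (eval_cost m e) => y c; nia.
have := bitsize_bound (eval_bound (e := Binop o e1 e2) bm sc).
case/andP: sc => /IH1 h1 /IH2 h2; move: h1 h2; rewrite /=.
move: (bitsize _) => x; move: (expr_size e1) (expr_size e2) (eval_cost m e1) (eval_cost m e2).
move=> y1 y2 c1 c2; nia.
Qed.

Definition unit_cost := 2 * (128 * (b * 128 + 2)) + 1.

Lemma ok_cost m e : bounded m -> ok_expr e -> 2 * eval_cost m e + 1 <= unit_cost.
Proof.
move=> bm /andP[sz sc]; rewrite leq_add2r leq_mul2l /=; apply: leq_trans (eval_cost_bound bm sc) _.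
by apply: leq_mul => //; rewrite leq_add2r leq_mul2l sz orbT.
Qed.

Fixpoint writes (c : cmd) : seq nat :=
  match c with
  | Skip => [::]
  | Assign a _ _ => [:: a]
  | Seq c1 c2 | If _ c1 c2 => writes c1 ++ writes c2
  | While _ c1 => writes c1
  end.

Definition same_outside (l : seq nat) (m m' : memory) := forall a i, a \notin l -> m' a i = m a i.

(** Time is counted in steps of cost [unit_cost], which covers two evaluations; the bound holds as
    long as all memory cells stay within [2 ^ b]. *)
Definition run c m t m' := [/\ bounded m', same_outside (writes c) m m' &
  exists2 t', exec c m m' t' & t' <= t * unit_cost].

Lemma run_weaken c m t1 t2 m' : t1 <= t2 -> run c m t1 m' -> run c m t2 m'.
Proof.
move=> le [bm so [t' ex let']]; split=> //; exists t' => //.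
by apply: leq_trans let' _; rewrite leq_mul2r le orbT.
Qed.

Lemma unit_cost_gt0 : 0 < unit_cost. Proof. by rewrite /unit_cost addn1. Qed.

Lemma run_skip m : bounded m -> run Skip m 1 m.
Proof. by move=> bm; split=> //; exists 1; [constructor | rewrite mul1n unit_cost_gt0]. Qed.

Lemma run_assign m a e1 e2 : bounded m -> ok_expr e1 -> ok_expr e2 -> small (eval m e2) ->
  run (Assign a e1 e2) m 1 (update m a (eval m e1) (eval m e2)).
Proof.
move=> bm ok1 ok2 sm; split.
- by move=> a' i; rewrite /update; case: ifP.
- by move=> a' i; rewrite inE /update => /negbTE ->.
exists (eval_cost m e1 + eval_cost m e2).+1; first by constructor.
by have := ok_cost bm ok1; have := ok_cost bm ok2; lia.
Qed.

Lemma run_seq c1 c2 m m1 m2 t1 t2 : run c1 m t1 m1 -> run c2 m1 t2 m2 ->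
  run (Seq c1 c2) m (t1 + t2 + 1) m2.
Proof.
move=> [b1 s1 [t1' e1 l1]] [b2' s2 [t2' e2 l2]]; split=> //.
  by move=> a i; rewrite mem_cat negb_or => /andP[n1 n2]; rewrite s2 // s1.
exists (t1' + t2').+1; first by econstructor; eauto.
by have := unit_cost_gt0; rewrite !mulnDl; lia.
Qed.

Lemma run_if e c1 c2 m m' t : bounded m -> ok_expr e ->
  (if eval m e != 0%R then run c1 m t m' else run c2 m t m') -> run (If e c1 c2) m (t + 1) m'.
Proof.
move=> bm ok; have := ok_cost bm ok; case: ifP => [ne|/negbFE/eqP e0] C [b' s [t' ex l]].
  split=> //; first by move=> a i; rewrite mem_cat negb_or => /andP[n1 n2]; rewrite s.
  exists (eval_cost m e + t').+1; first exact: ExecIfTrue.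
  by rewrite mulnDl; lia.
split=> //; first by move=> a i; rewrite mem_cat negb_or => /andP[n1 n2]; rewrite s.
exists (eval_cost m e + t').+1; first exact: ExecIfFalse.
by rewrite mulnDl; lia.
Qed.

Definition scalar a := Read a (Const 0).
Definition set_scalar a e := Assign a (Const 0) e.
Definition for_loop x y e body :=
  Seq (set_scalar y e) (Seq (set_scalar x (Const 0))
    (While (Binop Leq (Binop Add (scalar x) (Const 1)) (scalar y))
       (Seq body (set_scalar x (Binop Add (scalar x) (Const 1)))))).

Lemma small0 : small 0. Proof. exact: leq0n. Qed.
Lemma small_nat n : n <= 2 ^ b -> small n%:Z. Proof. by []. Qed.
Lemma small_lit n : n <= 4 -> small n%:Z.
Proof.
move=> n4; apply: small_nat; apply: leq_trans n4 _; rewrite -[4]/(2 ^ 2).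
by rewrite leq_exp2l.
Qed.

Let ok_cond x y : ok_expr (Binop Leq (Binop Add (scalar x) (Const 1)) (scalar y)).
Proof. by rewrite /ok_expr /= ?small0 ?(@small_lit 1). Qed.

(** The invariant must not depend on the counter, which is incremented after the body. The bound is
    evaluated once, before the loop. *)
Lemma run_for x y e body m N t (I : nat -> memory -> Prop) :
  bounded m -> ok_expr e -> eval m e = Posz N -> small N%:Z -> x != y ->
  x \notin writes body -> y \notin writes body ->
  (forall i m1 m2, (forall a j, a != x -> m1 a j = m2 a j) -> I i m1 -> I i m2) ->
  I 0 (update m y 0 (Posz N)) ->
  (forall i m1, i < N -> bounded m1 -> I i m1 -> m1 x 0 = Posz i ->
     same_outside (x :: y :: writes body) m m1 ->
     exists2 m2, run body m1 t m2 & I i.+1 m2) ->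
  exists2 m', run (for_loop x y e body) m (N * (t + 3) + 5) m' & I N m'.
Proof.
move=> bm oke eE sN xy xb yb Iins I0 step.
rewrite /for_loop; set w := While _ _.
have okx : ok_expr (Const 0) by rewrite /ok_expr /= small0.
have okx1 : ok_expr (Binop Add (scalar x) (Const 1)).
  by rewrite /ok_expr /= ?small0 ?(@small_lit 1).
have loop i m1 : i <= N -> bounded m1 -> I (N - i) m1 -> m1 x 0 = Posz (N - i) -> m1 y 0 = Posz N ->
    same_outside (x :: y :: writes body) m m1 ->
    exists2 m', run w m1 (i * (t + 3) + 1) m' & I N m'.
  elim: i m1 => [|i IH] m1 iN bm1 I1 x1 y1 so.
    exists m1; last by rewrite subn0 in I1.
    split=> //; exists (eval_cost m1 (Binop Leq (Binop Add (scalar x) (Const 1)) (scalar y))).+1.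
      apply: ExecWhileFalse => /=; rewrite x1 y1 subn0.
      by have -> : (N%:Z + 1 <= Posz N)%R = false by lia.
    by have := ok_cost bm1 (ok_cond x y); rewrite mul0n add0n mul1n; lia.
  have lt : N - i.+1 < N by lia.
  have [m2 r2 I2] := step _ _ lt bm1 I1 x1 so.
  have [b2' s2 [t2 e2 l2]] := r2.
  have x2 : m2 x 0 = Posz (N - i.+1) by rewrite s2.
  have ev : eval m2 (Binop Add (scalar x) (Const 1)) = Posz (N - i) by rewrite /= x2; lia.
  have sm : small (eval m2 (Binop Add (scalar x) (Const 1))).
    by rewrite ev; apply: leq_trans sN; rewrite !absz_nat leq_subr.
  have r3 := run_assign x b2' okx okx1 sm.
  have r23 := run_seq r2 r3; have [b3 s3 [t3 e3 l3]] := r23.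
  move: b3 s3 e3; set m3 := update _ _ _ _ => b3 s3 e3.
  have x3 : m3 x 0 = Posz (N - i) by rewrite -ev /m3 /update !eqxx.
  have m3E a j : a != x -> m3 a j = m2 a j by rewrite /m3 /update => /negbTE->.
  have y3 : m3 y 0 = Posz N by rewrite m3E 1?eq_sym // s2.
  have I3 : I (N - i) m3.
    have <- : (N - i.+1).+1 = N - i by lia.
    by apply: Iins I2 => a j na; rewrite m3E.
  have so3 : same_outside (x :: y :: writes body) m m3.
    move=> a j; rewrite !inE !negb_or => /and3P[nx ny nb].
    by rewrite m3E // s2 // so // !inE !negb_or nx ny.
  have [m' [b' s' [t' e' l']] I'] := IH m3 ltac:(lia) b3 I3 x3 y3 so3.
  exists m' => //; split=> //.
    by move=> a j na; rewrite s' // s3.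
  exists (eval_cost m1 (Binop Leq (Binop Add (scalar x) (Const 1)) (scalar y)) + t3 + t').+1.
    apply: ExecWhileTrue e3 e' => /=; rewrite x1 y1.
    by have -> : ((N - i.+1)%:Z + 1 <= Posz N)%R by lia.
  have -> : i.+1 * (t + 3) + 1 = (i * (t + 3) + 1) + (t + 1 + 1) + 1 by lia.
  rewrite mulnDl [(_ + (_ + 1 + 1)) * _]mulnDl mul1n; have := ok_cost bm1 (ok_cond x y); lia.
have smN : small (eval m e) by rewrite eE.
have r1 := run_assign y bm okx oke smN; have [b1 _ _] := r1.
have r2 := run_assign x b1 okx okx small0; have [b2' s2 _] := r2.
move: r1 r2 b1 b2' s2; rewrite /= eE; set m1 := update m y _ _; set m2 := update m1 _ _ _.
move=> r1 r2 b1 b2' s2.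
have I2 : I (N - N) m2.
  by rewrite subnn; apply: Iins I0 => a j na; rewrite /m2 {2}/update (negbTE na).
have [|||m' r' I'] := loop N m2 (leqnn N) b2' I2.
- by rewrite subnn /m2 /update !eqxx.
- by rewrite /m2 /update eq_sym (negbTE xy) /= /m1 /update !eqxx.
- move=> a j; rewrite !inE !negb_or => /and3P[nx ny _].
  by rewrite /m2 /update (negbTE nx) /= /m1 /update (negbTE ny).
exists m' => //; have := run_seq r1 (run_seq r2 r').
by apply: run_weaken; lia.
Qed.

End Runs.

(** * Neighbouring layouts as numbered sequences of swaps *)

Section Positions.

Variable k : nat.
Notation n := (4 * k).
Notation pos := ('I_k * 'I_4)%type.

Definition code (q : pos) := 4 * q.1 + q.2.

Lemma code_lt q : code q < n.
Proof. by case: q => P i; rewrite /code /=; have := ltn_ord P; have := ltn_ord i; lia. Qed.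

Lemma code_inj : injective code.
Proof.
move=> [P i] [Q j]; rewrite /code /= => E.
have [] : P = Q :> nat /\ i = j :> nat by have := ltn_ord i; have := ltn_ord j; lia.
by move=> /val_inj-> /val_inj->.
Qed.

Lemma code_surj i : i < n -> exists q, code q = i.
Proof.
move=> lt; have l1 : i %/ 4 < k by rewrite ltn_divLR // mulnC.
have l2 : i %% 4 < 4 by rewrite ltn_mod.
by exists (Ordinal l1, Ordinal l2); rewrite /code /= [RHS](divn_eq i 4) mulnC.
Qed.

Definition decode (q : pos) i := odflt q [pick p | code p == i].

Lemma codeK q p : decode q (code p) = p.
Proof.
rewrite /decode; case: pickP => [p' /eqP/code_inj //|/(_ p)]; by rewrite eqxx.
Qed.

Variable V : finType.
Implicit Types s : {ffun pos -> V}.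

Definition swap i j s : {ffun pos -> V} :=
  [ffun q => s (if code q == i then decode q j else if code q == j then decode q i else q)].

Lemma swapE p p' s q : swap (code p) (code p') s q = s (tperm p p' q).
Proof.
rewrite ffunE !(inj_eq code_inj) !codeK; congr (s _).
by rewrite permE /= .
Qed.

Lemma swap_inj i j s : i < n -> j < n -> injective s -> injective (swap i j s).
Proof.
move=> /code_surj[p <-] /code_surj[p' <-] sI q q'; rewrite !swapE.
by move/sI/perm_inj.
Qed.

(** Each swap consumes two digits of [t] in base [n], so that one counter runs through all sequences
    of [l] swaps. *)
Fixpoint swaps l t s :=
  if l is l'.+1 then swaps l' (t %/ n %/ n) (swap (t %% n) ((t %/ n) %% n) s) else s.

Lemma swaps_inj l t s : injective s -> injective (swaps l t s).
Proof.
have [k0|k0] := posnP k; first by move=> _ q; have := code_lt q; lia.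
by elim: l t s => [//|l IH] t s sI; apply: IH; apply: swap_inj; rewrite ?ltn_mod ?muln_gt0 ?k0.
Qed.

Lemma swaps_reach l s s' : 0 < k -> #|V| = n -> injective s -> injective s' ->
  #|diff s' s| <= l -> exists2 t, t < n ^ (2 * l) & swaps l t s = s'.
Proof.
move=> k0 cV; have n0 : 0 < n by rewrite muln_gt0.
elim: l s => [|l IH] s sI s'I.
  rewrite leqn0 cards_eq0 => /eqP d0; exists 0 => //=.
  apply/ffunP => q; have := in_set0 q; rewrite -d0 inE => /negbT; rewrite negbK => /eqP->//.
move=> dl.
have [p [p' dd]] : exists p p', #|diff s' (swap (code p) (code p') s)| <= l.
  have [d0|[q qd]] := set_0Vmem (diff s' s).
    have [q qE] := code_surj n0; exists q, q.
    suff -> : swap (code q) (code q) s = s by rewrite d0 cards0.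
    by apply/ffunP=> q'; rewrite swapE tperm1 perm1.
  have [q2 q2E] : exists q2, s q2 = s' q.
    have sB : bijective s by apply: inj_card_bij sI _; rewrite cV card_prod !card_ord mulnC.
    by have [g _ gK] := sB; exists (g (s' q)); rewrite gK.
  have q2q : q2 != q by apply/eqP => E; move: qd; rewrite inE -q2E E eqxx.
  have q2d : q2 \in diff s' s.
    by rewrite inE q2E (inj_eq s'I).
  (* The vertex wanted at [q] sits at [q2], which is therefore wrong too; the swap repairs [q] and
     spoils nothing. *)
  exists q, q2; rewrite -ltnS; apply: leq_trans dl; rewrite (cardsD1 q (diff s' s)) qd add1n ltnS.
  apply: subset_leq_card; apply/subsetP => x; rewrite !inE swapE.
  have [->|xq] := eqVneq x q; first by rewrite tpermL q2E eqxx.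
  have [->|xq2] := eqVneq x q2; first by rewrite q2E (inj_eq s'I).
  by rewrite tpermD // eq_sym.
have [t lt <-] := IH _ (swap_inj (code_lt p) (code_lt p') sI) s'I dd.
exists (code p + n * (code p' + n * t)).
  have := code_lt p; have := code_lt p'; rewrite mulnS expnS expnS => h' h.
  move: (n ^ _) lt => N lt; nia.
have dE i x : i < n -> (i + n * x) %/ n = x by move=> lti; rewrite addnC mulnC divnMDl // divn_small // addn0.
have mE i x : i < n -> (i + n * x) %% n = i by move=> lti; rewrite addnC mulnC modnMDl modn_small.
by rewrite /= mE ?dE ?mE ?dE ?code_lt.
Qed.

Variables (r : V -> V -> nat) (c A C : nat).

Definition improve s t :=
  let s' := swaps c t s in if objective r A C s + 1 <= objective r A C s' then s' else s.
Definition pass s := foldl improve s (iota 0 (n ^ (2 * c))).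

Lemma improve_inj s t : injective s -> injective (improve s t).
Proof. by move=> sI; rewrite /improve; case: ifP => // _; apply: swaps_inj. Qed.

Lemma foldl_improve_inj l s : injective s -> injective (foldl improve s l).
Proof. by elim: l s => //= t l IH s /improve_inj - /(_ t) /IH. Qed.

Lemma pass_inj s : injective s -> injective (pass s). Proof. exact: foldl_improve_inj. Qed.

Lemma improve_cases s t : improve s t = s \/ objective r A C s < objective r A C (improve s t).
Proof. by rewrite /improve addn1; case: ifP; [right | left]. Qed.

Lemma foldl_improve_cases l s :
  {in l, forall t, improve s t = s} \/ objective r A C s < objective r A C (foldl improve s l).
Proof.
have le l' s' : objective r A C s' <= objective r A C (foldl improve s' l').
  elim: l' s' => //= t l' IH s'; apply: leq_trans (IH _).
  by case: (improve_cases s' t) => [->|/ltnW].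
elim: l s => [|t l IH] s; first by left.
case: (improve_cases s t) => [E|lt] /=; last by right; apply: leq_trans (le _ _).
rewrite E; case: (IH s) => [fx|]; last by right.
by left=> x; rewrite inE => /predU1P[->//|/fx].
Qed.

(** If no trial of a pass succeeds, the layout has been compared with all its neighbours. *)
Lemma pass_cases s : injective s -> #|V| = n ->
  (local_optimum r c A C s /\ pass s = s) \/ objective r A C s < objective r A C (pass s).
Proof.
move=> sI cV; case: (foldl_improve_cases (iota 0 (n ^ (2 * c))) s) => [fx|]; last by right.
left; split; last first.
  by rewrite /pass; elim: (iota _ _) fx => //= t l IH fx; rewrite fx ?inE ?eqxx // IH // => x xl; apply: fx; rewrite inE xl orbT.
move=> s' s'I d; have [k0|k0] := posnP k.
  have -> // : s' = s by apply/ffunP => q; have := code_lt q; lia.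
have [t lt tE] := swaps_reach k0 cV sI s'I d.
have := fx t; rewrite mem_iota /= add0n => /(_ lt); rewrite /improve tE addn1.
by case: ifP => [_ ->|/negbT]; rewrite // -leqNgt.
Qed.

Lemma iter_pass_inj s i : injective s -> injective (iter i pass s).
Proof. by move=> sI; elim: i => //= i; apply: pass_inj. Qed.

(** Until a local optimum is reached each pass raises the objective, which stays below [N]. *)
Lemma iter_pass_optimum s N : injective s -> #|V| = n ->
  (forall s', injective s' -> objective r A C s' < N) -> local_optimum r c A C (iter N pass s).
Proof.
move=> sI cV bnd.
have H i : (local_optimum r c A C (iter i pass s) /\ pass (iter i pass s) = iter i pass s) \/
    i <= objective r A C (iter i pass s).
  elim: i => [|i [[opt fx]|le]] /=; first by right.
    by left; rewrite !fx.
  case: (pass_cases (iter_pass_inj (i := i) sI) cV) => [[opt fx]|lt]; first by left; rewrite !fx.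
  by right; apply: leq_ltn_trans lt.
case: (H N) => [[]//|]; by rewrite leqNgt bnd //; apply: iter_pass_inj.
Qed.

End Positions.

Local Open Scope ring_scope.

Lemma lt_numq_denq (x y : rat) : (numq x * denq y < numq y * denq x) = (x < y).
Proof. by rewrite -lt_ratE. Qed.

Section Rounding.

Variables (M : nat) (wm : rat).
Hypothesis wm_ge0 : 0 <= wm.

(** The floor of [x * M / wm] with the fractions cleared; for [wm = 0] integer division returns
    0. *)
Definition rounded_quotient x := ((numq x * denq wm * Posz M) %/ (numq wm * denq x))%Z.
Definition rounded x : nat := absz (rounded_quotient x).

Lemma roundedE x : 0 <= x -> rounded_quotient x = Posz (rounded x).
Proof.
move=> x0; rewrite gez0_abs // /rounded_quotient.
have [->|wn] := eqVneq wm 0; first by rewrite [numq 0]/= mul0r divz0.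
have D0 : 0 < numq wm * denq x by rewrite mulr_gt0 ?denq_gt0 // numq_gt0 lt_def wn.
by rewrite divz_ge0 // !mulr_ge0 // ?numq_ge0 // ltW // denq_gt0.
Qed.

Hypothesis wm_gt0 : 0 < wm.

Lemma rounded_bounds x : 0 <= x ->
  (rounded x)%:R * wm <= x * M%:R /\ x * M%:R < (rounded x).+1%:R * wm.
Proof.
move=> x0; have qE := roundedE x0.
have D0 : 0 < numq wm * denq x by rewrite mulr_gt0 ?denq_gt0 // numq_gt0.
have lo := lez_floor (numq x * denq wm * Posz M) (lt0r_neq0 D0).
have hi := ltz_ceil (numq x * denq wm * Posz M) D0.
move: lo hi; rewrite -/(rounded_quotient x) qE => lo hi.
have dx : (0 : rat) < (denq x)%:~R by rewrite ltr0z denq_gt0.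
have dw : (0 : rat) < (denq wm)%:~R by rewrite ltr0z denq_gt0.
have nx : (numq x)%:~R = x * (denq x)%:~R :> rat by rewrite -{2}(divq_num_den x) divfK // lt0r_neq0.
have nw : (numq wm)%:~R = wm * (denq wm)%:~R :> rat by rewrite -{2}(divq_num_den wm) divfK // lt0r_neq0.
move: lo hi; rewrite -(ler_int rat) -(ltr_int rat) !rmorphM /= !rmorphD /= nx nw.
have -> : (Posz (rounded x))%:~R = (rounded x)%:R :> rat by [].
have -> : (Posz M)%:~R = M%:R :> rat by [].
rewrite -natr1; have dd : 0 < (denq wm)%:~R * (denq x)%:~R :> rat by rewrite mulr_gt0.
move: ((denq wm)%:~R) ((denq x)%:~R) dd => dw' dx' dd lo hi; split.
  by rewrite -(ler_pM2r dd); lra.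
by rewrite -(ltr_pM2r dd); lra.
Qed.

End Rounding.

Lemma rounded_le M wm x : 0 <= x <= wm -> (rounded M wm x <= M)%N.
Proof.
case/andP=> x0 xw; have w0 := le_trans x0 xw.
have [E|wn] := eqVneq wm 0.
  by rewrite /rounded /rounded_quotient E [numq 0]/= mul0r divz0.
have wp : 0 < wm by rewrite lt_def wn.
have [lo _] := rounded_bounds M w0 wp x0.
rewrite -(ler_nat rat) -(ler_pM2r wp); apply: le_trans lo _.
by rewrite mulrC ler_wpM2l.
Qed.

(** * The program *)

Local Close Scope ring_scope.

(* Arrays 0, 1, 2 hold the instance and array 3 the best layout; array 4 holds the
   rounded weights, array 5 the current layout and array 6 the one under trial.
   Arrays from 10 on are scalars: 10 to 15 are counters and bounds of loops nested
   up to three deep, 20 is the cell of the heaviest edge, 21 the large factor of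
   the lexicographic objectives, 22 and 23 the numbers of swap sequences and of
   passes, 24 the best value, 25 and 26 the factors of the ends and the middle
   edges, 27 and 28 the current value and that under trial, 29 to 32 temporaries.
   Counter 12, written in base [n], encodes the sequence of swaps to be tried. *)
Fixpoint assigns (l : seq (nat * expr * expr)) : cmd :=
  if l is (a, e1, e2) :: l' then Seq (Assign a e1 e2) (assigns l') else Skip.

Fixpoint after (l : seq (nat * expr * expr)) (m : memory) : memory :=
  if l is (a, e1, e2) :: l' then after l' (update m a (eval m e1) (eval m e2)) else m.

Definition copy_cells a a' :=
  for_loop 14 15 (scalar 0) (assigns [:: (a', scalar 14, Read a (scalar 14))]).

(** The remainder modulo [n], for which the machine has no operation. *)
Definition digit := Binop Defs.Sub (scalar 29) (Binop Mul (Binop Div (scalar 29) (scalar 0)) (scalar 0)).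
Definition quotient := Binop Div (scalar 29) (scalar 0).

Definition apply_swaps (c : nat) :=
  Seq (set_scalar 29 (scalar 12))
    (for_loop 14 15 (Const c) (assigns
      [:: (30, Const 0, digit); (29, Const 0, quotient);
          (31, Const 0, digit); (29, Const 0, quotient);
          (32, Const 0, Read 6 (scalar 30));
          (6, scalar 30, Read 6 (scalar 31)); (6, scalar 31, scalar 32)])).

Definition vertex x i := Read x (Binop Add (Binop Mul (Const 4) (scalar 14)) (Const (Posz i))).
Definition edge x i j := Read 4 (Binop Add (Binop Mul (vertex x i) (scalar 0)) (vertex x j)).

Definition compute_objective x out :=
  Seq (set_scalar out (Const 0))
    (for_loop 14 15 (Binop Div (scalar 0) (Const 4)) (assigns
      [:: (out, Const 0,
           Binop Add (scalar out)
            (Binop Add (Binop Mul (scalar 25) (Binop Add (edge x 0 1) (edge x 2 3)))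
                       (Binop Mul (scalar 26) (edge x 1 2))))])).

Definition try_swaps c :=
  Seq (copy_cells 5 6) (Seq (apply_swaps c) (Seq (compute_objective 6 28)
    (If (Binop Leq (Binop Add (scalar 27) (Const 1)) (scalar 28))
       (Seq (set_scalar 27 (scalar 28)) (copy_cells 6 5)) Skip))).

Definition one_pass c := for_loop 12 13 (scalar 22) (try_swaps c).

Definition phase c eA eC :=
  Seq (assigns [:: (25, Const 0, eA); (26, Const 0, eC)])
  (Seq (compute_objective 5 27)
  (Seq (for_loop 10 11 (scalar 23) (one_pass c))
  (Seq (assigns [:: (25, Const 0, Const 1); (26, Const 0, Const 1)])
  (Seq (compute_objective 5 28)
    (If (Binop Leq (scalar 24) (scalar 28))
       (Seq (set_scalar 24 (scalar 28)) (copy_cells 5 3)) Skip))))).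

Definition set_identity :=
  for_loop 10 11 (scalar 0)
    (assigns [:: (5, scalar 10, scalar 10); (3, scalar 10, scalar 10)]).

Definition power c :=
  Seq (set_scalar 22 (Const 1))
    (for_loop 10 11 (Const (2 * c)%N) (assigns [:: (22, Const 0, Binop Mul (scalar 22) (scalar 0))])).

(** Weights are compared and divided by cross multiplication of numerators and denominators. *)
Definition num_max x y := Binop Mul (Read 1 (scalar x)) (Read 2 (scalar y)).

Definition find_max :=
  Seq (set_scalar 20 (Const 0))
    (for_loop 10 11 (Binop Mul (scalar 0) (scalar 0))
      (If (Binop Leq (Binop Add (num_max 20 10) (Const 1)) (num_max 10 20))
         (set_scalar 20 (scalar 10)) Skip)).

Definition round_weights (K : nat) :=
  for_loop 10 11 (Binop Mul (scalar 0) (scalar 0)) (assigns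
    [:: (4, scalar 10, Binop Div (Binop Mul (num_max 10 20) (Binop Mul (Const K) (scalar 0)))
                                (num_max 20 10))]).

Definition bound_expr (K : nat) := Binop Mul (Binop Mul (Const K) (scalar 0)) (scalar 0).

Definition local_search_program (c K : nat) :=
  Seq find_max (Seq (round_weights K) (Seq (power c)
  (Seq (assigns [:: (21, Const 0, Binop Add (bound_expr K) (Const 1));
                    (23, Const 0, Binop Add (Binop Mul (scalar 21) (bound_expr K)) (Const 1));
                    (24, Const 0, Const 0)])
  (Seq set_identity
  (Seq (phase c (scalar 21) (Const 1))
  (Seq (phase c (Const 1) (scalar 21)) (phase c (Const 1) (Const 1)))))))).

(** * Correctness and running time of the program *)

Section Correctness.

Variable b : nat.
Hypothesis b2 : 2 <= b.
Notation small := (small b).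
Notation run := (run b).
Notation bounded := (bounded b).
Notation ok_expr := (ok_expr b).

Definition wp d m t (Q : memory -> Prop) := exists2 m', run d m t m' & Q m'.

Lemma wp_weaken d m t1 t2 (Q : memory -> Prop) : t1 <= t2 -> wp d m t1 Q -> wp d m t2 Q.
Proof. by move=> le [m' r q]; exists m' => //; apply: run_weaken r. Qed.

Lemma wp_imp d m t (Q Q' : memory -> Prop) : wp d m t Q -> (forall m', Q m' -> Q' m') -> wp d m t Q'.
Proof. by move=> [m' r q] H; exists m' => //; apply: H. Qed.

Lemma wp_seq d1 d2 m t1 t2 (Q1 Q : memory -> Prop) : wp d1 m t1 Q1 ->
  (forall m1, run d1 m t1 m1 -> bounded m1 -> Q1 m1 -> wp d2 m1 t2 Q) ->
  wp (Seq d1 d2) m (t1 + t2 + 1) Q.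
Proof.
move=> [m1 r1 q1] /(_ m1 r1) H; have [m2 r2 q2] : wp d2 m1 t2 Q by apply: H => //; case: r1.
by exists m2 => //; apply: run_seq r1 r2.
Qed.

Lemma wp_set a e m z (Q : memory -> Prop) : bounded m -> ok_expr e -> eval m e = z ->
  small z -> Q (update m a 0 z) -> wp (set_scalar a e) m 1 Q.
Proof.
move=> bm ok E sz q; exists (update m a 0 z) => //; rewrite -E.
by apply: run_assign; rewrite ?E // /ok_expr /= small0.
Qed.

Lemma wp_nil m (Q : memory -> Prop) : bounded m -> Q m -> wp (assigns [::]) m 1 Q.
Proof. by move=> bm q; exists m => //; apply: run_skip. Qed.

Lemma wp_cons a e1 e2 l m t i z (Q : memory -> Prop) : bounded m ->
  ok_expr e1 -> ok_expr e2 -> eval m e1 = i -> eval m e2 = z -> small z ->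
  (bounded (update m a i z) -> wp (assigns l) (update m a i z) t Q) ->
  wp (assigns ((a, e1, e2) :: l)) m t.+2 Q.
Proof.
move=> bm ok1 ok2 E1 E2 sz H; have r := run_assign b2 a bm ok1 ok2.
rewrite E1 E2 in r; have [b1 _ _] := r sz; have [m' r' q] := H b1.
by exists m' => //; apply: run_weaken (run_seq b2 (r sz) r'); lia.
Qed.

Lemma wp_if d1 d2 m t (Q : memory -> Prop) (x y : int) (e1 e2 : expr) :
  bounded m -> ok_expr (Binop Leq e1 e2) -> eval m e1 = x -> eval m e2 = y ->
  (if (x <= y)%R then wp d1 m t Q else wp d2 m t Q) ->
  wp (If (Binop Leq e1 e2) d1 d2) m (t + 1) Q.
Proof.
move=> bm ok E1 E2 H.
have [m' r q] : exists2 m', (if (x <= y)%R then run d1 m t m' else run d2 m t m') & Q m'.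
  by move: H; case: ifP => _ [m' r q]; exists m'.
exists m' => //; apply: run_if => //=; rewrite E1 E2.
by move: r; case: (x <= y)%R.
Qed.

Variables (n k c : nat).
Hypothesis nk : n = 4 * k.
Hypothesis small_c : small c.
Hypothesis small_n : small n.
Notation pos := ('I_k * 'I_4)%type.
Implicit Types (s : {ffun pos -> 'I_n}) (m : memory).

Definition holds m a s := forall q, m a (Posz (code q)) = Posz (s q).

Lemma holds_run d m t m' a s : run d m t m' -> a \notin writes d -> holds m a s -> holds m' a s.
Proof. by move=> [_ so _] na h q; rewrite so. Qed.

Ltac ok := apply/andP; split; [exact: isT | rewrite /=; 
  repeat (apply/andP; split); first [exact: small0 | exact: (small_lit b2) | assumption | exact: isT]].

Definition copy_time := n * 6 + 5.

Lemma wp_copy m a a' s : bounded m -> m 0 0 = Posz n -> a < 14 -> a' < 14 -> a != a' -> holds m a s ->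
  wp (copy_cells a a') m copy_time (fun m' => holds m' a' s).
Proof.
move=> bm n0 a14 a'14 aa' h.
pose I i m1 := forall q : pos, code q < i -> m1 a' (Posz (code q)) = Posz (s q).
apply: (wp_imp (Q := I n)); first apply: (wp_weaken (t1 := n * (3 + 3) + 5)) => //; last first.
  by move=> m' I' q; apply: I'; rewrite nk code_lt.
apply: (run_for b2) => //; try (by rewrite /= ?inE; lia).
- by move=> i m1 m2 E I1 q lt; rewrite -E ?I1 //; lia.
- move=> i m1 lti b1 I1 x1 so.
  apply: (wp_cons (i := Posz i)) => //; first exact: b1.
  move=> b1'; apply: wp_nil => // q; rewrite ltnS leq_eqVlt /= x1 /update eqxx /=.
  case: eqVneq => [<- _|ne /= lt]; first by rewrite eqxx so ?h // !inE; lia.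
  by rewrite eqz_nat (negbTE ne) I1.
Qed.

Lemma small_lt i : i < n -> small (Posz i).
Proof. by move=> lt; apply: leq_trans small_n; apply: ltnW. Qed.

Lemma eval_digit m x : m 0 0 = Posz n -> m 29 0 = Posz x -> eval m digit = Posz (x %% n).
Proof. by move=> n0 x0; rewrite /= n0 x0 divz_nat; have := divn_eq x n; lia. Qed.

Lemma eval_quotient m x : m 0 0 = Posz n -> m 29 0 = Posz x -> eval m quotient = Posz (x %/ n).
Proof. by move=> n0 x0; rewrite /= n0 x0 divz_nat. Qed.

Definition swaps_time := c * 18 + 7.

Lemma wp_apply_swaps m s t : 0 < n -> bounded m -> m 0 0 = Posz n -> m 12 0 = Posz t -> holds m 6 s ->
  wp (apply_swaps c) m swaps_time (fun m' => holds m' 6 (swaps c t s)).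
Proof.
move=> n_gt0 bm n0 t0 h.
(* The swaps still encoded in [x] lead from the present layout to the final one. *)
pose I i m1 := exists x s', [/\ m1 29 0 = Posz x, holds m1 6 s' & swaps (c - i) x s' = swaps c t s].
have st : small t by rewrite -[Posz t]t0.
apply: (wp_weaken (t1 := 1 + (c * (15 + 3) + 5) + 1)); first by rewrite /swaps_time; lia.
apply: (wp_seq (Q1 := fun m1 => m1 29 0 = Posz t /\ holds m1 6 s)).
  apply: (wp_set (z := Posz t)) => //.
move=> m1 [_ so1 _] b1 [t1 h1].
apply: (wp_imp (Q := I c)); last by move=> m' [x [s' []]]; rewrite subnn /= => _ h' <-.
apply: (run_for b2) => //.
- move=> i m2 m3 E [x [s' [x2 h2 sE]]]; exists x, s'; split=> //; first by rewrite -E.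
  by move=> q; rewrite -E.
- by exists t, s; rewrite subn0.
move=> i m2 lti b2' [x [s' [x2 h2 sE]]] _ so2.
have n2 : m2 0 0 = Posz n by rewrite so2 // so1.
have sx : small x by rewrite -[Posz x]x2.
apply: (wp_cons (i := 0) (z := Posz (x %% n))) => //.
- exact: eval_digit.
- by apply: leq_trans sx; rewrite leq_mod.
have [p pE] : exists p : pos, code p = x %% n by apply: code_surj; rewrite -nk ltn_mod.
have [p' p'E] : exists p : pos, code p = (x %/ n) %% n by apply: code_surj; rewrite -nk ltn_mod.
rewrite -pE => b3; apply: (wp_cons (i := 0) (z := Posz (x %/ n))) => //.
- exact: eval_quotient.
- by apply: leq_trans sx; rewrite leq_div.
move=> b4; apply: (wp_cons (i := 0) (z := Posz (code p'))) => //.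
- by rewrite p'E; exact: eval_digit.
- by apply: small_lt; rewrite nk code_lt.
move=> b5; apply: (wp_cons (i := 0) (z := Posz (x %/ n %/ n))) => //.
- exact: eval_quotient.
- by apply: leq_trans sx; rewrite !(leq_trans (leq_div _ _)).
move=> b6; apply: (wp_cons (i := 0) (z := Posz (s' p))) => //.
- exact: h2.
- by apply: small_lt.
move=> b7; apply: (wp_cons (i := Posz (code p)) (z := Posz (s' p'))) => //.
- exact: h2.
- by apply: small_lt.
move=> b8; apply: (wp_cons (i := Posz (code p')) (z := Posz (s' p))) => //.
- by apply: small_lt.
move=> b9; apply: wp_nil => //; exists (x %/ n %/ n), (swap (code p) (code p') s'); split=> //.
- move=> q; rewrite swapE /update /= !eqz_nat !(inj_eq (@code_inj _)).
  have [->|qp'] := eqVneq q p'; first by rewrite tpermR.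
  have [->|qp] := eqVneq q p; first by rewrite tpermL.
  by rewrite h2 tpermD // eq_sym.
by rewrite -sE -(subnSK lti) /= -nk pE p'E.
Qed.


Variable r : 'I_n -> 'I_n -> nat.
Definition table m := m 0 0 = Posz n /\ forall u v : 'I_n, m 4 (Posz (u * n + v)) = Posz (r u v).

Lemma table_run d m t m' : run d m t m' -> (0 \notin writes d) && (4 \notin writes d) -> table m -> table m'.
Proof. by move=> [_ so _] /andP[d0 d4] [t0 t4]; split=> [|u v]; rewrite so. Qed.

Lemma eval_edge m x (i j : nat) s (P : 'I_k) (Pi Pj : 'I_4) : table m -> holds m x s ->
  m 14 0 = Posz P ->
  i = Pi -> j = Pj -> eval m (edge x i j) = Posz (r (s (P, Pi)) (s (P, Pj))).
Proof.
move=> [n0 t4] h P0 -> ->; rewrite /= P0 n0.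
have vE (q : 'I_4) : m x (4 * Posz P + Posz q)%R = Posz (s (P, q)).
  by rewrite -h /code /=; congr (m _ _); lia.
by rewrite !vE -t4; congr (m _ _); lia.
Qed.

Definition objective_time := n * 6 + 7.

Lemma wp_objective m x out s A C : bounded m -> table m -> m 25 0 = Posz A -> m 26 0 = Posz C ->
  x < 10 -> 26 < out < 29 -> holds m x s -> small (Posz (objective r A C s)) ->
  wp (compute_objective x out) m objective_time (fun m' => m' out 0 = Posz (objective r A C s)).
Proof.
move=> bm tm A0 C0 x10 /andP[out1 out2] h sm.
pose term (P : 'I_k) := A * (r (s (P, i0)) (s (P, i1)) + r (s (P, i2)) (s (P, i3))) +
  C * r (s (P, i1)) (s (P, i2)).
have oE : objective r A C s = \sum_P term P by rewrite /objective !big_distrr -big_split.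
pose I i m1 := m1 out 0 = Posz (\sum_(P : 'I_k | P < i) term P).
apply: (wp_weaken (t1 := 1 + (k * (3 + 3) + 5) + 1)); first by rewrite /objective_time nk; lia.
apply: (wp_seq (Q1 := fun m1 => m1 out 0 = 0%R)).
  by apply: (wp_set (z := 0)) => //; rewrite /update !eqxx.
move=> m1 r1 b1 out0.
have [_ so1 _] := r1.
have t1 : table m1 by apply: table_run r1 _ tm; rewrite /= !inE; lia.
have h1 : holds m1 x s by apply: holds_run r1 _ h; rewrite /= !inE; lia.
apply: (wp_imp (Q := I k)); last first.
  by move=> m' E; rewrite E oE; congr Posz; apply: eq_bigl => P; rewrite ltn_ord.
apply: (run_for b2) => //; try (by rewrite /= ?inE; lia).
- by ok.
- by rewrite /= t1.1 divz_nat nk mulKn.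
- by apply: leq_trans small_n; rewrite nk /= leq_pmull.
- by move=> i m2 m3 E; rewrite /I -E //; lia.
- rewrite /I big_pred0 // /update; case: eqP => // E; exfalso; lia.
move=> i m2 lti b2' I2 c2 so2.
have t2 : table m2.
  by split; [|move=> u v]; rewrite so2 ?t1.1 ?t1.2 //= !inE; lia.
have h2 : holds m2 x s by move=> q; rewrite so2 ?h1 //= !inE; lia.
have A2 : m2 25 0 = Posz A by rewrite so2 ?so1 //= !inE; lia.
have C2 : m2 26 0 = Posz C by rewrite so2 ?so1 //= !inE; lia.
have split_sum : \sum_(P : 'I_k | P < i.+1) term P = \sum_(P : 'I_k | P < i) term P + term (Ordinal lti).
  rewrite (bigD1 (Ordinal lti)) /= ?ltnSn // addnC; congr (_ + _).
  by apply: eq_bigl => P; rewrite ltnS ltn_neqAle andbC.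
apply: (wp_cons (i := 0) (z := Posz (\sum_(P : 'I_k | P < i.+1) term P))) => //.
- by ok.
- rewrite split_sum /term.
  have := @eval_edge m2 x 0 1 s (Ordinal lti) i0 i1 t2 h2 c2 erefl erefl.
  have := @eval_edge m2 x 2 3 s (Ordinal lti) i2 i3 t2 h2 c2 erefl erefl.
  have := @eval_edge m2 x 1 2 s (Ordinal lti) i1 i2 t2 h2 c2 erefl erefl.
  move: (edge x 0 1) (edge x 2 3) (edge x 1 2) => e1 e2 e3 E3 E2 E1.
  by rewrite /= E1 E2 E3 I2 A2 C2 !PoszD !PoszM !PoszD.
- apply: leq_trans sm; rewrite oE [leqRHS](bigID (fun P : 'I_k => P < i.+1)) /=.
  by rewrite leq_addr.
by move=> b3; apply: wp_nil => //; rewrite /I /update !eqxx.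
Qed.

Definition try_time := copy_time + (swaps_time + (objective_time + ((1 + copy_time + 1) + 1) + 1) + 1) + 1.

Section Objective.

Variables A C : nat.
Hypothesis small_objective : forall s, small (Posz (objective r A C s)).

Definition factors m := m 25 0 = Posz A /\ m 26 0 = Posz C.

Lemma factors_run d m t m' : run d m t m' -> (25 \notin writes d) && (26 \notin writes d) ->
  factors m -> factors m'.
Proof. by move=> [_ so _] /andP[d0 d4] [t0 t4]; split; rewrite so. Qed.

Definition search_state s m := holds m 5 s /\ m 27 0 = Posz (objective r A C s).

Lemma wp_try_swaps m s t : 0 < n -> bounded m -> table m -> factors m ->
  m 12 0 = Posz t -> search_state s m ->
  wp (try_swaps c) m try_time (search_state (improve r c A C s t)).
Proof.
move=> n_gt0 bm tm fm m12 [h5 m27].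
apply: (wp_seq (Q1 := fun m' => holds m' 6 s)).
  by apply: wp_copy => //; case: tm.
move=> m1 r1 b1 h1; have [_ so1 _] := r1.
have t1 := table_run r1 isT tm.
apply: (wp_seq (Q1 := fun m' => holds m' 6 (swaps c t s))).
  by apply: wp_apply_swaps => //; [case: t1 | rewrite so1].
move=> m2 r2 b2' h2; have [_ so2 _] := r2.
have t2 := table_run r2 isT t1; have f2 := factors_run r2 isT (factors_run r1 isT fm).
apply: (wp_seq (Q1 := fun m' => m' 28 0 = Posz (objective r A C (swaps c t s)))).
  by case: f2 => A2 C2; apply: wp_objective.
move=> m3 r3 b3 v3; have [_ so3 _] := r3.
have t3 := table_run r3 isT t2.
have c3 : m3 27 0 = Posz (objective r A C s) by rewrite so3 // so2 // so1.
have h3 : holds m3 6 (swaps c t s) := holds_run (a := 6) r3 isT h2.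
have h35 : holds m3 5 s :=
  holds_run (a := 5) r3 isT (holds_run (a := 5) r2 isT (holds_run (a := 5) r1 isT h5)).
apply: (wp_if (x := Posz (objective r A C s + 1)) b3 _ _ (v3 : eval m3 (scalar 28) = _)); first by ok.
  by rewrite /= c3 PoszD.
rewrite lez_nat /improve; case: (_ <= _); last first.
  by apply: (wp_weaken (t1 := 1)); [lia | exists m3; [exact: run_skip | split]].
apply: (wp_seq (Q1 := fun m' => m' 27 0 = Posz (objective r A C (swaps c t s)))).
  by apply: (wp_set (z := Posz (objective r A C (swaps c t s)))).
move=> m4 r4 b4 v4.
have h4 : holds m4 6 (swaps c t s) := holds_run (a := 6) r4 isT h3.
have t4 := table_run r4 isT t3.
have [m5 r5 h5'] : wp (copy_cells 6 5) m4 copy_time (fun m' => holds m' 5 (swaps c t s)).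
  by apply: wp_copy => //; case: t4.
by exists m5 => //; split=> //; case: r5 => _ -> //.
Qed.

Variable T : nat.
Hypothesis TE : T = n ^ (2 * c).
Hypothesis small_T : small T.
Hypothesis c_gt0 : 0 < c.

Definition pass_time := T * (try_time + 3) + 5.

Lemma wp_pass m s : bounded m -> table m -> factors m -> m 22 0 = Posz T -> search_state s m ->
  wp (one_pass c) m pass_time (search_state (pass r c A C s)).
Proof.
move=> bm tm fm mT sm.
rewrite /pass -nk -TE.
pose I i := search_state (foldl (improve r c A C) s (iota 0 i)).
apply: (run_for b2 (I := I)) => //.
- by move=> i m1 m2 E [h v]; split=> [q|]; rewrite -E // h.
move=> i m1 lti b1 I1 c1 so1.
have n_gt0 : 0 < n.
  by case: (posnP n) lti => // n0; rewrite TE n0 exp0n // muln_gt0.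
rewrite /I; have -> : iota 0 i.+1 = iota 0 i ++ [:: i] by rewrite -[i.+1]addn1 iotaD.
rewrite foldl_cat /=.
apply: wp_try_swaps => //.
  by case: tm => h0 h4; split=> [|u v]; rewrite so1.
by case: fm => h0 h4; split; rewrite so1.
Qed.

Variable N : nat.
Hypothesis small_N : small N.

Definition passes_time := N * (pass_time + 3) + 5.

Lemma wp_passes m s : bounded m -> table m -> factors m -> m 22 0 = Posz T -> m 23 0 = Posz N ->
  search_state s m ->
  wp (for_loop 10 11 (scalar 23) (one_pass c)) m passes_time
     (fun m' => holds m' 5 (iter N (pass r c A C) s)).
Proof.
move=> bm tm fm mT mN sm.
pose I i := search_state (iter i (pass r c A C) s).
apply: (wp_imp (Q := I N)); last by move=> m' [].
apply: (run_for b2 (I := I)) => //.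
- by move=> i m1 m2 E [h v]; split=> [q|]; rewrite -E // h.
move=> i m1 lti b1 I1 c1 so1; apply: wp_pass => //.
- by case: tm => h0 h4; split=> [|u v]; rewrite so1.
- by case: fm => h0 h4; split; rewrite so1.
by rewrite so1.
Qed.

End Objective.

Section Phase.

Variables T N B : nat.
Hypothesis TE : T = n ^ (2 * c).
Hypothesis small_T : small T.
Hypothesis c_gt0 : 0 < c.
Hypothesis small_N : small N.

Definition ready m := [/\ table m, m 21 0 = Posz B, m 22 0 = Posz T & m 23 0 = Posz N].

Lemma ready_run d m t m' : run d m t m' ->
  all [pred a | a \notin writes d] [:: 0; 4; 21; 22; 23] -> ready m -> ready m'.
Proof.
move=> r' /= /and5P[d0 d4 d21 d22 /andP[d23 _]] [tm e1 e2 e3]; have [_ so _] := r'.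
by split; rewrite ?so //; apply: table_run r' _ tm; rewrite d0.
Qed.

Definition phase_time :=
  5 + (objective_time + (passes_time T N +
    (5 + (objective_time + ((1 + copy_time + 1) + 1) + 1) + 1) + 1) + 1) + 1.

(* [F] is the recorded value of the stored layout [sb]. *)
Definition best_state sb F m :=
  [/\ holds m 3 sb, m 24 0 = Posz F & F <= objective r 1 1 sb].

Lemma wp_phase m s sb F eA eC A C :
  (forall m, m 21 0 = Posz B -> eval m eA = Posz A) ->
  (forall m, m 21 0 = Posz B -> eval m eC = Posz C) ->
  ok_expr eA -> ok_expr eC -> small A -> small C ->
  (forall s, small (Posz (objective r A C s))) -> (forall s, small (Posz (objective r 1 1 s))) ->
  bounded m -> ready m -> holds m 5 s -> best_state sb F m ->
  let s' := iter N (pass r c A C) s in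
  wp (phase c eA eC) m phase_time (fun m' => holds m' 5 s' /\
    exists sb' F', [/\ best_state sb' F' m', F <= F', objective r 1 1 s' <= F' &
                       sb' = sb \/ sb' = s']).
Proof.
move=> EA EC okA okC sA sC so_AC so_11 bm rm h5 [h3 m24 Fle] s'.
have ok0 : ok_expr (Const 0) by ok.
have ok1 : ok_expr (Const 1) by ok.
have small1 : small 1 by apply: (@small_lit _ b2 1).
apply: (wp_seq (Q1 := factors A C)).
  apply: (wp_cons (i := 0) (z := Posz A)) => //; first by apply: EA; case: rm.
  move=> b1; apply: (wp_cons (i := 0) (z := Posz C)) => //; first by apply: EC; case: rm.
  by move=> b2'; apply: wp_nil.
move=> m1 r1 b1 f1; have rm1 := ready_run r1 isT rm; have [t1 _ _ _] := rm1.
have h51 := holds_run (a := 5) r1 isT h5.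
apply: (wp_seq (Q1 := fun m' => m' 27 0 = Posz (objective r A C s))).
  by case: f1 => A1 C1; apply: wp_objective.
move=> m2 r2 b2' v2; have rm2 := ready_run r2 isT rm1; have [t2 _ T2 N2] := rm2.
have h52 := holds_run (a := 5) r2 isT h51; have f2 := factors_run r2 isT f1.
apply: (wp_seq (Q1 := fun m' => holds m' 5 s')).
  by apply: wp_passes.
move=> m3 r3 b3 h53; have rm3 := ready_run r3 isT rm2.
apply: (wp_seq (Q1 := factors 1 1)).
  apply: (wp_cons (i := 0) (z := 1)) => // b4; apply: (wp_cons (i := 0) (z := 1)) => // b5.
  by apply: wp_nil.
move=> m4 r4 b4 f4; have rm4 := ready_run r4 isT rm3; have [t4 _ _ _] := rm4.
have h54 := holds_run (a := 5) r4 isT h53.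
apply: (wp_seq (Q1 := fun m' => m' 28 0 = Posz (objective r 1 1 s'))).
  by case: f4 => A1 C1; apply: wp_objective.
move=> m5 r5 b5 v5; have rm5 := ready_run r5 isT rm4; have [t5 _ _ _] := rm5.
have h55 := holds_run (a := 5) r5 isT h54.
have h35 : holds m5 3 sb.
  apply: (holds_run (a := 3) r5 isT); apply: (holds_run (a := 3) r4 isT).
  apply: (holds_run (a := 3) r3 isT); apply: (holds_run (a := 3) r2 isT).
  exact: (holds_run (a := 3) r1 isT).
have F5 : m5 24 0 = Posz F.
  case: r5 => _ -> // _; case: r4 => _ -> // _; case: r3 => _ -> // _.
  by case: r2 => _ -> // _; case: r1 => _ -> // _.
apply: (wp_if (x := Posz F) (y := Posz (objective r 1 1 s')) b5) => //.
rewrite lez_nat; case le: (_ <= _); last first.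
  apply: (wp_weaken (t1 := 1)); [by rewrite addn1 | exists m5; first exact: run_skip].
  by split=> //; exists sb, F; split=> //; [by rewrite ltnW // ltnNge le | left].
apply: (wp_seq (Q1 := fun m' => m' 24 0 = Posz (objective r 1 1 s'))).
  by apply: (wp_set (z := Posz (objective r 1 1 s'))).
move=> m6 r6 b6 v6; have [t6 _ _ _] := ready_run r6 isT rm5.
have h56 := holds_run (a := 5) r6 isT h55.
have [m7 r7 h7] : wp (copy_cells 5 3) m6 copy_time (fun m' => holds m' 3 s').
  by apply: wp_copy => //; case: t6.
exists m7 => //; split; first exact: (holds_run (a := 5) r7 isT h56).
exists s', (objective r 1 1 s'); split=> //; last by right.
by split=> //; case: r7 => _ -> //.
Qed.

End Phase.

Definition identity_layout (idn : forall q : pos, code q < n) : {ffun pos -> 'I_n} :=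
  [ffun q => Ordinal (idn q)].

Lemma identity_layout_inj idn : injective (identity_layout idn).
Proof. by move=> q q'; rewrite !ffunE => -[/code_inj]. Qed.

Definition identity_time := n * 8 + 5.

Lemma wp_set_identity idn m : bounded m -> m 0 0 = Posz n ->
  wp set_identity m identity_time
    (fun m' => holds m' 5 (identity_layout idn) /\ holds m' 3 (identity_layout idn)).
Proof.
move=> bm n0.
pose I i m1 := forall q : pos, code q < i ->
  m1 5 (Posz (code q)) = Posz (code q) /\ m1 3 (Posz (code q)) = Posz (code q).
apply: (wp_imp (Q := I n)); last first.
  by move=> m' I'; split=> q; rewrite ffunE /=; case: (I' q (idn q)).
apply: (run_for b2 (t := 5)) => //.
- by move=> i m1 m2 E I1 q lt; rewrite -!E //; apply: I1.
move=> i m1 lti b1 I1 c1 so1.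
apply: (wp_cons (i := Posz i) (z := Posz i)) => //; first exact: small_lt.
move=> b3; apply: (wp_cons (i := Posz i) (z := Posz i)) => //; first exact: small_lt.
move=> b4; apply: wp_nil => // q; rewrite ltnS leq_eqVlt /update /= eqz_nat.
by case: eqVneq => [-> //|_ /= /I1].
Qed.

Hypothesis small_c2 : small (2 * c)%N.
Hypothesis small_powers : forall i, i <= 2 * c -> small (Posz (n ^ i)).

Definition power_time := 1 + (2 * c * 6 + 5) + 1.

Lemma wp_power m : bounded m -> m 0 0 = Posz n ->
  wp (power c) m power_time (fun m' => m' 22 0 = Posz (n ^ (2 * c))).
Proof.
move=> bm n0; have small1 : small 1 by apply: (@small_lit _ b2 1).
have ok1 : ok_expr (Const 1) by ok.
apply: (wp_seq (Q1 := fun m' => m' 22 0 = 1)); first by apply: (wp_set (z := 1)).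
move=> m1 r1 b1 e1; have n1 : m1 0 0 = Posz n by case: r1 => _ ->.
pose I i (m1 : memory) := m1 22 0 = Posz (n ^ i).
apply: (run_for b2 (t := 3) (I := I)) => //.
- by move=> i m2 m3 E; rewrite /I E.
move=> i m2 lti b2' I2 c2 so2.
apply: (wp_cons (i := 0) (z := Posz (n ^ i.+1))) => //.
- by rewrite /= I2 so2 // n1 -PoszM expnSr.
- exact: small_powers.
by move=> b3; apply: wp_nil.
Qed.

Section Weights.

Variable w : 'I_n -> 'I_n -> rat.
Hypothesis w_ge0 : forall u v, (0 <= w u v)%R.
Variable K : nat.
Hypothesis small_n2 : small (n * n)%N.
Hypothesis small_Kn : small (K * n)%N.
Hypothesis small_K : small K.

Definition instance m := [/\ m 0 0 = Posz n,
  forall u v : 'I_n, m 1 (Posz (u * n + v)) = numq (w u v) &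
  forall u v : 'I_n, m 2 (Posz (u * n + v)) = denq (w u v)].

Lemma instance_outside l m m' : same_outside l m m' -> all [pred a | a \notin l] [:: 0; 1; 2] ->
  instance m -> instance m'.
Proof. by move=> so /= /and4P[d0 d1 d2 _] [e0 e1 e2]; split=> *; rewrite so. Qed.

Lemma instance_run d m t m' : run d m t m' -> all [pred a | a \notin writes d] [:: 0; 1; 2] ->
  instance m -> instance m'.
Proof. by case=> _ so _; apply: instance_outside so. Qed.

Lemma pair_index i : i < n * n -> exists u v : 'I_n, i = u * n + v.
Proof.
move=> lt; have n_gt0 : 0 < n by case: (posnP n) lt => // ->.
have lu : i %/ n < n by rewrite ltn_divLR.
have lv : i %% n < n by rewrite ltn_mod.
by exists (Ordinal lu), (Ordinal lv); rewrite /= -divn_eq.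
Qed.

Lemma pair_index_inj (u v u' v' : 'I_n) : u * n + v = u' * n + v' -> u = u' /\ v = v'.
Proof.
move=> E; have n_gt0 : 0 < n by apply: leq_ltn_trans (ltn_ord u).
have Eu : u = u' :> nat.
  by have := congr1 (divn^~ n) E; rewrite !divnMDl // !divn_small // !addn0.
split; apply: val_inj => //=; move: E; rewrite Eu; exact: addnI.
Qed.

Lemma pair_lt (u v : 'I_n) : u * n + v < n * n.
Proof. by have := ltn_ord u; have := ltn_ord v; nia. Qed.

Definition at_max m := forall n_gt0 : 0 < n, exists u0 v0 : 'I_n,
  m 20 0 = Posz (u0 * n + v0) /\ forall u v, (w u v <= w u0 v0)%R.

Definition find_max_time := 1 + (n * n * (2 + 3) + 5) + 1.

Lemma eval_num_max m x y (u v u' v' : 'I_n) : instance m ->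
  m x 0 = Posz (u * n + v) -> m y 0 = Posz (u' * n + v') ->
  eval m (num_max x y) = (numq (w u v) * denq (w u' v'))%R.
Proof. by move=> [_ e1 e2] ex ey; rewrite /= ex ey e1 e2. Qed.

Lemma wp_find_max m : bounded m -> instance m -> wp find_max m find_max_time at_max.
Proof.
move=> bm im; have ok0 : ok_expr (Const 0) by ok.
apply: (wp_seq (Q1 := fun m' => m' 20 0 = 0)); first by apply: (wp_set (z := 0)).
move=> m1 r1 b1 m20; have i1 := instance_run r1 isT im.
pose I i (m1 : memory) := forall n_gt0 : 0 < n, exists u0 v0 : 'I_n,
  m1 20 0 = Posz (u0 * n + v0) /\ forall u v : 'I_n, u * n + v < i -> (w u v <= w u0 v0)%R.
apply: (wp_imp (Q := I (n * n))); last first.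
  move=> m' I' n_gt0; have [u0 [v0 [E le]]] := I' n_gt0; exists u0, v0; split=> // u v.
  exact/le/pair_lt.
have n1 : m1 0 0 = Posz n by case: i1.
apply: (run_for b2 (I := I)) => //.
- by rewrite /= n1 PoszM.
- by move=> i m2 m3 E I2 n_gt0; rewrite -E //; apply: I2.
- by move=> n_gt0; exists (Ordinal n_gt0), (Ordinal n_gt0); rewrite /update /= m20.
move=> i m2 lti b2' I2 c2 so2.
have [u [v iE]] := pair_index lti.
have n_gt0 : 0 < n by apply: leq_ltn_trans (ltn_ord u).
have i2 : instance m2 by apply: instance_outside so2 _ i1.
have [u0 [v0 [E20 le]]] := I2 n_gt0.
have E10 : m2 10 0 = Posz (u * n + v) by rewrite c2 iE.
have Emax := eval_num_max i2 E20 E10; have Ecur := eval_num_max i2 E10 E20.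
apply: (wp_if (t := 1) (x := (numq (w u0 v0) * denq (w u v) + 1)%R) b2' _ _ Ecur); first by ok.
  by rewrite -Emax.
have -> : (numq (w u0 v0) * denq (w u v) + 1 <= numq (w u v) * denq (w u0 v0))%R =
          (w u0 v0 < w u v)%R by rewrite lezD1 lt_numq_denq.
have last_index (u' v' : 'I_n) : u' * n + v' < i.+1 -> u' * n + v' < i \/ (u' = u /\ v' = v).
  by rewrite ltnS leq_eqVlt => /predU1P[|]; [rewrite iE => /pair_index_inj; right | left].
case: ltP => [lt|ge].
  apply: (wp_set (z := Posz i)) => //; first by apply: leq_trans small_n2; apply: ltnW.
  move=> _; exists u, v; split; first by rewrite -iE.
  move=> u' v' /last_index[/le|[-> ->] //]; by move/le_trans; apply; apply: ltW.
exists m2; first exact: run_skip.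
by move=> _; exists u0, v0; split=> // u' v' /last_index[/le|[-> ->] //].
Qed.

Definition round_time := n * n * (3 + 3) + 5.

Lemma wp_round_weights m (u0 v0 : 'I_n) : bounded m -> instance m -> m 20 0 = Posz (u0 * n + v0) ->
  (forall u v, w u v <= w u0 v0)%R ->
  wp (round_weights K) m round_time (fun m' => m' 0 0 = Posz n /\
    forall u v : 'I_n, m' 4 (Posz (u * n + v)) = Posz (rounded (K * n) (w u0 v0) (w u v))).
Proof.
move=> bm im E20 max.
pose r' u v := rounded (K * n) (w u0 v0) (w u v).
pose I i (m1 : memory) := forall u v : 'I_n, u * n + v < i -> m1 4 (Posz (u * n + v)) = Posz (r' u v).
have n0 : m 0 0 = Posz n by case: im.
suff [m' r'' I'] : wp (round_weights K) m round_time (I (n * n)).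
  by exists m' => //; split=> [|u v]; [case: r'' => _ -> | exact/I'/pair_lt].
apply: (run_for b2 (t := 3) (I := I)) => //.
- by rewrite /= n0 PoszM.
- by move=> i m2 m3 E I2 u v lt; rewrite -E //; apply: I2.
move=> i m2 lti b2' I2 c2 so2.
have [u [v iE]] := pair_index lti.
have i2 : instance m2 by apply: instance_outside so2 _ im.
have E20' : m2 20 0 = Posz (u0 * n + v0) by rewrite so2.
have E10 : m2 10 0 = Posz (u * n + v) by rewrite c2 iE.
apply: (wp_cons (i := Posz i) (z := Posz (r' u v))) => //.
- by ok.
- rewrite -roundedE // /rounded_quotient -(eval_num_max i2 E10 E20') -(eval_num_max i2 E20' E10).
  by rewrite PoszM; case: i2 => n2 _ _; rewrite /= n2.
- by apply: leq_trans small_Kn; apply: rounded_le; rewrite w_ge0 max.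
move=> b3; apply: wp_nil => // u' v'; rewrite ltnS leq_eqVlt /update /= eqz_nat.
by case: eqVneq => [|_ /= /I2 //]; rewrite iE => /pair_index_inj[-> ->].
Qed.

(** Without vertices there is no heaviest edge for cell 20 to name, and the loop is empty. *)
Lemma wp_round_weights0 m : n = 0 -> bounded m -> m 0 0 = Posz n ->
  wp (round_weights K) m round_time (fun m' => m' 0 0 = Posz n).
Proof.
move=> n0 bm m0.
apply: (run_for b2 (t := 3) (I := fun _ m' => m' 0 0 = Posz n)) => //.
- by rewrite /= m0 PoszM.
- by move=> i m2 m3 E; rewrite -E.
by move=> i m1; rewrite n0.
Qed.

End Weights.

End Correctness.

Section WeightBounds.

Variables (n k M : nat) (r : 'I_n -> 'I_n -> nat).
Hypothesis nk : n = 4 * k.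
Hypothesis rM : forall u v, r u v <= M.
Notation pos := ('I_k * 'I_4)%type.

Lemma ends_weight_le (s : pos -> 'I_n) : ends_weight r s <= k * (2 * M).
Proof.
rewrite -[k in leqRHS]card_ord -sum_nat_const; apply: leq_sum => P _.
by rewrite mul2n -addnn leq_add.
Qed.

Lemma mids_weight_le (s : pos -> 'I_n) : mids_weight r s <= k * M.
Proof. by rewrite -[k in leqRHS]card_ord -sum_nat_const; apply: leq_sum. Qed.

Lemma ends_weight_le_all (s : pos -> 'I_n) : ends_weight r s <= M * n.
Proof. by apply: leq_trans (ends_weight_le s) _; rewrite nk; nia. Qed.

Lemma mids_weight_le_all (s : pos -> 'I_n) : mids_weight r s <= M * n.
Proof. by apply: leq_trans (mids_weight_le s) _; rewrite nk; nia. Qed.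

Lemma objective_le A C B (s : pos -> 'I_n) : A <= B -> C <= B -> objective r A C s <= B * (M * n).
Proof.
move=> AB CB; apply: leq_trans (leq_add (leq_mul AB (ends_weight_le s)) (leq_mul CB (mids_weight_le s))) _.
by rewrite -mulnDr leq_mul2l nk; apply/orP; right; nia.
Qed.

End WeightBounds.

Section Program.

Variables (n k c K b : nat).
Hypothesis nk : n = 4 * k.
Hypothesis c_gt0 : 0 < c.

Definition total_weight := K * n * n.
Definition ends_factor := total_weight + 1.
Definition pass_count := ends_factor * total_weight + 1.
(** Dominates all loop bounds, factors and objective values. Taking it as a bit length is generous
    but still polynomial; the base [n.+1] makes all powers monotone in the exponent. *)
Definition value_bound := n * n + n.+1 ^ (2 * c) + pass_count + 2 * c + K + 4.

Hypothesis value_b : value_bound <= b.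

Let b2 : 2 <= b. Proof. by apply: leq_trans value_b; rewrite /value_bound; lia. Qed.

Let small_le x : x <= value_bound -> small b (Posz x).
Proof.
move=> le; apply: small_nat; apply: leq_trans (leq_trans le value_b) _.
by rewrite ltnW // ltn_expl.
Qed.

Let pass_count_le : pass_count <= value_bound.
Proof. by rewrite /value_bound; lia. Qed.

Variable w : 'I_n -> 'I_n -> rat.
Hypothesis w_ge0 : forall u v, (0 <= w u v)%R.
Notation pos := ('I_k * 'I_4)%type.

Definition rounded_table (r : 'I_n -> 'I_n -> nat) := (forall u v, r u v <= K * n) /\
  (0 < n -> exists u0 v0, (forall u v, (w u v <= w u0 v0)%R) /\
    forall u v, r u v = rounded (K * n) (w u0 v0) (w u v)).

Definition is_result (r : 'I_n -> 'I_n -> nat) (sb : {ffun pos -> 'I_n}) :=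
  [/\ rounded_table r, injective sb &
   forall A C, (A, C) \in [:: (ends_factor, 1); (1, ends_factor); (1, 1)] ->
   exists2 s : {ffun pos -> 'I_n}, injective s /\ local_optimum r c A C s &
     objective r 1 1 s <= objective r 1 1 sb].

Definition total_time :=
  let ph := phase_time n c (n ^ (2 * c)) pass_count in
  find_max_time n + (round_time n + (power_time c + (7 + (identity_time n +
    (ph + (ph + ph + 1) + 1) + 1) + 1) + 1) + 1) + 1.

Lemma wp_local_search m : bounded b m -> instance w m ->
  wp b (local_search_program c K) m total_time
    (fun m' => exists r sb, is_result r sb /\ holds m' 3 sb).
Proof.
move=> bm im.
have pc : total_weight <= pass_count /\ ends_factor <= pass_count.
  by rewrite /pass_count /ends_factor; nia.
have small_c : small b c by apply: small_le; rewrite /value_bound; lia.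
have small_n : small b n by apply: small_le; rewrite /value_bound; nia.
have small_c2 : small b (2 * c)%N by apply: small_le; rewrite /value_bound; lia.
have small_n2 : small b (n * n)%N by apply: small_le; rewrite /value_bound; lia.
have small_K : small b K by apply: small_le; rewrite /value_bound; lia.
have small_Kn : small b (K * n)%N.
  by apply: small_le; move: pc; rewrite /value_bound /total_weight; nia.
have small_B : small b ends_factor by apply: small_le; rewrite /value_bound; lia.
have small_N : small b pass_count by apply: small_le; rewrite /value_bound; lia.
have powers i : i <= 2 * c -> n ^ i <= n.+1 ^ (2 * c).
  move=> le; apply: leq_trans (leq_pexp2l (ltn0Sn n) le).
  by case: i le => // i _; rewrite leq_exp2r.
have small_powers i : i <= 2 * c -> small b (Posz (n ^ i)).
  by move=> /powers le; apply: small_le; rewrite /value_bound; lia.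
have small_T : small b (Posz (n ^ (2 * c))) by apply: small_powers.
have small1 : small b 1 by apply: (@small_lit _ b2 1).
have ok0 : ok_expr b (Const 0) by rewrite /ok_expr /= small0.
have ok1 : ok_expr b (Const 1) by rewrite /ok_expr /= small1.
have oks a : ok_expr b (scalar a) by rewrite /ok_expr /= small0.
apply: (wp_seq b2 (Q1 := at_max w)); first exact: (wp_find_max b2 nk small_c small_n small_c2 small_n2 small_Kn small_K).
move=> m1 r1 b1 max1; have i1 := instance_run r1 isT im.
pose Q1 (m' : memory) := exists r, table r m' /\ rounded_table r.
apply: (wp_seq b2 (Q1 := Q1)).
  have [n0|n_gt0] := posnP n.
    have m0 : m1 0 0 = Posz n by case: i1.
    apply: wp_imp (wp_round_weights0 b2 K small_n2 n0 b1 m0) _ => m' m'0.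
    exists (fun _ _ => 0); split; first by split=> // -[i lti]; exfalso; rewrite n0 in lti.
    by split=> // n_gt0; exfalso; rewrite n0 in n_gt0.
  have [u0 [v0 [E20 max]]] := max1 n_gt0.
  apply: wp_imp (wp_round_weights b2 nk small_c small_n small_c2 w_ge0 small_n2 small_Kn small_K b1 i1 E20 max) _.
  move=> m' t'; exists (fun u v => rounded (K * n) (w u0 v0) (w u v)); split=> //.
  split=> [u v|_]; first by apply: rounded_le; rewrite w_ge0 max.
  by exists u0, v0.
move=> m2 r2 b2' [r [t2 rt]]; have i2 := instance_run r2 isT i1.
have obj_le A C B (s : {ffun pos -> 'I_n}) : A <= B -> C <= B -> B <= ends_factor -> small b (Posz (objective r A C s)).
  move=> AB CB BE; apply: small_le.
  apply: leq_trans (objective_le nk rt.1 s AB CB) _.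
  have le1 : B * total_weight <= pass_count by rewrite /pass_count addn1 leqW // leq_mul2r BE orbT.
  exact: leq_trans le1 pass_count_le.
apply: (wp_seq b2 (Q1 := fun m' => m' 22 0 = Posz (n ^ (2 * c)))).
  by apply: wp_power => //; case: i2.
move=> m3 r3 b3 T3; have i3 := instance_run r3 isT i2; have t3 := table_run r3 isT t2.
pose Q3 (m' : memory) := ready r (n ^ (2 * c)) pass_count ends_factor m' /\ m' 24 0 = Posz 0.
have n3 : m3 0 0 = Posz n by case: i3.
have okK : ok_expr b (bound_expr K) by rewrite /ok_expr /= small_K.
apply: (wp_seq b2 (Q1 := Q3)).
  apply: (wp_cons b2 (i := 0) (z := Posz ends_factor)) => //.
  - by rewrite /ok_expr /= small_K small1.
  - by rewrite /= n3 /ends_factor /total_weight PoszD !PoszM.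
  move=> b4; apply: (wp_cons b2 (i := 0) (z := Posz pass_count)) => //.
  - by rewrite /ok_expr /= small_K small1.
  - by rewrite /= /update /= n3 /pass_count /total_weight PoszD !PoszM.
  move=> b5; apply: (wp_cons b2 (i := 0) (z := 0)) => // b6.
  by apply: wp_nil => //; split=> //; split=> //; case: t3.
move=> m4 r4 b4 [rm4 m24]; have n4 : m4 0 0 = Posz n by case: rm4 => -[].
have idn (q : pos) : code q < n by rewrite nk code_lt.
pose s0 := identity_layout idn.
apply: (wp_seq b2 (Q1 := fun m' => holds m' 5 s0 /\ holds m' 3 s0)).
  exact: wp_set_identity.
move=> m5 r5 b5 [h55 h53]; have rm5 := ready_run r5 isT rm4.
(* The value of the initial layout is never computed; the recorded 0 is a lower bound. *)
have best5 : best_state r s0 0 m5 by split=> //; case: r5 => _ -> //.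
have s0I : injective s0 := @identity_layout_inj n k idn.
have E21 B (m' : memory) : m' 21 0 = Posz B -> eval m' (scalar 21) = Posz B by [].
have E1 B (m' : memory) : m' 21 0 = Posz B -> eval m' (Const 1) = Posz 1 by [].
have B1 : 1 <= ends_factor by rewrite /ends_factor addn1.
have so11 (s : {ffun pos -> 'I_n}) : small b (Posz (objective r 1 1 s)) by apply: (@obj_le _ _ 1).
apply: (wp_seq b2); first apply: (wp_phase b2 nk small_c small_n erefl small_T c_gt0 small_N
  (@E21 _) (@E1 _) _ _ small_B small1 _ so11 b5 rm5 h55 best5) => //.
  by move=> s; apply: (@obj_le _ _ ends_factor).
move=> m6 r6 b6 [h6 [sb6 [F6 [best6 F6' v6 sb6E]]]]; have rm6 := ready_run r6 isT rm5.
apply: (wp_seq b2); first apply: (wp_phase b2 nk small_c small_n erefl small_T c_gt0 small_N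
  (@E1 _) (@E21 _) _ _ small1 small_B _ so11 b6 rm6 h6 best6) => //.
  by move=> s; apply: (@obj_le _ _ ends_factor).
move=> m7 r7 b7 [h7 [sb7 [F7 [best7 F7' v7 sb7E]]]]; have rm7 := ready_run r7 isT rm6.
apply: wp_imp (wp_phase b2 nk small_c small_n erefl small_T c_gt0 small_N
  (@E1 _) (@E1 _) ok1 ok1 small1 small1 so11 so11 b7 rm7 h7 best7) _.
move=> m8 [_ [sb8 [F8 [[h8 _ best8] F8' v8 sb8E]]]].
have cV : #|'I_n| = 4 * k by rewrite card_ord.
(* [pass_count] exceeds the largest possible value of each objective, so the passes end in a local
   optimum. *)
have opt A C (s : {ffun pos -> 'I_n}) : A <= ends_factor -> C <= ends_factor -> injective s ->
    injective (iter pass_count (pass r c A C) s) /\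
    local_optimum r c A C (iter pass_count (pass r c A C) s).
  move=> AB CB sI; split; first exact: iter_pass_inj.
  apply: iter_pass_optimum => // s' _; rewrite /pass_count addn1 ltnS.
  by apply: leq_trans (objective_le nk rt.1 s' AB CB) _; rewrite -/total_weight.
have [s1I o1] := opt ends_factor 1 s0 (leqnn _) B1 s0I.
have [s2I o2] := opt 1 ends_factor _ B1 (leqnn _) s1I.
have [s3I o3] := opt 1 1 _ B1 B1 s2I.
exists r, sb8; split=> //; split=> //.
  have I6 : injective sb6 by case: sb6E => ->.
  have I7 : injective sb7 by case: sb7E => ->.
  by case: sb8E => ->.
have f6 := leq_trans v6 (leq_trans F7' (leq_trans F8' best8)).
have f7 := leq_trans v7 (leq_trans F8' best8); have f8 := leq_trans v8 best8.
move=> A C; rewrite !inE => /or3P[] /eqP[-> ->].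
- by exists (iter pass_count (pass r c ends_factor 1) s0).
- by exists (iter pass_count (pass r c 1 ends_factor) (iter pass_count (pass r c ends_factor 1) s0)).
by exists (iter pass_count (pass r c 1 1) (iter pass_count (pass r c 1 ends_factor)
   (iter pass_count (pass r c ends_factor 1) s0))).
Qed.

End Program.

Definition polynomially_bounded (f : nat -> nat) := exists p : {poly nat}, forall x, f x = p.[x]%R.

Lemma poly_const a : polynomially_bounded (fun _ => a).
Proof. by exists a%:P%R => x; rewrite hornerC. Qed.

Lemma poly_id : polynomially_bounded id.
Proof. by exists 'X%R => x; rewrite hornerX. Qed.

Lemma poly_add f g : polynomially_bounded f -> polynomially_bounded g ->
  polynomially_bounded (fun x => f x + g x).
Proof. by move=> [p pE] [q qE]; exists (p + q)%R => x; rewrite hornerD pE qE. Qed.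

Lemma poly_mul f g : polynomially_bounded f -> polynomially_bounded g ->
  polynomially_bounded (fun x => f x * g x).
Proof. by move=> [p pE] [q qE]; exists (p * q)%R => x; rewrite hornerM pE qE. Qed.

Lemma poly_exp f e : polynomially_bounded f -> polynomially_bounded (fun x => f x ^ e).
Proof.
move=> pf; elim: e => [|e IH]; first exact: poly_const 1.
have [p pE] := poly_mul pf IH; exists p => x; by rewrite -pE expnS.
Qed.

Lemma poly_succ f : polynomially_bounded f -> polynomially_bounded (fun x => (f x).+1).
Proof. by move=> /poly_add /(_ (poly_const 1))[p pE]; exists p => x; rewrite -pE addn1. Qed.

Ltac poly := repeat match goal with
  | |- polynomially_bounded (fun x => ?a) => exact: poly_const
  | |- polynomially_bounded (fun x => x) => exact: poly_id
  | |- polynomially_bounded (fun x => addn (@?f x) (@?g x)) => apply: (@poly_add f g)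
  | |- polynomially_bounded (fun x => muln (@?f x) (@?g x)) => apply: (@poly_mul f g)
  | |- polynomially_bounded (fun x => expn (@?f x) ?e) => apply: (@poly_exp f e)
  | |- polynomially_bounded (fun x => (@?f x).+1) => apply: (@poly_succ f)
  end.

(** The coefficients are natural numbers; monotonicity allows bounds in the number of vertices to be
    restated in the input size. *)
Lemma poly_mono f x y : polynomially_bounded f -> x <= y -> f x <= f y.
Proof.
move=> [p pE] xy; rewrite !pE !horner_coef; elim/big_ind2: _ => // [a b a' b'|i _]; first exact: leq_add.
have E (z : nat) : (z ^+ i)%R = z ^ i by elim: (nat_of_ord i) => // j; rewrite exprS expnS => ->.
by rewrite !E leq_mul2l; case: (nat_of_ord i) => [|j]; rewrite ?expn0 ?leqnn ?leq_exp2r ?xy ?orbT.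
Qed.

Lemma poly_value_bound c K : polynomially_bounded (fun x => value_bound x c K).
Proof. by rewrite /value_bound /pass_count /ends_factor /total_weight; poly. Qed.

Lemma poly_total_time c K : polynomially_bounded (fun x => total_time x c K).
Proof.
rewrite /total_time /find_max_time /round_time /power_time /identity_time /phase_time
  /objective_time /passes_time /pass_time /try_time /copy_time /swaps_time
  /pass_count /ends_factor /total_weight /objective_time.
by cbv beta zeta; poly.
Qed.

(** The bit bound [x + value_bound x c K] accommodates both the input entries and the computed
    values. *)
Lemma poly_program_time c K : polynomially_bounded (fun x =>
  total_time x c K * unit_cost (x + value_bound x c K)).
Proof.
apply: (poly_mul (poly_total_time c K)); rewrite /unit_cost; poly; exact: poly_value_bound.
Qed.

(** * From layouts to packings *)

Local Open Scope ring_scope.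

Section Packings.

Variable G : metric_graph.
Notation n := (nvertices G).
Notation w := (@weight G).
Notation path4 := (4.-tuple 'I_n).

Definition layout_weight k (o : {ffun 'I_k * 'I_4 -> 'I_n}) := \sum_P path_total o w P.

Lemma path_weight4 (p : path4) : path_weight p =
  w (tnth p i0) (tnth p i1) + w (tnth p i1) (tnth p i2) + w (tnth p i2) (tnth p i3).
Proof.
case: p => -[|a [|b [|c [|d []]]]] //= sz.
rewrite /path_weight /path_edges /= !big_cons big_nil /= addr0 addrA.
by rewrite !(tnth_nth a).
Qed.

Definition layout_path k (s : {ffun 'I_k * 'I_4 -> 'I_n}) j : path4 :=
  [tuple s (j, i0); s (j, i1); s (j, i2); s (j, i3)].

Lemma tnth_layout_path k (s : {ffun 'I_k * 'I_4 -> 'I_n}) j i : tnth (layout_path s j) i = s (j, i).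
Proof. by elim/ord4P: i. Qed.

Definition layout_packing k (s : {ffun 'I_k * 'I_4 -> 'I_n}) := [set layout_path s j | j : 'I_k].

Lemma mem_layout_path k (s : {ffun 'I_k * 'I_4 -> 'I_n}) j v :
  reflect (exists i, v = s (j, i)) (v \in layout_path s j).
Proof.
apply: (iffP idP) => [/tnthP[i ->]|[i ->]]; first by exists i; rewrite tnth_layout_path.
by rewrite -tnth_layout_path mem_tnth.
Qed.

Lemma layout_path_inj k (s : {ffun 'I_k * 'I_4 -> 'I_n}) : injective s -> injective (layout_path s).
Proof.
move=> sI j j' E; have := congr1 (fun p : path4 => tnth p i0) E.
by rewrite !tnth_layout_path => /sI[].
Qed.

Lemma layout_packing_weight k (s : {ffun 'I_k * 'I_4 -> 'I_n}) : injective s ->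
  packing_weight (layout_packing s) = layout_weight s.
Proof.
move=> sI; rewrite /packing_weight big_imset /=; last by move=> j j' _ _; apply: layout_path_inj.
by apply: eq_bigr => j _; rewrite path_weight4 !tnth_layout_path.
Qed.

Lemma layout_packingP k (s : {ffun 'I_k * 'I_4 -> 'I_n}) : n = (4 * k)%N -> injective s ->
  four_path_packing (layout_packing s).
Proof.
move=> nk sI; apply/and4P; split.
- by rewrite card_imset ?card_ord //; [rewrite nk mulKn | exact: layout_path_inj].
- apply/forall_inP => p /imsetP[j _ ->]; rewrite /four_path /=.
  by rewrite !inE !(inj_eq sI) /= !xpair_eqE !eqxx.
- apply/forall_inP => p /imsetP[j _ ->]; apply/forall_inP => q /imsetP[j' _ ->].
  apply/implyP => ne; apply/pred0P => v /=; apply/negbTE/negP => /andP[].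
  move=> /mem_layout_path[i ->] /mem_layout_path[i' /sI[jj _]].
  by rewrite jj eqxx in ne.
apply/forallP => v.
have cV : #|'I_n| = (4 * k)%N by rewrite card_ord.
have sB : bijective s by apply: inj_card_bij sI _; rewrite cV card_prod !card_ord mulnC.
have [g _ gK] := sB; apply/exists_inP; exists (layout_path s (g v).1); first exact: imset_f.
by apply/mem_layout_path; exists (g v).2; rewrite -surjective_pairing gK.
Qed.

Lemma packing_layout k (P : {set path4}) : #|P| = k -> four_path_packing P ->
  exists2 o : {ffun 'I_k * 'I_4 -> 'I_n}, injective o & layout_weight o = packing_weight P.
Proof.
move=> <- /and4P[_ /forall_inP paths /forall_inP dis _].
pose o : {ffun 'I_#|P| * 'I_4 -> 'I_n} := [ffun q => tnth (enum_val q.1) q.2].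
exists o.
  move=> [j i] [j' i']; rewrite !ffunE /= => E.
  have [jj|ne] := eqVneq j j'; last first.
    have /forall_inP/(_ _ (enum_valP j')) := dis _ (enum_valP j).
    rewrite (inj_eq enum_val_inj) ne /= => /pred0P/(_ (tnth (enum_val j) i)).
    by rewrite /= mem_tnth E mem_tnth.
  move: E; rewrite jj => E; congr (_, _).
  exact: (tuple_uniqP _ (paths _ (enum_valP j'))) E.
rewrite /layout_weight /packing_weight [RHS]big_enum_val; apply: eq_bigr => j _.
by rewrite path_weight4 /path_total !ffunE.
Qed.

Lemma opt_le (x : rat) : 0 <= x ->
  (forall P : {set path4}, four_path_packing P -> packing_weight P <= x) -> opt G <= x.
Proof.
move=> x0 H; rewrite /opt; elim/big_ind: _ => // a b ax bx.
by rewrite ge_max ax bx.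
Qed.

Lemma leq_bitsize (z : int) : (absz z <= 2 ^ bitsize z)%N.
Proof.
rewrite /bitsize; apply: leq_trans (leqnSn _) _; apply: leq_trans (up_logP _ (leqnn 2)) _.
by rewrite leq_exp2l.
Qed.

Lemma entry_bitsize_le (u v : 'I_n) :
  (bitsize (numq (w u v)) + bitsize (denq (w u v)) <= input_size G)%N.
Proof.
rewrite /input_size (bigD1 u) //= (bigD1 v) //=.
by rewrite -!addnA; apply: leq_trans (leq_addl _ _); rewrite addnA leq_addr.
Qed.

Lemma nvertices_le : (n <= input_size G)%N.
Proof.
rewrite /input_size; apply: leq_trans (leq_addl _ _).
rewrite -[X in (X <= _)%N]card_ord -sum1_card; apply: leq_sum => u _.
by rewrite (bigD1 u) //= -!addnA addSn.
Qed.

Lemma table_cellE (f : 'I_n -> 'I_n -> int) (u v : 'I_n) : table_cell f (Posz (u * n + v)) = f u v.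
Proof.
have n_gt0 : (0 < n)%N by apply: leq_ltn_trans (ltn_ord u).
rewrite /table_cell divnMDl // divn_small // addn0 modnMDl modn_small //.
by rewrite !valK.
Qed.

Lemma input_instance : instance w (input G).
Proof. by split=> // u v; rewrite /input table_cellE. Qed.

Lemma input_bounded b : (input_size G <= b)%N -> bounded b (input G).
Proof.
move=> le; have sm z : (bitsize z <= input_size G)%N -> small b z.
  by move=> lz; apply: leq_trans (leq_bitsize z) _; rewrite leq_exp2l // (leq_trans lz).
have cell (f : 'I_n -> 'I_n -> int) i : (forall u v, (bitsize (f u v) <= input_size G)%N) ->
    small b (table_cell f i).
  move=> fb; rewrite /table_cell; case: i => // i.
  by case: insubP => // u _ _; case: insubP => // v _ _; apply: sm.
case=> [|[|[|a]]] i //=.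
- by case: ifP => // _; apply: sm; rewrite /input_size leq_addr.
- by apply: cell => u v; apply: leq_trans (entry_bitsize_le u v); rewrite leq_addr.
by apply: cell => u v; apply: leq_trans (entry_bitsize_le u v); rewrite leq_addl.
Qed.

End Packings.

(** * Choice of the constants and the final ratio *)

Lemma local_search_run c K G : (0 < c)%N -> (4 %| nvertices G)%N ->
  exists m t, [/\ exec (local_search_program c K) (input G) m t,
    (t <= total_time (input_size G) c K * unit_cost (input_size G + value_bound (input_size G) c K))%N &
    exists r (sb : {ffun 'I_(nvertices G %/ 4) * 'I_4 -> 'I_(nvertices G)}),
      is_result c K (@weight G) r sb /\ holds m 3 sb].
Proof.
move=> c0 dn; set S := input_size G.
have nk : nvertices G = (4 * (nvertices G %/ 4))%N by rewrite mulnC divnK.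
have vb : (value_bound (nvertices G) c K <= S + value_bound S c K)%N.
  by apply: leq_trans (leq_addl _ _); apply: poly_mono (poly_value_bound c K) (nvertices_le G).
have bi : bounded (S + value_bound S c K) (input G) by apply: input_bounded; rewrite leq_addr.
have [m [_ _ [t ex le]] res] := wp_local_search nk c0 vb (@weight_ge0 G) bi (input_instance G).
exists m, t; split=> //; apply: leq_trans le _; rewrite leq_mul2r.
by rewrite (poly_mono (poly_total_time c K) (nvertices_le G)) orbT.
Qed.

Lemma search_constants : exists (L c K : nat) (e : rat),
  [/\ (8 * L + 16 <= c)%N, (0 < c)%N, 10 * 10 * 10 <= L%:R :> rat, K%:R = 10 * 10 * 10 :> rat &
   [/\ 0 < e, e <= 1, e * (10 * 10 * 10) = 1 &
       forall k : nat, e * (e * (2 * k)%:R) < 4 -> (4 * k <= c)%N]].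
Proof.
(* The constant is known only through its rational value, so that no large unary number is ever
   computed. *)
have [L LE] : exists L : nat, L%:R = 10 * 10 * 10 :> rat by exists (10 * 10 * 10)%N; rewrite !natrM.
have [e eE] : exists e : rat, e * (10 * 10 * 10) = 1 by exists (10 * 10 * 10)^-1; lra.
have e2 : e = 1 / (10 * 10 * 10) by lra.
(* [L] also serves as [K]. The term [8 * L * L] covers the small instances: [e^2 * 2k < 4] means
   [k < 2 * L^2]. *)
exists L, (8 * L * L + (8 * L + 16))%N, L, e; split; [exact: leq_addl | | | exact: LE |].
- by rewrite addn_gt0 [X in _ || X]addn_gt0 !orbT.
- rewrite LE; exact: lexx.
split; [lra | lra | exact: eE | move=> k].
rewrite -(ler_nat rat) !natrD !natrM LE e2 => lt; lra.
Qed.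

Section Ratio.

Variables (G : metric_graph) (k : nat).
Hypothesis nk : nvertices G = (4 * k)%N.
Notation n := (nvertices G).
Notation w := (@weight G).
Notation layout := {ffun 'I_k * 'I_4 -> 'I_n}.
Implicit Types s o : layout.

Lemma path_total_ge0 o P : 0 <= path_total o w P.
Proof. by rewrite /path_total !addr_ge0 ?weight_ge0. Qed.

Lemma layout_weight_ge0 o : 0 <= layout_weight o.
Proof. by apply: sumr_ge0 => P _; apply: path_total_ge0. Qed.

Lemma heaviest_layout s : injective s ->
  exists2 o : layout, injective o & forall o' : layout, injective o' -> layout_weight o' <= layout_weight o.
Proof.
move=> /injectiveP sI; case: (@Order.TotalTheory.arg_maxP _ _ _ s (fun o => injectiveb o) (@layout_weight G k) sI).
by move=> o /injectiveP oI max; exists o => // o' /injectiveP; apply: max.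
Qed.

(** Shows that the heaviest edge lies on some packing, so its weight is at most the optimum. *)
Lemma layout_through s (P : 'I_k) u v : injective s -> u != v ->
  exists2 o : layout, injective o & o (P, i0) = u /\ o (P, i1) = v.
Proof.
move=> sI uv; have sB : bijective s.
  by apply: inj_card_bij sI _; rewrite card_prod !card_ord nk mulnC.
have [g _ gK] := sB.
pose t1 := tperm (P, i0) (g u).
pose t2 := tperm (P, i1) (t1 (g v)).
have t1v : t1 (g v) != (P, i0).
  apply: contra_neq uv => E; have : g v = t1 (P, i0) by rewrite -E tpermK.
  by rewrite tpermL => /(congr1 s); rewrite !gK.
exists [ffun q => s (t1 (t2 q))]; first by move=> q q'; rewrite !ffunE => /sI/perm_inj/perm_inj.
rewrite !ffunE; split; last by rewrite tpermL tpermK gK.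
by rewrite [t2 _]tpermD ?tpermL ?gK // xpair_eqE andbF.
Qed.

Lemma opt_le_layout_weight s o : injective s -> (forall o' : layout, injective o' -> layout_weight o' <= layout_weight o) ->
  opt G <= layout_weight o.
Proof.
move=> sI max; apply: opt_le; first exact: layout_weight_ge0.
move=> P PP; have cP : #|P| = k by case/and4P: PP => /eqP -> _ _ _; rewrite nk mulKn.
by have [o' o'I <-] := packing_layout cP PP; apply: max.
Qed.

Lemma rounding_unit (K m : nat) (x : rat) : 0 < (K * m)%:R :> rat ->
  m%:R * (x / (K * m)%:R) * K%:R = x.
Proof. by move=> gt0; rewrite mulrAC -natrM mulnC mulrC divfK // lt0r_neq0. Qed.

Lemma search_result_ratio c L K (e : rat) (r : 'I_n -> 'I_n -> nat) s :
  is_result c K w r s -> (0 < K)%N -> (8 * L + 16 <= c)%N -> 0 < e -> e <= 1 ->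
  10 * 10 * 10 <= L%:R :> rat -> K%:R = 10 * 10 * 10 :> rat -> e * (10 * 10 * 10) = 1 ->
  (e * (e * (2 * k)%:R) < 4 -> (4 * k <= c)%N) ->
  14 / 17 * opt G <= layout_weight s.
Proof.
move=> [[rK rE] sI res] K0 Lc e0 e1.
have [o oI omax] := heaviest_layout sI.
have opt_o := opt_le_layout_weight sI omax.
have trivial_case : layout_weight o <= 0 -> 14 / 17 * opt G <= layout_weight s.
  by move=> o0; have := layout_weight_ge0 s; have := le_trans opt_o o0; lra.
have [n0|n_gt0] := posnP n.
  have k0 : k = 0%N by move: n0; rewrite nk; case: (k).
  move=> _ _ _ _; apply: trivial_case; rewrite /layout_weight big1 // => -[j lt]; exfalso; by rewrite k0 in lt.
have [u0 [v0 [max {}rE]]] := rE n_gt0.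
set wm := w u0 v0 in max rE; have wm0 : 0 <= wm := weight_ge0 u0 v0.
have [wmE|wmN] := eqVneq wm 0.
  have le0 x y : w x y <= 0 by have := max x y; rewrite wmE.
  move=> _ _ _ _; apply: trivial_case; apply: sumr_le0 => P _; rewrite /path_total.
  have := le0 (o (P, i0)) (o (P, i1)); have := le0 (o (P, i1)) (o (P, i2)).
  by have := le0 (o (P, i2)) (o (P, i3)); lra.
have wmp : 0 < wm by rewrite lt_def wmN.
have k_gt0 : (0 < k)%N by have := n_gt0; rewrite nk muln_gt0.
have Kn0 : 0 < (K * n)%:R :> rat by rewrite ltr0n muln_gt0 K0.
(* With this unit the total rounding error is a small fraction of [wm], hence of the optimum:
   [4 * k * u * K = wm]. *)
pose u := wm / (K * n)%:R; have u0' : 0 < u by rewrite divr_gt0.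
have r_le x y : (r x y)%:R * u <= w x y.
  rewrite rE /u mulrA ler_pdivrMr //.
  by case: (rounded_bounds (K * n) wm0 wmp (weight_ge0 x y)).
have r_gt x y : w x y < (r x y).+1%:R * u.
  rewrite rE /u mulrA ltr_pdivlMr //.
  by case: (rounded_bounds (K * n) wm0 wmp (weight_ge0 x y)).
have rC x y : r x y = r y x by rewrite !rE weight_sym.
have cV : #|'I_n| = (4 * k)%N by rewrite card_ord.
have lt_factor x : (x <= K * n * n)%N -> (x < ends_factor n K)%N.
  by rewrite /ends_factor /total_weight addn1.
have ends_lt (s' : layout) : injective s' -> (ends_weight r s' < ends_factor n K)%N.
  by move=> _; apply: lt_factor; apply: ends_weight_le_all.
have mids_lt (s' : layout) : injective s' -> (mids_weight r s' < ends_factor n K)%N.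
  by move=> _; apply: lt_factor; apply: mids_weight_le_all.
have [s1 [s1I opt1] le1] := res _ _ (mem_head _ _).
have [s2 [s2I opt2] le2] : exists2 s2 : layout, injective s2 /\
    local_optimum r c 1 (ends_factor n K) s2 & (objective r 1 1 s2 <= objective r 1 1 s)%N.
  by apply: res; rewrite !inE eqxx orbT.
have [s3 [s3I opt3] le3] : exists2 s3 : layout, injective s3 /\
    local_optimum r c 1 1 s3 & (objective r 1 1 s3 <= objective r 1 1 s)%N.
  by apply: res; rewrite !inE eqxx !orbT.
have wm_o : wm <= layout_weight o.
  have uv : u0 != v0 by apply: contra_neq wmN => E; rewrite /wm E weight_diag.
  have [o' o'I [E0 E1]] := layout_through (Ordinal k_gt0) sI uv.
  apply: le_trans (omax _ o'I); rewrite /layout_weight (bigD1 (Ordinal k_gt0)) //=.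
  rewrite {1}/path_total E0 E1 -/wm -!addrA lerDl !addr_ge0 ?weight_ge0 //.
  by apply: sumr_ge0 => P _; apply: path_total_ge0.
have le_s : (objective r 1 1 s)%:R * u <= layout_weight s.
  rewrite /objective !mul1n natrD mulrDl /ends_weight /mids_weight !natr_sum !mulr_suml -big_split.
  apply: ler_sum => P _; rewrite /= natrD mulrDl /path_total.
  have := r_le (s (P, i0)) (s (P, i1)); have := r_le (s (P, i1)) (s (P, i2)).
  by have := r_le (s (P, i2)) (s (P, i3)); lra.
have unitE : 4 * k%:R * u * K%:R = wm.
  by rewrite -[4 * k%:R](natrM _ 4 k) -nk rounding_unit.
move=> L10 K10 e10 kc; rewrite K10 in unitE.
have ratio := local_search_ratio cV (@weight_sym G) (@weight_ge0 G) (@weight_triangle G) rC u0' r_le r_gt Lc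
  ends_lt mids_lt e0 e1 s1I s2I s3I oI opt1 opt2 opt3 le1 le2 le3 L10 e10 kc.
rewrite unitE in ratio; clear L10 K10 e10 kc unitE.
have ratio_ge0 : 0 <= 14 / 17 :> rat by lra.
exact: le_trans (ler_wpM2l ratio_ge0 opt_o) (le_trans (ratio wm_o) le_s).
Qed.

End Ratio.

Theorem mainTheorem10 :
  exists A : cmd, polynomial_time A /\ approximation_algorithm (14 / 17) A.
Proof.
have [L [c [K [e [Lc c0 L10 K10 [e0 e1 e10 kc]]]]]] := search_constants.
have K0 : (0 < K)%N by rewrite -(ltr_nat rat) K10 !mulr_gt0.
exists (local_search_program c K); split.
  have [p pE] := poly_program_time c K; exists p => G dn.
  have [m [t [ex le _]]] := local_search_run K c0 dn.
  exists m, t; split; first exact: ex.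
  rewrite -pE; exact: le.
move=> G dn; have [m [t [ex _ [r [s [res h]]]]]] := local_search_run K c0 dn.
have nk : nvertices G = (4 * (nvertices G %/ 4))%N by rewrite mulnC divnK.
have sI : injective s by case: res.
exists m, t, (layout_packing s); split; [exact: ex | | exact: layout_packingP |].
  by exists (layout_path s) => [j i|]; [rewrite tnth_layout_path -h | ].
rewrite layout_packing_weight; last exact: sI.
exact: (search_result_ratio nk res K0 Lc e0 e1 L10 K10 e10 (kc _)).
Qed.
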